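(* Let $\ell$ be a positive integer. As $x \to \infty$ we have the following: (a) $\#\{ p \leq x : \phi(p-\ell) > \phi(p+\ell) \} \sim \frac{1}{2}\pi(x)$; (b) $\#\{ p \leq x : \phi(p-\ell) < \phi(p+\ell) \} \sim \frac{1}{2}\pi(x)$; (c) $\#\{ p \leq x : \phi(p-\ell) = \phi(p+\ell) \} = o(\pi(x))$. Here $p$ ranges over odd primes with $p > \ell$.
   Context: $\phi$ is the Euler totient function, $\pi(x)$ is the number of primes at most $x$, and $f(x) \sim g(x)$ means $f(x)/g(x) \to 1$ as $x \to \infty$. The letter $p$ always denotes an odd prime. The integer $\ell$ is fixed as $x \to \infty$. *)

(* Defs.v *)
From mathcomp Require Import all_boot all_order all_algebra.
From mathcomp Require Import all_classical all_reals all_analysis.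

Set Implicit Arguments.
Unset Strict Implicit.
Unset Printing Implicit Defensive.

Import Order.TTheory GRing.Theory Num.Theory.
Import numFieldNormedType.Exports.

Local Open Scope classical_set_scope.
Local Open Scope ring_scope.

(* Lets the notation f =o_ F g infer the filter structure of F = pinfty_nbhs R. *)
Canonical pinfty_filter_on (R : realType) :=
  FilterType (pinfty_nbhs R) (@filter_filter _ _ proper_pinfty_nbhs).

Section Counting.
Context {R : realType}.

(* The bound Num.truncn x (the integer part of x, or 0 if x < 0) only makes the
   range finite: it excludes no n <= x, as card_upto_mem shows. *)
Definition card_upto (P : pred nat) (x : R) : nat :=
  size [seq n <- iota 0 (Num.truncn x).+1 | P n && (n%:R <= x)].

Lemma card_upto_mem (P : pred nat) (x : R) (n : nat) :
  (n \in [seq n <- iota 0 (Num.truncn x).+1 | P n && (n%:R <= x)])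
  = P n && (n%:R <= x).
Proof.
rewrite mem_filter mem_iota add0n leq0n /= andb_idr// => /andP[_ nx].
by rewrite ltnS truncn_ge_nat// (le_trans _ nx).
Qed.

Definition prime_pi (x : R) : R := (card_upto prime x)%:R.

Definition odd_prime_count (P : pred nat) (x : R) : R :=
  (card_upto (fun p => [&& prime p, odd p & P p]) x)%:R.

Definition asymp (f g : R -> R) : Prop := f x / g x @[x --> +oo] --> (1 : R).

End Counting.

(* Main.v *)
Require Import Defs.
From mathcomp Require Import all_boot all_order all_algebra.
From mathcomp Require Import all_classical all_reals all_analysis.
From mathcomp Require Import zify ring lra.

Set Implicit Arguments.
Unset Strict Implicit.
Unset Printing Implicit Defensive.

Import Order.TTheory GRing.Theory Num.Theory.
Import numFieldNormedType.Exports.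

Local Open Scope classical_set_scope.
Local Open Scope ring_scope.

(* Since ln (phi n) = ln n + \sum_(r | n) ln (1 - 1/r), the sign of
   phi (p - l) - phi (p + l) is, up to an error O(1/p), that of
   \sum_r lam r * ([r | p + l] - [r | p - l]), with lam r = - ln (1 - 1/r).
   Primes r > y contribute little for most p, by a Chebyshev bound for primes
   in progressions that is uniform in the modulus. The part h with r <= y
   depends only on p modulo the product M of the primes up to y, and
   h (- a) = - h a. So equidistribution of the primes among the classes
   coprime to M makes both signs equally frequent, provided h is rarely small.
   It is: the values of \sum_(r <= w) s_r * lam r with s_r in {-1, 0, 1} are
   distinct by unique factorization, hence separated, and each pattern (s_r)
   occurs in a proportion at most \prod_r (r - 3)/(r - 1) of the classes.
     Equidistribution is proved without characters, for functions g of mean 0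
   on the unit classes. The map taking g to the function b |-> L(1, g(b .)) is
   injective: on its kernel the limiting densities of the classes, with respect
   to the weights vonM n / n, satisfy a maximum principle that forces a real
   character with L(1, chi) = 0. Being then surjective, it gives
   \sum_(n <= N) g n * vonM n / n = O(1). Fed into Selberg's inequality, this
   shows by a contraction argument that \sum_(n <= N) g n * vonM n = o(N). *)

(** * Arithmetic functions *)

(** Equidistribution for a fixed modulus reaches only primes r <= y with y constant, while p + l and
    p - l have prime factors of all sizes. The tail r > y must be small against the width d of the
    window in which h counts as small, so d is fixed before y, and anticoncentration must hold with
    one d for all large y. It is stated for all translates of h because each further prime merely
    translates the value. The kernel of g |-> L(1, g(b .)) stands for the characters with L(1, chi)
    = 0, and so only real functions occur. If it is nonzero, the limiting density is not uniform,
    and its deviation f from uniformity lies in the kernel too. There the density average of the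
    translates of f is - f; at an extremum of f this leaves no room. Selberg's inequality alone
    reproduces a bound |psi_g N| <= al N with the same al. The gain comes from those n for which
    psi_g (N / n) is small: as the sums with weights vonM n / n stay bounded, psi_g cannot keep one
    sign and order N on long intervals, so such n carry a fixed share of the logarithmic weight. *)

Section ArithmeticFunctions.
Context {R : realType}.
Implicit Types (p d m n k N : nat).

(** Splitting off the whole power of the least prime leaves a cofactor prime to it, the form in
    which [mobius] and [vonM] are computable. *)
Lemma pfactor_ind (P : nat -> Prop) :
  P 1%N ->
  (forall p k m, prime p -> (0 < k)%N -> (0 < m)%N -> ~~ (p %| m)%N -> P m ->
     P (p ^ k * m)%N) ->
  forall n, (0 < n)%N -> P n.
Proof.
move=> P1 Pind; elim/ltn_ind => n IH n0.
have [n1|n1] := leqP n 1; first by have -> : n = 1%N by lia.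
have pr := pdiv_prime n1.
have [m cm nE] := pfactor_coprime pr n0.
have k0 : (0 < logn (pdiv n) n)%N.
  by rewrite logn_gt0 mem_primes pr n0 pdiv_dvd.
have m0 : (0 < m)%N by move: n0; rewrite nE muln_gt0 => /andP[].
have pk : (1 < pdiv n ^ logn (pdiv n) n)%N.
  by rewrite -(exp1n (logn (pdiv n) n)) ltn_exp2r// prime_gt1.
rewrite {1}nE mulnC; apply: Pind => //.
  by rewrite -prime_coprime.
by apply: IH => //; rewrite nE; nia.
Qed.

Lemma sum_divisors_pfactor (F : nat -> R) p k m :
  prime p -> (0 < m)%N -> ~~ (p %| m)%N ->
  \sum_(d <- divisors (p ^ k * m)) F d =
  \sum_(d <- divisors m) \sum_(0 <= i < k.+1) F (p ^ i * d)%N.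
Proof.
move=> pp m0 pm; rewrite exchange_big /=.
have p0 := prime_gt0 pp.
have cop d : d \in divisors m -> coprime p d.
  rewrite -dvdn_divisors// => dm; move: pm.
  by rewrite -prime_coprime//; apply: coprime_dvdr.
transitivity (\sum_(d <- [seq (p ^ i * d)%N | i <- index_iota 0 k.+1,
                          d <- divisors m]) F d); last by rewrite big_allpairs_dep.
apply: perm_big; apply: uniq_perm; first exact: divisors_uniq.
  have : uniq (index_iota 0 k.+1) by exact: iota_uniq.
  move: (index_iota _ _) => r ur.
  apply: allpairs_uniq; rewrite ?divisors_uniq//.
  move=> [i d] [j e] /allpairsP[[i' d'] [/= _ dm [-> ->]]].
  move=> /allpairsP[[j' e'] [/= _ em [-> ->]]] E.
  have dd := cop _ dm; have ee := cop _ em.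
  have : logn p (p ^ i' * d') = logn p (p ^ j' * e') by rewrite E.
  have d0 : (0 < d')%N by apply: (dvdn_gt0 m0); rewrite dvdn_divisors.
  have e0 : (0 < e')%N by apply: (dvdn_gt0 m0); rewrite dvdn_divisors.
  rewrite !lognM ?expn_gt0 ?p0// !pfactorK// (logn_coprime dd) (logn_coprime ee) !addn0.
  move=> ij; move: E; rewrite ij => /eqP; rewrite eqn_pmul2l ?expn_gt0 ?p0//.
  by move=> /eqP ->.
move=> x; apply/idP/allpairsP.
  rewrite -dvdn_divisors ?muln_gt0 ?expn_gt0 ?p0// => xd.
  have x0 : (0 < x)%N by apply: dvdn_gt0 xd; rewrite ?muln_gt0 ?expn_gt0 ?p0.
  have [d cd xE] := pfactor_coprime pp x0.
  exists (logn p x, d); split => /=; last by rewrite mulnC.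
    rewrite mem_index_iota /= ltnS.
    have : (p ^ logn p x %| p ^ k * m)%N.
      by apply: dvdn_trans xd; rewrite {2}xE dvdn_mull.
    rewrite Gauss_dvdl; first by rewrite dvdn_Pexp2l// prime_gt1.
    by rewrite coprimeXl// prime_coprime.
  rewrite -dvdn_divisors//.
  have : (d %| p ^ k * m)%N by apply: dvdn_trans xd; rewrite xE dvdn_mulr.
  by rewrite Gauss_dvdr// coprimeXr// coprime_sym.
case=> -[i d] /= [ik dm ->]; move: ik dm; rewrite mem_index_iota /= ltnS => ik.
rewrite -!dvdn_divisors ?muln_gt0 ?expn_gt0 ?p0//= => dm.
by apply: dvdn_mul => //; rewrite dvdn_exp2l.
Qed.

Lemma sum_dvdn_mul (G : nat -> R) d N : (0 < d)%N ->
  \sum_(1 <= n < N.+1 | (d %| n)%N) G n =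
  \sum_(1 <= k < (N %/ d).+1) G (d * k)%N.
Proof.
move=> d0; rewrite -(big_map (fun k => (d * k)%N) predT G) -[LHS]big_filter.
apply: perm_big; apply: uniq_perm.
- by rewrite filter_uniq// iota_uniq.
- by rewrite map_inj_uniq ?iota_uniq// => x y /eqP; rewrite eqn_pmul2l// => /eqP.
move=> x; rewrite mem_filter mem_index_iota; apply/idP/mapP.
  move=> /andP[/dvdnP[k ->]] /andP[k1 k2]; exists k; last by rewrite mulnC.
  by rewrite mem_index_iota ltnS leq_divRL//; move: k1 k2; case: k => //=; lia.
move=> [k]; rewrite mem_index_iota ltnS leq_divRL// => /andP[k1 k2] ->.
by rewrite dvdn_mulr//= ltnS (mulnC d) k2 muln_gt0 d0 k1.
Qed.

Lemma sum_divisors_le (F : nat -> R) n N : (0 < n <= N)%N ->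
  \sum_(d <- divisors n) F d = \sum_(1 <= d < N.+1 | (d %| n)%N) F d.
Proof.
move=> /andP[n0 nN]; rewrite -[RHS]big_filter; apply: perm_big; apply: uniq_perm.
- exact: divisors_uniq.
- by rewrite filter_uniq// iota_uniq.
move=> d; rewrite mem_filter mem_index_iota -dvdn_divisors// ltnS.
case dn: (d %| n)%N => //=; apply/esym/andP; split; first exact: dvdn_gt0 dn.
by apply: leq_trans nN; apply: dvdn_leq.
Qed.

Lemma sum_divisors_exchange (F : nat -> nat -> R) N :
  \sum_(1 <= n < N.+1) \sum_(d <- divisors n) F d (n %/ d)%N =
  \sum_(1 <= d < N.+1) \sum_(1 <= k < (N %/ d).+1) F d k.
Proof.
transitivity (\sum_(1 <= n < N.+1) \sum_(1 <= d < N.+1 | (d %| n)%N) F d (n %/ d)%N).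
  by rewrite big_nat [RHS]big_nat; apply: eq_bigr => n; rewrite ltnS => nN; exact: sum_divisors_le.
rewrite (exchange_big_dep_nat predT)//= big_nat [RHS]big_nat.
apply: eq_bigr => d /andP[d0 dN].
by rewrite sum_dvdn_mul//; apply: eq_bigr => k _; rewrite mulKn.
Qed.

Definition mobius n : R := \prod_(p <- primes n) (if logn p n == 1%N then -1 else 0).

(** The von Mangoldt function: n is a positive power of a prime exactly when [primes n] is a
    singleton. *)
Definition vonM n : R := if primes n is [:: p] then ln p%:R else 0.

Lemma mobius_le1 n : `|mobius n| <= 1.
Proof.
rewrite /mobius; elim: (primes n) => [|p s IH]; first by rewrite big_nil normr1.
rewrite big_cons normrM mulr_ile1//.
by case: ifP; rewrite ?normrN ?normr1 ?normr0.
Qed.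

Lemma primes_pfactor_mul p k m : prime p -> (0 < k)%N -> (0 < m)%N -> ~~ (p %| m)%N ->
  perm_eq (primes (p ^ k * m)) (p :: primes m).
Proof.
move=> pp k0 m0 pm; have p0 := prime_gt0 pp.
apply: uniq_perm; rewrite /= ?primes_uniq ?andbT//.
  by rewrite mem_primes (negbTE pm) !andbF.
by move=> x; rewrite primesM ?expn_gt0 ?p0// primesX// primes_prime// !inE.
Qed.

Lemma mobius_pfactor p i d : prime p -> (0 < d)%N -> ~~ (p %| d)%N ->
  mobius (p ^ i * d) = (if i is 0 then 1 else if i is 1 then -1 else 0) * mobius d.
Proof.
move=> pp d0 pd; have p0 := prime_gt0 pp.
case: i => [|i]; first by rewrite expn0 !mul1n mul1r.
rewrite /mobius (perm_big _ (primes_pfactor_mul pp _ d0 pd))//= big_cons.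
rewrite lognM ?expn_gt0 ?p0// pfactorK// logn_coprime ?prime_coprime// addn0.
congr (_ * _); first by case: i.
rewrite big_seq [RHS]big_seq; apply: eq_bigr => q; rewrite mem_primes => /and3P[qp _ qd].
rewrite lognM ?expn_gt0 ?p0// lognX (logn_prime _ pp) (_ : (q == p) = false) ?muln0//.
by apply: contraNF pd => /eqP <-.
Qed.

Lemma sum_mobius_mul (F : nat -> R) p k m : prime p -> (0 < k)%N -> (0 < m)%N ->
  ~~ (p %| m)%N ->
  \sum_(d <- divisors (p ^ k * m)) mobius d * F d =
  \sum_(d <- divisors m) mobius d * (F d - F (p * d)%N).
Proof.
move=> pp k0 m0 pm; rewrite sum_divisors_pfactor//.
rewrite big_seq [RHS]big_seq; apply: eq_bigr => d.
rewrite -dvdn_divisors// => dm.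
have d0 : (0 < d)%N by apply: dvdn_gt0 dm.
have pd : ~~ (p %| d)%N by apply: contra pm => /dvdn_trans; apply.
case: k k0 => // k _.
rewrite big_nat_recl//= big_nat_recl//= big1_seq ?addr0; last first.
  by move=> i _; rewrite mobius_pfactor// !mul0r.
by rewrite !mobius_pfactor// expn0 mul1n expn1; ring.
Qed.

Lemma sum_mobius n : (0 < n)%N -> \sum_(d <- divisors n) mobius d = (n == 1)%N%:R.
Proof.
move=> n0; elim/pfactor_ind: n / n0 => [|p k m pp k0 m0 pm _].
  by rewrite big_seq1 /mobius big_nil.
have := sum_mobius_mul (fun=> 1) pp k0 m0 pm.
under eq_bigr do rewrite mulr1.
move=> ->; rewrite big1 => [|d _]; last by rewrite subrr mulr0.
rewrite muln_eq1 (_ : (p ^ k == 1)%N = false)//.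
by apply/negbTE; rewrite neq_ltn orbC -(exp1n k) ltn_exp2r// prime_gt1.
Qed.

Lemma vonM_pfactor p i d : prime p -> (0 < d)%N -> ~~ (p %| d)%N ->
  vonM (p ^ i * d) = (if i is 0 then vonM d else if d == 1%N then ln p%:R else 0).
Proof.
move=> pp d0 pd; have p0 := prime_gt0 pp.
case: i => [|i]; first by rewrite expn0 !mul1n.
have := primes_pfactor_mul (k := i.+1) pp isT d0 pd.
rewrite /vonM; case: eqVneq => [->|d1].
  by move=> /perm_small_eq->.
have : (pdiv d) \in primes d by rewrite mem_primes pdiv_prime ?d0 ?pdiv_dvd//; lia.
by move=> + /perm_size; case: (primes d) => //= ? ? _; case: (primes _) => //= ? [].
Qed.

Lemma vonM1 : vonM 1 = 0. Proof. by []. Qed.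

Lemma vonM_prime p : prime p -> vonM p = ln p%:R.
Proof. by move=> pp; rewrite /vonM primes_prime. Qed.

Lemma vonM_ge0 n : 0 <= vonM n.
Proof.
rewrite /vonM; case E : (primes n) => [//|p []//].
have : p \in primes n by rewrite E inE.
by rewrite mem_primes => /andP[/prime_gt0 p0 _]; rewrite ln_ge0// ler1n.
Qed.

Lemma sum_vonM n : (0 < n)%N -> \sum_(d <- divisors n) vonM d = ln n%:R.
Proof.
move=> n0; elim/pfactor_ind: n / n0 => [|p k m pp k0 m0 pm IH].
  by rewrite big_seq1 vonM1 ln1.
rewrite sum_divisors_pfactor//.
transitivity (\sum_(d <- divisors m) (vonM d + (d == 1)%N%:R * (k%:R * ln p%:R))).
  rewrite big_seq [RHS]big_seq; apply: eq_bigr => d.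
  rewrite -dvdn_divisors// => dm.
  have d0 : (0 < d)%N by apply: dvdn_gt0 dm.
  have pd : ~~ (p %| d)%N by apply: contra pm => /dvdn_trans; apply.
  rewrite big_nat_recl//= vonM_pfactor//; congr (_ + _).
  under eq_bigr => i _ do rewrite vonM_pfactor//.
  rewrite sumr_const_nat subn0; by case: eqP => _; rewrite ?mul1r ?mul0r ?mulr0 ?mulr_natl ?mul0rn.
have p0 := prime_gt0 pp.
rewrite big_split /= IH natrM lnM ?posrE ?ltr0n ?expn_gt0 ?p0//.
rewrite addrC; congr (_ + _); rewrite -mulr_suml natrX lnXn ?ltr0n//.
rewrite -[ln _ *+ _]mulr_natl -[RHS]mul1r; congr (_ * _).
rewrite (bigD1_seq 1%N) ?divisors_uniq -?dvdn_divisors//= big1 ?addr0// => i /negbTE->//.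
Qed.

(** Since [sum_mobius] kills the constant ln x for n > 1, what remains is Moebius inversion of
    [sum_vonM]. On p ^ k * m only the pairs d, p * d survive, and their logarithms differ by ln
    p. *)
Lemma sum_mobius_ln (x : R) n : 0 < x -> (0 < n)%N ->
  \sum_(d <- divisors n) mobius d * ln (x / d%:R) = (n == 1)%N%:R * ln x + vonM n.
Proof.
move=> x0 n0; elim/pfactor_ind: n / n0 => [|p k m pp k0 m0 pm _].
  by rewrite big_seq1 vonM1 mul1r divr1 /mobius big_nil mul1r addr0.
rewrite sum_mobius_mul//.
transitivity (\sum_(d <- divisors m) mobius d * ln p%:R).
  rewrite big_seq [RHS]big_seq; apply: eq_bigr => d.
  rewrite -dvdn_divisors// => dm.
  have d0 : (0 < d)%N by apply: dvdn_gt0 dm.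
  have p0 := prime_gt0 pp.
  congr (_ * _); rewrite !ln_div ?posrE ?ltr0n ?muln_gt0 ?p0//.
  by rewrite natrM lnM ?posrE ?ltr0n//; ring.
rewrite -mulr_suml sum_mobius// vonM_pfactor// muln_eq1.
rewrite (_ : (p ^ k == 1)%N = false) ?mul0r ?add0r; last first.
  by apply/negbTE; rewrite neq_ltn orbC -(exp1n k) ltn_exp2r// prime_gt1.
by case: k k0 => // k _; case: eqP; rewrite ?mul1r ?mul0r.
Qed.

End ArithmeticFunctions.

(** * Chebyshev and Mertens estimates, and the Tatuzawa-Iseki inequality *)

Section Estimates.
Context {R : realType}.
Implicit Types (d m n k N K : nat) (x y : R).

Lemma ln_le_subr1 x : 0 < x -> ln x <= x - 1.
Proof. by move=> x0; rewrite -[X in ln X](subrKC 1 x) le_ln1Dx//; lra. Qed.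

Lemma ln_ge_1subV x : 0 < x -> 1 - x^-1 <= ln x.
Proof.
move=> x0; have := @ln_le_subr1 x^-1; rewrite invr_gt0 lnV ?posrE// => /(_ x0); lra.
Qed.

Lemma ln_succ_bounds n : (0 < n)%N ->
  n.+1%:R^-1 <= ln n.+1%:R - ln n%:R :> R /\ ln n.+1%:R - ln n%:R <= n%:R^-1 :> R.
Proof.
move=> n0; have n0' : 0 < n%:R :> R by rewrite ltr0n.
have n1' : 0 < n.+1%:R :> R by rewrite ltr0n.
have nE : n.+1%:R = n%:R + 1 :> R by rewrite -natr1.
rewrite -ln_div ?posrE//; split.
  apply: le_trans (ln_ge_1subV _); last by rewrite divr_gt0.
  by rewrite invf_div nE le_eqVlt; apply/orP; left; apply/eqP; field; lra.
apply: le_trans (ln_le_subr1 _) _; first by rewrite divr_gt0.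
by rewrite nE le_eqVlt; apply/orP; left; apply/eqP; field; lra.
Qed.

Definition harm N : R := \sum_(1 <= n < N.+1) n%:R^-1.

Lemma harmS N : harm N.+1 = harm N + N.+1%:R^-1.
Proof. by rewrite /harm big_nat_recr. Qed.

(** harm - ln decreases, and its steps are bounded by those of 1 / n. Comparing two finite stages
    takes the place of an estimate with Euler's constant. *)
Lemma harm_sub_ln K N : (0 < K <= N)%N ->
  0 <= (harm K - ln K%:R) - (harm N - ln N%:R) <= K%:R^-1 - N%:R^-1.
Proof.
move=> /andP[K0]; elim: N => [|N IH]; first by rewrite leqNgt K0.
rewrite leq_eqVlt => /orP[/eqP<-|KN]; first by rewrite !subrr lexx.
have /andP[h1 h2] := IH KN; have [l1 l2] := @ln_succ_bounds N (leq_trans K0 KN).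
rewrite harmS; move: (N.+1%:R^-1 : R) (ln N.+1%:R : R) l1 l2 h1 h2.
by move=> a b *; apply/andP; split; lra.
Qed.

Lemma harm_ln N : (0 < N)%N -> 0 <= harm N - ln N%:R <= 1.
Proof.
move=> N0; have := @harm_sub_ln 1 N; rewrite N0 => /(_ isT).
rewrite ln1 /harm big_nat1 invr1.
have N0' : 0 < N%:R^-1 :> R by rewrite invr_gt0 ltr0n.
move: (\sum_(_ <= _ < _) _) => h; lra.
Qed.

Definition lnfact N : R := \sum_(1 <= n < N.+1) ln n%:R.

Lemma lnfact_bounds N : (0 < N)%N ->
  N%:R * ln N%:R - N%:R <= lnfact N <= N%:R * ln N%:R - N%:R + 1 + ln N%:R.
Proof.
elim: N => // N IH _; rewrite /lnfact big_nat_recr//= -/(lnfact N).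
case: N IH => [_|N /(_ isT) /andP[]].
  by rewrite /lnfact big_geq// ln1 !mulr0; apply/andP; split; lra.
move: (N.+1) (ltn0Sn N) => {}N N0.
have [l1 l2] := ln_succ_bounds N0.
have N0' : 0 < N%:R :> R by rewrite ltr0n.
have e1 : N%:R * (ln N.+1%:R - ln N%:R) <= 1 :> R.
  by rewrite -(ler_pM2l N0') divff ?gt_eqF// in l2.
have e2 : 1 <= N.+1%:R * (ln N.+1%:R - ln N%:R) :> R.
  have N1' : 0 < N.+1%:R :> R by rewrite ltr0n.
  by rewrite -(ler_pM2l N1') divff ?gt_eqF// in l1.
have nE : N.+1%:R = N%:R + 1 :> R by rewrite -natr1.
move: e1 e2; rewrite nE; move: (ln _) (ln _) => a b e1 e2 h1 h2; apply/andP; split; nra.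
Qed.

Lemma sum_inv_sqrt N : \sum_(1 <= n < N.+1) (Num.sqrt n%:R)^-1 <= 2 * Num.sqrt N%:R :> R.
Proof.
elim: N => [|N IH]; first by rewrite big_geq// sqrtr0 mulr0.
rewrite big_nat_recr//= -[leRHS](subrK (2 * Num.sqrt N%:R)) addrC lerD//.
set a := Num.sqrt N%:R; set b := Num.sqrt N.+1%:R.
have b0 : 0 < b by rewrite sqrtr_gt0 ltr0n.
have a0 : 0 <= a by rewrite sqrtr_ge0.
have ab : b ^+ 2 = a ^+ 2 + 1 by rewrite !sqr_sqrtr ?ler0n// -natr1.
have aleb : a <= b by rewrite -(@ler_pXn2r _ 2)// ?nnegrE ?ltW// ab; lra.
rewrite -(ler_pM2l b0) divff ?gt_eqF//; nra.
Qed.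

(** With z the fourth root of y, 1 + ln y = 1 + 4 ln z <= 4 z, and 16 = 4 ^ 2. *)
Lemma sqr_1Dln_le y : 1 <= y -> (1 + ln y) ^+ 2 <= 16 * Num.sqrt y.
Proof.
move=> y1; set z := Num.sqrt (Num.sqrt y).
have z0 : 0 < z by rewrite !sqrtr_gt0; lra.
have zE : z ^+ 4 = y.
  by rewrite (exprM z 2 2) !sqr_sqrtr ?sqrtr_ge0//; lra.
have -> : Num.sqrt y = z ^+ 2 by rewrite sqr_sqrtr// sqrtr_ge0.
have := ln_le_subr1 z0; have : 0 <= ln y by rewrite ln_ge0.
rewrite -zE lnXn// -mulr_natl; move: (ln z) => l; nra.
Qed.

Lemma ratio_ge1 d N : (1 <= d < N.+1)%N -> 1 <= N%:R / d%:R :> R.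
Proof.
by rewrite ltnS => /andP[d0 dN]; rewrite ler_pdivlMr ?ltr0n// mul1r ler_nat.
Qed.

Lemma sum_sqr_1Dln N : \sum_(1 <= d < N.+1) (1 + ln (N%:R / d%:R)) ^+ 2 <= 32 * N%:R :> R.
Proof.
apply: (@le_trans _ _ (\sum_(1 <= d < N.+1) 16 * Num.sqrt N%:R * (Num.sqrt d%:R)^-1)).
  apply: ler_sum_nat => d dN; apply: le_trans (sqr_1Dln_le (ratio_ge1 dN)) _.
  by rewrite sqrtrM ?ler0n// sqrtrV ?ler0n// mulrA.
rewrite -mulr_sumr; have := sum_inv_sqrt N.
have := @sqr_sqrtr R N%:R; rewrite ler0n => /(_ isT).
have := sqrtr_ge0 (N%:R : R); move: (Num.sqrt N%:R) => a a0 <-.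
move: (\sum_(_ <= _ < _) _) => s; nra.
Qed.

Definition psi N : R := \sum_(1 <= n < N.+1) vonM n.

Lemma psi_ge0 N : 0 <= psi N.
Proof. by apply: sumr_ge0 => n _; exact: vonM_ge0. Qed.

Lemma psiS N : psi N.+1 = psi N + vonM N.+1.
Proof. by rewrite /psi big_nat_recr. Qed.

Lemma lnfact_vonM N : lnfact N = \sum_(1 <= n < N.+1) vonM n * (N %/ n)%:R.
Proof.
rewrite /lnfact; transitivity (\sum_(1 <= n < N.+1) \sum_(d <- divisors n) vonM d : R).
  by rewrite big_nat [RHS]big_nat; apply: eq_bigr => n /andP[n0 _]; rewrite sum_vonM.
rewrite (sum_divisors_exchange (fun d _ => vonM d)); apply: eq_bigr => d _.
by rewrite sumr_const_nat subn1 mulr_natr.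
Qed.

Lemma lnfact_vonM_le K N : (K <= N)%N ->
  lnfact K = \sum_(1 <= n < N.+1) vonM n * (K %/ n)%:R.
Proof.
move=> KN; rewrite lnfact_vonM [RHS](big_cat_nat _ (n := K.+1))//=.
rewrite [X in _ = _ + X]big_nat [X in _ = _ + X]big1 ?addr0// => n /andP[Kn _].
by rewrite divn_small ?mulr0.
Qed.

(** Chebyshev's argument: N %/ n is never below twice N./2 %/ n, and exceeds it by at least 1 for
    N./2 < n <= N. *)
Lemma psi_sub_half N : psi N - psi N./2 <= lnfact N - 2 * lnfact N./2.
Proof.
have hN : (N./2 <= N)%N by lia.
rewrite {1}/psi (big_cat_nat _ (n := N./2.+1))//= -/(psi _) [_ + _ - _]addrC addKr.
rewrite (lnfact_vonM_le hN) lnfact_vonM mulr_sumr -sumrB.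
rewrite [leRHS](big_cat_nat _ (n := N./2.+1))//= -[leLHS]add0r lerD//.
  apply: sumr_ge0 => n _; rewrite mulrCA -mulrBr mulr_ge0 ?vonM_ge0// subr_ge0.
  rewrite -natrM ler_nat; have := leq_divM N./2 n.
  case: n => [|n]; first by rewrite !divn0.
  by move=> h; rewrite leq_divRL//; nia.
apply: ler_sum_nat => n /andP[n1 n2]; rewrite (divn_small n1) !mulr0 subr0.
by rewrite ler_peMr ?vonM_ge0// ler1n divn_gt0//; lia.
Qed.

Lemma psi_ge_sub N : lnfact N - 2 * lnfact N./2 <= psi N.
Proof.
have hN : (N./2 <= N)%N by lia.
rewrite (lnfact_vonM_le hN) lnfact_vonM mulr_sumr -sumrB.
apply: ler_sum_nat => n /andP[n1 n2]; rewrite mulrCA -mulrBr ler_piMr ?vonM_ge0//.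
rewrite lerBlDr -natrM addrC natr1 ler_nat.
have := ltn_ceil (N./2) n1; have := leq_divM N n.
move: (N %/ n)%N (N./2 %/ n)%N => a b h1 h2.
have : (a * n < (2 * b).+2 * n)%N by nia.
by rewrite ltn_mul2r => /andP[]; lia.
Qed.

Lemma half_bounds N : (1 < N)%N -> exists2 e : R,
  0 <= e <= 1 & [/\ N%:R = 2 * (N./2)%:R + e, 0 < (N./2)%:R :> R & 1 <= (N./2)%:R :> R].
Proof.
move=> N1; exists (odd N)%:R; first by case: (odd N); rewrite ?lexx ?ler01.
rewrite ltr0n ler1n; split; try lia.
by rewrite -{1}(odd_double_half N) natrD -mul2n natrM addrC.
Qed.

Lemma psi_le N : psi N <= 8 * N%:R.
Proof.
elim/ltn_ind: N => N IH; have [N1|N1] := leqP N 1.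
  case: N N1 {IH} => [|[|//]] _; first by rewrite /psi big_geq// mulr0.
  by rewrite /psi big_nat1 vonM1 mulr1.
have := IH N./2; rewrite (_ : (N./2 < N)%N = true); last by lia.
move=> /(_ isT); have := psi_sub_half N.
have /andP[_] := @lnfact_bounds N (ltnW N1).
have /andP[+ _] := @lnfact_bounds N./2 (ltac:(lia)).
have [e /andP[e0 e1] [NE K0 K1]] := half_bounds N1.
have N0 : 0 < N%:R :> R by rewrite ltr0n; lia.
have l1 := ln_le_subr1 N0; have l2 := ln_le_subr1 K0.
have lK : 0 <= ln (N./2)%:R :> R by rewrite ln_ge0.
have l3 : ln N%:R - ln (N./2)%:R <= 2 :> R.
  rewrite -ln_div ?posrE//; apply: le_trans (ln_le_subr1 _) _; first by rewrite divr_gt0.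
  by rewrite lerBlDr ler_pdivrMr// NE; lra.
move: l1 l2 lK l3 N0; rewrite NE.
move: (lnfact _) (lnfact _) (psi _) (psi _) (ln _) (ln _) => a b c d f g.
move: (N./2)%:R K0 K1 {NE} => K K0 K1; nra.
Qed.

Lemma psi_lower N : (0 < N)%N -> N%:R / 2 - 3 - 2 * ln N%:R <= psi N.
Proof.
move=> N0; have [N1|N1] := leqP N 1.
  have -> : N = 1%N by lia.
  by rewrite ln1; have := psi_ge0 1; lra.
have := psi_ge_sub N.
have /andP[+ _] := @lnfact_bounds N (ltnW N1).
have /andP[_] := @lnfact_bounds N./2 (ltac:(lia)).
have [e /andP[e0 e1] [NE K0 K1]] := half_bounds N1.
have N0' : 0 < N%:R :> R by rewrite ltr0n.
have lK : 0 <= ln (N./2)%:R :> R by rewrite ln_ge0.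
have l3 : 2^-1 <= ln N%:R - ln (N./2)%:R :> R.
  rewrite -ln_div ?posrE//; apply: le_trans (ln_ge_1subV _); last by rewrite divr_gt0.
  by rewrite invf_div lerBrDr -lerBrDl ler_pdivrMr// NE; lra.
move: lK l3 N0'; rewrite NE.
move: (lnfact _) (lnfact _) (psi _) (ln _) (ln _) => a b c d f.
move: (N./2)%:R K0 K1 {NE} => K K0 K1; nra.
Qed.

Lemma divn_le_ratio n N : (0 < n)%N -> (N %/ n)%:R <= N%:R / n%:R :> R.
Proof.
by move=> n0; rewrite ler_pdivlMr ?ltr0n// -natrM ler_nat leq_divM.
Qed.

Lemma ratio_lt_divn n N : (0 < n)%N -> N%:R / n%:R < (N %/ n)%:R + 1 :> R.
Proof.
by move=> n0; rewrite ltr_pdivrMr ?ltr0n// natr1 -natrM ltr_nat ltn_ceil.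
Qed.

Lemma mertens N : (0 < N)%N ->
  ln N%:R - 1 <= \sum_(1 <= n < N.+1) (vonM n : R) / n%:R <= ln N%:R + 8.
Proof.
move=> N0; set s := \sum_(_ <= _ < _) _.
have N0' : 0 < N%:R :> R by rewrite ltr0n.
have /andP[l u] := lnfact_bounds N0.
have lnN := ln_le_subr1 N0'.
have h1 : lnfact N <= N%:R * s.
  rewrite lnfact_vonM mulr_sumr; apply: ler_sum_nat => n /andP[n0 _].
  by rewrite mulrCA ler_wpM2l ?vonM_ge0// divn_le_ratio.
have h2 : N%:R * s <= lnfact N + psi N.
  rewrite lnfact_vonM mulr_sumr -big_split /=; apply: ler_sum_nat => n /andP[n0 _].
  by rewrite mulrCA -[X in _ <= _ + X]mulr1 -mulrDr ler_wpM2l ?vonM_ge0// ltW// ratio_lt_divn.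
have := psi_le N; move: (N%:R : R) (ln N%:R : R) N0' lnN (psi N) (lnfact N) h1 h2 l u.
by move=> n l n0 nl p t *; rewrite -(ler_pM2l n0) -[X in _ && X](ler_pM2l n0); apply/andP; split; lra.
Qed.

(** Passing from N to N + 1 raises every logarithm by at most 1 / N, hence the sum by at most psi N
    / N <= 8; the new term has logarithm 0. *)
Lemma sum_vonM_ln N : \sum_(1 <= n < N.+1) vonM n * ln (N%:R / n%:R) <= 8 * N%:R :> R.
Proof.
elim: N => [|N IH]; first by rewrite big_geq// mulr0.
rewrite big_nat_recr//= divff ?pnatr_eq0// ln1 mulr0 addr0.
case: N IH => [|N IH]; first by rewrite big_geq// mulr1 ler0n.
apply: (@le_trans _ _ (\sum_(1 <= n < N.+2)
    (vonM n * ln (N.+1%:R / n%:R) + vonM n * (N.+1%:R : R)^-1))).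
  apply: ler_sum_nat => n /andP[n0 _]; rewrite -mulrDr ler_wpM2l ?vonM_ge0//.
  rewrite !ln_div ?posrE ?ltr0n//.
  have [_] := @ln_succ_bounds N.+1 isT.
  by move: (N.+1%:R^-1 : R) (ln N.+2%:R : R) => a b *; lra.
rewrite big_split /= -mulr_suml -/(psi N.+1) -(natr1 N.+1) mulrDr mulr1 lerD//.
by rewrite ler_pdivrMr ?ltr0n// psi_le.
Qed.

(** Weighting the sums over multiples of d by mobius d * ln (N / d) gives F n the coefficient
    computed in [sum_mobius_ln], so both terms on the left come out at once. The error is a sum of
    squares of 1 + ln (N / d), which is O(N); this is why the hypothesis can afford such a factor,
    and the 32 is that of [sum_sqr_1Dln]. *)
Lemma tatuzawa_iseki (F : nat -> R) N (C : R) : (0 < N)%N -> 0 <= C ->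
  (forall d, (1 <= d < N.+1)%N ->
     `|\sum_(1 <= m < (N %/ d).+1) F (d * m)%N| <= C * (1 + ln (N%:R / d%:R))) ->
  `|F 1%N * ln N%:R + \sum_(1 <= k < N.+1) vonM k * F k| <= 32 * C * N%:R.
Proof.
move=> N0 C0 FC; have N0' : 0 < N%:R :> R by rewrite ltr0n.
have -> : F 1%N * ln N%:R + \sum_(1 <= k < N.+1) vonM k * F k =
  \sum_(1 <= d < N.+1) mobius d * ln (N%:R / d%:R) *
     \sum_(1 <= m < (N %/ d).+1) F (d * m)%N.
  transitivity (\sum_(1 <= d < N.+1) \sum_(1 <= m < (N %/ d).+1)
     mobius d * ln (N%:R / d%:R) * F (d * m)%N); last first.
    by apply: eq_bigr => d _; rewrite mulr_sumr.
  rewrite -(sum_divisors_exchange (fun d m => mobius d * ln (N%:R / d%:R) * F (d * m)%N)).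
  transitivity (\sum_(1 <= n < N.+1) ((n == 1)%N%:R * ln N%:R + vonM n) * F n).
    under [RHS]eq_bigr do rewrite mulrDl.
    rewrite big_split /=; congr (_ + _); rewrite big_ltn// mul1r mulrC big_nat big1 ?addr0//.
    by move=> [|[|n]]//; rewrite !mul0r.
  rewrite big_nat [RHS]big_nat; apply: eq_bigr => n /andP[n0 _].
  rewrite -sum_mobius_ln// mulr_suml big_seq [RHS]big_seq; apply: eq_bigr => d.
  by rewrite -dvdn_divisors// mulnC => /divnK->.
apply: le_trans (ler_norm_sum _ _ _) _.
apply: (@le_trans _ _ (\sum_(1 <= d < N.+1) C * (1 + ln (N%:R / d%:R)) ^+ 2)).
  apply: ler_sum_nat => d dN; rewrite !normrM expr2.
  have l0 : 0 <= ln (N%:R / d%:R) :> R by rewrite ln_ge0// ratio_ge1.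
  have := FC _ dN; have := @mobius_le1 R d; rewrite (ger0_norm l0).
  have := normr_ge0 (mobius d : R); have := normr_ge0 (\sum_(1 <= m < (N %/ d).+1) F (d * m)%N).
  move: `|_| `|_| (ln _) l0 => a b l l0 a0 b0 b1 ab.
  apply: (@le_trans _ _ ((1 + l) * b)); first by rewrite ler_wpM2r//; nra.
  by rewrite mulrCA ler_wpM2l//; lra.
rewrite -mulr_sumr -mulrA mulrCA ler_wpM2l//; exact: sum_sqr_1Dln.
Qed.

End Estimates.

(** * Hyperbola sums, Selberg's symmetry formula, partial summation *)

Section Hyperbola.
Context {R : realType}.
Implicit Types (d m n k N K : nat).

Lemma sum_hyperbola_sym (H : nat -> nat -> R) N :
  \sum_(1 <= a < N.+1) \sum_(1 <= b < (N %/ a).+1) H a b =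
  \sum_(1 <= b < N.+1) \sum_(1 <= a < (N %/ b).+1) H a b.
Proof.
have E (G : nat -> R) a : (0 < a)%N ->
    \sum_(1 <= b < (N %/ a).+1) G b = \sum_(1 <= b < N.+1 | (a * b <= N)%N) G b.
  move=> a0; rewrite -[RHS]big_filter; apply: perm_big; apply: uniq_perm.
  - exact: iota_uniq.
  - by rewrite filter_uniq// iota_uniq.
  move=> b; rewrite mem_filter !mem_index_iota !ltnS leq_divRL// mulnC.
  by case: b => [|b]; rewrite ?andbF//=; case: leqP => //= h; apply/esym; nia.
transitivity (\sum_(1 <= a < N.+1) \sum_(1 <= b < N.+1 | (a * b <= N)%N) H a b).
  by rewrite big_nat [RHS]big_nat; apply: eq_bigr => a /andP[a0 _]; exact: E.
rewrite (exchange_big_dep_nat predT)//= big_nat [RHS]big_nat.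
apply: eq_bigr => b /andP[b0 _]; rewrite [RHS]E//.
by apply: eq_bigl => a; rewrite mulnC.
Qed.

Lemma divnS_ratio_ln d N : (1 <= d < N.+1)%N -> ln (N %/ d)%:R <= ln (N%:R / d%:R) :> R.
Proof.
move=> /andP[d0 dN]; have K0 : (0 < N %/ d)%N by rewrite divn_gt0.
by rewrite ler_ln ?posrE ?divr_gt0 ?ltr0n ?divn_le_ratio//; lia.
Qed.

Lemma selberg_full N : (0 < N)%N ->
  `|psi N * ln N%:R + \sum_(1 <= k < N.+1) vonM k * psi (N %/ k) - 2 * N%:R * ln N%:R|
  <= 130 * N%:R :> R.
Proof.
move=> N0; have N0' : 0 < N%:R :> R by rewrite ltr0n.
(* [C] cancels the linear terms in the sum over multiples of d: lnfact K contributes - K, and - N /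
   d * harm K contributes - K * (harm N - ln N), up to errors of order 1 + ln (N / d). *)
pose C : R := 1 + (harm N - ln N%:R).
have [g0 g1] : 0 <= harm N - ln N%:R :> R /\ harm N - ln N%:R <= 1 :> R.
  by apply/andP/harm_ln.
pose F k : R := psi (N %/ k) - N%:R / k%:R + C.
have := @tatuzawa_iseki R F N 3 N0 (ltac:(lra)).
have h d : (1 <= d < N.+1)%N ->
    `|\sum_(1 <= m < (N %/ d).+1) F (d * m)%N| <= 3 * (1 + ln (N%:R / d%:R)).
  move=> dN; have /andP[d0 _] := dN; set K := (N %/ d)%N.
  have K0 : (0 < K)%N by rewrite divn_gt0//; lia.
  have -> : \sum_(1 <= m < K.+1) F (d * m)%N = lnfact K - N%:R / d%:R * harm K + K%:R * C.
    rewrite /F big_split /= sumrB; congr (_ - _ + _).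
    - rewrite lnfact_vonM; transitivity (\sum_(1 <= n < K.+1) \sum_(1 <= k < (K %/ n).+1) vonM k : R).
        by apply: eq_bigr => k _; rewrite divnMA.
      by rewrite sum_hyperbola_sym; apply: eq_bigr => k _; rewrite sumr_const_nat subn1 mulr_natr.
    - by rewrite /harm mulr_sumr; apply: eq_bigr => k _; rewrite natrM invfM mulrA.
    - by rewrite sumr_const_nat subn1 mulr_natl.
  have KN : (0 < K <= N)%N by rewrite K0 leq_div.
  have /andP[a1 a2] := @harm_sub_ln R _ _ KN.
  have /andP[l1 l2] := @lnfact_bounds R _ K0.
  have y1 := @divn_le_ratio R d N d0; have y2 := @ratio_lt_divn R d N d0.
  have lK := divnS_ratio_ln dN.
  have K1 : 1 <= K%:R :> R by rewrite ler1n.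
  have lK0 : 0 <= ln K%:R :> R by rewrite ln_ge0.
  have NV : 0 <= N%:R^-1 :> R by rewrite invr_ge0 ltW.
  have t2 : K%:R * (harm K - ln K%:R - (harm N - ln N%:R)) <= 1 :> R.
    have KV : K%:R * K%:R^-1 = 1 :> R by rewrite divff// gt_eqF//; lra.
    rewrite -[leRHS]KV ler_wpM2l ?ler0n//; lra.
  have KV : K%:R^-1 <= 1 :> R by rewrite invf_le1//; lra.
  rewrite /C; move: y1 y2 lK; rewrite -/K; move: (N%:R / d%:R) (ln (N%:R / d%:R)) => y l y1 y2 lK.
  move: a1 a2 t2 l1 l2; set t := harm K - _ - _.
  have -> : harm K = ln K%:R + (harm N - ln N%:R) + t by rewrite /t; ring.
  move: NV KV lK y1 y2 g0 g1 lK0 K1; move: (K%:R^-1 : R) (N%:R^-1 : R) => kv nv NV KV lK y1 y2.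
  clearbody t C; move: t (lnfact K) (harm N - ln N%:R) (K%:R : R) (ln K%:R : R) lK y1 y2 => t L g k lk lK y1 y2 g0 g1 lk0 k1 a1 a2 t2 l1 l2.
  have -> : L - y * (lk + g + t) + k * (1 + g) =
    (L - (k * lk - k)) - (k * t) - (y - k) * (lk + g + t) by ring.
  have z1 : 0 <= (y - k) * (lk + g + t) by rewrite mulr_ge0//; lra.
  have z2 : (y - k) * (lk + g + t) <= lk + g + t by rewrite ler_piMl//; lra.
  have z3 : 0 <= k * t by rewrite mulr_ge0//; lra.
  by rewrite ler_norml; apply/andP; split; lra.
move=> /(_ h); rewrite {1}/F divn1 divr1.
have -> : \sum_(1 <= k < N.+1) vonM k * F k = \sum_(1 <= k < N.+1) vonM k * psi (N %/ k)
    - N%:R * (\sum_(1 <= k < N.+1) vonM k / k%:R) + C * psi N.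
  rewrite /psi !mulr_sumr -sumrB -big_split /=; apply: eq_bigr => k _.
  rewrite /F -/(psi _); move: (psi _) (vonM k) (k%:R^-1 : R) => a b c; ring.
have /andP[m1 m2] := @mertens R _ N0.
have p := @psi_le R N; have p0 := @psi_ge0 R N; have l := ln_le_subr1 N0'.
have l0 : 0 <= ln N%:R :> R by rewrite ln_ge0// ler1n.
rewrite /C; move: (harm N - ln N%:R) g0 g1 => g g0 g1.
move: (\sum_(1 <= k < N.+1) vonM k * psi _) (\sum_(1 <= k < N.+1) vonM k / _) m1 m2 => S s m1 m2.
move: (N%:R : R) (ln N%:R : R) (psi N) N0' p p0 l l0 m1 m2 => n ln p n0 p1 p2 l1 l2 m1 m2.
rewrite !ler_norml => /andP[h1 h2].
have q1 : 0 <= n * (s - ln + 1) by rewrite mulr_ge0//; lra.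
have q2 : 0 <= n * (ln + 8 - s) by rewrite mulr_ge0//; lra.
have q3 : 0 <= (1 + g) * ln <= 2 * ln by apply/andP; split; nra.
have q4 : 0 <= (1 + g) * p <= 2 * p by apply/andP; split; nra.
case/andP: q3 => q3 q3'; case/andP: q4 => q4 q4'.
by apply/andP; split; lra.
Qed.

Lemma abel_sum (g f : nat -> R) K N : (K <= N)%N ->
  \sum_(K <= n < N.+1) g n * f n = (\sum_(K <= n < N.+1) g n) * f N
    - \sum_(K <= n < N) (\sum_(K <= k < n.+1) g k) * (f n.+1 - f n).
Proof.
elim: N => [|N IH] KN.
  by move: KN; rewrite leqn0 => /eqP->; rewrite !big_nat1 big_geq// subr0.
have [->|KN'] := eqVneq K N.+1; first by rewrite !big_nat1 big_geq// subr0.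
have {}KN : (K <= N)%N by lia.
rewrite big_nat_recr /=; last by lia.
rewrite IH// [\sum_(K <= n < N.+2) _]big_nat_recr /=; last by lia.
rewrite [\sum_(K <= n < N.+1) _ * (_ - _)]big_nat_recr//=; ring.
Qed.

Lemma abel_bound (g f : nat -> R) (B : R) K N : (K <= N)%N ->
  (forall j, (K <= j)%N -> `|\sum_(K <= n < j.+1) g n| <= B) ->
  `|\sum_(K <= n < N.+1) g n * f n| <= B * (`|f N| + \sum_(K <= n < N) `|f n.+1 - f n|).
Proof.
move=> KN gB; rewrite abel_sum//.
apply: le_trans (ler_normB _ _) _; rewrite mulrDr lerD//.
  by rewrite normrM ler_wpM2r// gB.
apply: le_trans (ler_norm_sum _ _ _) _; rewrite mulr_sumr.
by apply: ler_sum_nat => n /andP[n0 _]; rewrite normrM ler_wpM2r// gB.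
Qed.

Lemma abel_decr (g f : nat -> R) (B : R) K N : 0 <= B ->
  (forall j, (K <= j)%N -> `|\sum_(K <= n < j.+1) g n| <= B) ->
  (forall n, (K <= n)%N -> 0 <= f n.+1 <= f n) -> 0 <= f K ->
  `|\sum_(K <= n < N.+1) g n * f n| <= B * f K.
Proof.
move=> B0 gB fd fK; have [NK|KN] := ltnP N K; first by rewrite big_geq// normr0 mulr_ge0.
apply: le_trans (abel_bound f KN gB) _; rewrite ler_wpM2l//.
suff : 0 <= f N /\ f N + \sum_(K <= n < N) `|f n.+1 - f n| = f K.
  by move=> [f0 <-]; rewrite (ger0_norm f0).
elim: N KN => [|N IH] KN.
  by move: KN fK; rewrite leqn0 => /eqP->; rewrite big_geq// addr0.
have [<-|KN'] := eqVneq K N.+1; first by rewrite big_geq// addr0.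
have {}KN : (K <= N)%N by lia.
have [f0 fE] := IH KN; have /andP[f1 f2] := fd _ KN; split => //.
rewrite big_nat_recr//= ler0_norm ?subr_le0// -fE; ring.
Qed.

Lemma abel_incr (g f : nat -> R) (B : R) K N : 0 <= B -> (K <= N)%N ->
  (forall j, (K <= j)%N -> `|\sum_(K <= n < j.+1) g n| <= B) ->
  (forall n, (K <= n)%N -> f n <= f n.+1) -> 0 <= f K ->
  `|\sum_(K <= n < N.+1) g n * f n| <= 2 * B * f N.
Proof.
move=> B0 KN gB fd fK; apply: le_trans (abel_bound f KN gB) _.
rewrite -mulrA mulrCA ler_wpM2l//.
suff : 0 <= f N /\ \sum_(K <= n < N) `|f n.+1 - f n| = f N - f K.
  by move=> [f0 ->]; rewrite (ger0_norm f0); lra.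
elim: N KN => [|N IH] KN.
  by move: KN fK; rewrite leqn0 => /eqP->; rewrite big_geq// subrr.
have [<-|KN'] := eqVneq K N.+1; first by rewrite big_geq// subrr.
have {}KN : (K <= N)%N by lia.
have [f0 fE] := IH KN; have f1 := fd _ KN; split; first exact: le_trans f1.
by rewrite big_nat_recr//= fE ger0_norm ?subr_ge0//; ring.
Qed.

End Hyperbola.

(** * Functions on residue classes *)

Section ResidueFunctions.
Context {R : realType} (q : nat).
Local Notation M := q.+2.
Local Notation Z := 'Z_M.
Implicit Types (g h : Z -> R) (a b c : Z) (n k d N K : nat).

Definition unit_supp g := forall a, a \isn't a GRing.unit -> g a = 0.

(** Unit-supported functions orthogonal to the principal character; they take the place of the
    non-principal characters. *)
Definition mean0 g := unit_supp g /\ \sum_a g a = 0.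

Definition shift c g : Z -> R := fun x => g (c * x).

Definition norm1 g : R := \sum_a `|g a|.

Lemma shift_shift b c g : shift b (shift c g) = shift (c * b) g.
Proof. by rewrite /shift; apply/funext => x; rewrite mulrA. Qed.

Lemma shift1 g : shift 1 g = g.
Proof. by rewrite /shift; apply/funext => x; rewrite mul1r. Qed.

Lemma shift_nonunit c g : unit_supp g -> c \isn't a GRing.unit -> shift c g = fun=> 0.
Proof.
move=> gU cU; apply/funext => x; rewrite /shift gU//.
by apply: contra cU; rewrite unitrM => /andP[].
Qed.

Lemma sum_shift (f : R -> R) c g : c \is a GRing.unit ->
  \sum_a f (shift c g a) = \sum_a f (g a).
Proof.
move=> cU; rewrite [RHS](reindex_inj (h := fun x => c * x))//=.
by apply: can_inj (fun x => c^-1 * x) _ => x; rewrite mulKr.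
Qed.

Lemma unit_supp_shift c g : unit_supp g -> unit_supp (shift c g).
Proof.
move=> gU a aU; rewrite /shift gU//.
by apply: contra aU; rewrite unitrM => /andP[].
Qed.

Lemma mean0_shift c g : mean0 g -> mean0 (shift c g).
Proof.
move=> [gU g0]; split; first exact: unit_supp_shift.
have [cU|cU] := boolP (c \is a GRing.unit); first by rewrite (sum_shift id).
by rewrite shift_nonunit// big1.
Qed.

Lemma norm1_ge0 g : 0 <= norm1 g.
Proof. by apply: sumr_ge0 => a _; exact: normr_ge0. Qed.

Lemma le_norm1 g a : `|g a| <= norm1 g.
Proof.
by rewrite /norm1 (bigD1 a)//= lerDl; apply: sumr_ge0 => b _; exact: normr_ge0.
Qed.

Lemma norm1_shift c g : unit_supp g -> norm1 (shift c g) <= norm1 g.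
Proof.
move=> gU; have [cU|cU] := boolP (c \is a GRing.unit).
  by rewrite /norm1 (sum_shift Num.norm).
by rewrite shift_nonunit// {1}/norm1 normr0 big1//; exact: norm1_ge0.
Qed.

Lemma natr_Z_addM n : (n + M)%:R = n%:R :> Z.
Proof. by rewrite natrD (@pchar_Zp M) ?addr0. Qed.

Lemma sum_residues g : \sum_(0 <= n < M) g n%:R = \sum_a g a.
Proof. by rewrite big_mkord; apply: eq_bigr => a _; rewrite natr_Zp. Qed.

(** Whole periods cancel, and the remaining stretch, shorter than M, meets each class at most
    once. *)
Lemma mean0_partial0 g N : mean0 g -> `|\sum_(0 <= n < N) g n%:R| <= norm1 g.
Proof.
move=> [gU g0]; elim/ltn_ind: N => N IH; have [NM|MN] := ltnP N M.
  apply: le_trans (ler_norm_sum _ _ _) _.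
  rewrite /norm1 -(sum_residues (fun a => `|g a|)).
  rewrite [leRHS](big_cat_nat _ (n := N))//= ?(ltnW NM)// lerDl.
  by apply: sumr_ge0 => n _; exact: normr_ge0.
rewrite (big_cat_nat _ (n := M))//= sum_residues g0 add0r.
rewrite -[q.+2]/(0 + q.+2)%N big_addn.
under eq_bigr do rewrite natr_Z_addM.
by apply: IH; lia.
Qed.

Lemma mean0_partial g K N : mean0 g -> `|\sum_(K <= n < N) g n%:R| <= 2 * norm1 g.
Proof.
move=> gm; have [NK|KN] := leqP N K.
  by rewrite big_geq// normr0 mulr_ge0// norm1_ge0.
have -> : \sum_(K <= n < N) g n%:R = \sum_(0 <= n < N) g n%:R - \sum_(0 <= n < K) g n%:R.
  by rewrite [X in _ = X - _](big_cat_nat _ (n := K))//= ?(ltnW KN)// [_ + _ - _]addrC addKr.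
by apply: le_trans (ler_normB _ _) _; rewrite mulr2n mulrDl mul1r lerD// mean0_partial0.
Qed.

Lemma mean0_ln g N : mean0 g -> (0 < N)%N ->
  `|\sum_(1 <= n < N.+1) g n%:R * ln n%:R| <= 4 * norm1 g * ln N%:R.
Proof.
move=> gm N0; rewrite (_ : 4 * _ = 2 * (2 * norm1 g)); last by ring.
apply: (@abel_incr R (fun n => g n%:R) (fun n => ln n%:R) _ 1) => //.
- by rewrite mulr_ge0// norm1_ge0.
- by move=> j _; exact: mean0_partial.
- by move=> n n0; rewrite ler_ln ?posrE ?ltr0n ?ler_nat.
- by rewrite ln1.
Qed.

Lemma mean0_decr g (f : nat -> R) K N : mean0 g ->
  (forall n, (K <= n)%N -> 0 <= f n.+1 <= f n) -> 0 <= f K ->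
  `|\sum_(K <= n < N.+1) g n%:R * f n| <= 2 * norm1 g * f K.
Proof.
move=> gm fd fK; apply: (@abel_decr R (fun n => g n%:R) f) => //.
- by rewrite mulr_ge0// norm1_ge0.
- by move=> j _; exact: mean0_partial.
Qed.

Definition psig g N : R := \sum_(1 <= n < N.+1) g n%:R * vonM n.

Lemma psig_le g N : `|psig g N| <= norm1 g * psi N.
Proof.
apply: le_trans (ler_norm_sum _ _ _) _; rewrite /psi mulr_sumr.
by apply: ler_sum => n _; rewrite normrM (ger0_norm (vonM_ge0 n)) ler_wpM2r ?vonM_ge0// le_norm1.
Qed.

(** [tatuzawa_iseki] for k |-> psig (shift k g) (N / k). By [sum_vonM] the sum over multiples of d
    is the sum of g (d n) * ln n, which is O(ln (N / d)) because g has mean 0; hence no main term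
    arises. *)
Lemma selberg_mean0 g N : mean0 g -> (0 < N)%N ->
  `|psig g N * ln N%:R + \sum_(1 <= k < N.+1) vonM k * psig (shift k%:R g) (N %/ k)|
    <= 128 * norm1 g * N%:R.
Proof.
move=> gm N0; have ng := norm1_ge0 g.
have := @tatuzawa_iseki R (fun k => psig (shift k%:R g) (N %/ k)) N (4 * norm1 g) N0 (ltac:(lra)).
rewrite shift1 divn1 mulrA (_ : 32 * 4 = 128 :> R); last by ring.
apply => d dN; have /andP[d0 _] := dN; set K := (N %/ d)%N.
have K0 : (0 < K)%N by rewrite divn_gt0//; lia.
have -> : \sum_(1 <= m < K.+1) psig (shift (d * m)%:R g) (N %/ (d * m)) =
    \sum_(1 <= n < K.+1) shift d%:R g n%:R * ln n%:R.
  transitivity (\sum_(1 <= m < K.+1) \sum_(1 <= n < (K %/ m).+1) shift d%:R g (m * n)%:R * vonM n).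
    apply: eq_bigr => m _; rewrite divnMA; apply: eq_bigr => n _.
    by rewrite /shift !natrM mulrA.
  rewrite sum_hyperbola_sym.
  rewrite -(sum_divisors_exchange (fun n m => shift d%:R g (m * n)%:R * vonM n)).
  rewrite big_nat [RHS]big_nat; apply: eq_bigr => n /andP[n0 _].
  rewrite -sum_vonM// mulr_sumr big_seq [RHS]big_seq; apply: eq_bigr => e.
  by rewrite -dvdn_divisors// => /divnK->.
have := @mean0_ln _ K (mean0_shift d%:R gm) K0.
have := norm1_shift d%:R gm.1; have := norm1_ge0 (shift d%:R g).
have := @divnS_ratio_ln R _ _ dN; rewrite -/K.
have : 0 <= ln K%:R :> R by rewrite ln_ge0// ler1n.
move=> l0 ll n0 nn h; apply: le_trans h _.
by apply: ler_pM => //; [lra|lra|lra].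
Qed.

(** The powers of p up to N all divide p ^ v, with v the largest exponent, and the values of [vonM]
    on the divisors of p ^ v sum to ln (p ^ v). *)
Lemma sum_vonM_pdvd p N : prime p -> (0 < N)%N ->
  \sum_(1 <= n < N.+1 | (p %| n)%N) vonM n <= ln N%:R :> R.
Proof.
move=> pp N0; set v := trunc_log p N.
have pv : (p ^ v <= N)%N by rewrite trunc_logP ?prime_gt1.
have pv0 : (0 < p ^ v)%N by rewrite expn_gt0 prime_gt0.
apply: (@le_trans _ _ (ln (p ^ v)%:R)); last first.
  by rewrite ler_ln ?posrE ?ltr0n// ler_nat.
rewrite -sum_vonM// (@sum_divisors_le _ _ _ N) ?pv0//.
rewrite big_mkcond [leRHS]big_mkcond /=; apply: ler_sum_nat => n /andP[n0 nN].
case: ifPn => [pn|_]; last by case: ifP => // _; exact: vonM_ge0.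
case: ifPn => // npv; have [m cm nE] := pfactor_coprime pp n0.
have m0 : (0 < m)%N by move: n0; rewrite nE muln_gt0 => /andP[].
have l0 : (0 < logn p n)%N by rewrite logn_gt0 mem_primes pp n0 pn.
rewrite nE mulnC vonM_pfactor// -?prime_coprime//.
case: (logn p n) nE l0 => // j nE _; case: eqP => // m1.
have : (p ^ j.+1 <= N)%N by move: nN nE; rewrite m1 mul1n => + <-.
move=> h; have : (j.+1 <= v)%N by rewrite trunc_log_max ?prime_gt1.
by move=> jv; move: npv; rewrite nE m1 mul1n dvdn_exp2l.
Qed.

Definition chi0 : Z -> R := fun a => (a \is a GRing.unit)%:R.

Lemma chi0_unit_supp : unit_supp chi0.
Proof. by move=> a; rewrite /chi0 => /negbTE->. Qed.

Lemma chi0_natr n : chi0 n%:R = (coprime M n)%:R.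
Proof. by rewrite /chi0 unitZpE. Qed.

Lemma chi0M a b : chi0 (a * b) = chi0 a * chi0 b.
Proof. by rewrite /chi0 unitrM -natrM mulnb. Qed.

Lemma sum_vonM_noncoprime N : (0 < N)%N ->
  0 <= psi N - psig chi0 N <= (size (primes M))%:R * ln N%:R.
Proof.
move=> N0; rewrite /psi /psig -sumrB.
have E n : vonM n - chi0 n%:R * vonM n = (~~ coprime M n)%:R * vonM n :> R.
  by rewrite chi0_natr; case: coprime; rewrite ?mul1r ?mul0r ?subrr ?subr0.
under eq_bigr do rewrite E; apply/andP; split.
  by apply: sumr_ge0 => n _; rewrite mulr_ge0// vonM_ge0.
apply: (@le_trans _ _ (\sum_(p <- primes M) \sum_(1 <= n < N.+1 | (p %| n)%N) vonM n)).
  rewrite (exchange_big_dep predT)//=; apply: ler_sum_nat => n /andP[n0 nN].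
  case cn: (coprime M n); first by rewrite mul0r sumr_ge0// => p _; exact: vonM_ge0.
  have /hasP[p pM pn] : has (fun p => (p %| n)%N) (primes M).
    have := negbT cn; rewrite coprime_has_primes// negbK => /hasP[p pn pM].
    by apply/hasP; exists p => //; move: pn; rewrite mem_primes => /and3P[].
  rewrite mul1r big_mkcond (bigD1_seq p) ?primes_uniq//= pn lerDl.
  by apply: sumr_ge0 => ? _; case: ifP => // _; exact: vonM_ge0.
apply: (@le_trans _ _ (\sum_(p <- primes M) ln N%:R)); last first.
  by rewrite big_const_seq count_predT iter_addr_0 mulr_natl.
rewrite big_seq [leRHS]big_seq; apply: ler_sum => p; rewrite mem_primes => /and3P[pp _ _]; exact: sum_vonM_pdvd.
Qed.

(** Restricting [selberg_full] to n prime to M discards at most s * ln K from psi K, with s the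
    number of primes dividing M. From [A] to [A1] the inner variable is restricted, from [A1] to
    [A0] the outer one; each change is O(N) by [sum_vonM_ln]. *)
Lemma selberg_chi0 : exists2 C : R, 0 <= C & forall N, (0 < N)%N ->
  `|psig chi0 N * ln N%:R + \sum_(1 <= k < N.+1) vonM k * psig (shift k%:R chi0) (N %/ k)
    - 2 * N%:R * ln N%:R| <= C * N%:R.
Proof.
set s : R := (size (primes M))%:R; have s0 : 0 <= s by rewrite ler0n.
exists (130 + 32 * s) => [|N N0]; first lra.
have N0' : 0 < N%:R :> R by rewrite ltr0n.
have l0 : 0 <= ln N%:R :> R by rewrite ln_ge0// ler1n.
have SF := @selberg_full R _ N0.
set A := \sum_(_ <= _ < _) _ in SF; set A0 := \sum_(_ <= _ < _) _.
have e K : (0 < K)%N -> 0 <= psi K - psig chi0 K <= s * ln K%:R by exact: sum_vonM_noncoprime.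
have vl := @sum_vonM_ln R N.
have p0 K : 0 <= psig chi0 K <= psi K.
  apply/andP; split; last by case: K => [|K]; [rewrite /psig /psi !big_geq | have /andP[] := e K.+1 isT; lra].
  by apply: sumr_ge0 => n _; rewrite mulr_ge0 ?vonM_ge0// ler0n.
have lnle n : (0 < n < N.+1)%N -> s * ln (N %/ n)%:R <= s * ln (N%:R / n%:R).
  by move=> nN; rewrite ler_wpM2l// divnS_ratio_ln.
have lnge n : (0 < n < N.+1)%N -> (0 < N %/ n)%N.
  by move=> /andP[n0 nN]; rewrite divn_gt0//; lia.
have shiftE k n : psig (shift k%:R chi0) n = chi0 k%:R * psig chi0 n.
  by rewrite /psig mulr_sumr; apply: eq_bigr => j _; rewrite /shift chi0M mulrA.
pose A1 : R := \sum_(1 <= k < N.+1) vonM k * psig chi0 (N %/ k).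
have h1 : 0 <= A - A1 <= 8 * s * N%:R.
  rewrite /A /A1 -sumrB; apply/andP; split.
    by apply: sumr_ge0 => k _; rewrite -mulrBr mulr_ge0 ?vonM_ge0// subr_ge0; have /andP[] := p0 (N %/ k)%N.
  apply: (@le_trans _ _ (\sum_(1 <= k < N.+1) s * (vonM k * ln (N%:R / k%:R)))).
    apply: ler_sum_nat => k kN; rewrite -mulrBr mulrCA ler_wpM2l ?vonM_ge0//.
    by apply: le_trans (lnle _ kN); have /andP[] := e _ (lnge _ kN).
  by rewrite -mulr_sumr (mulrC 8) -mulrA ler_wpM2l.
have h2 : 0 <= A1 - A0 <= 8 * s * N%:R.
  have -> : A1 - A0 = \sum_(1 <= n < N.+1) chi0 n%:R * vonM n * (psi (N %/ n) - psig chi0 (N %/ n)).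
    transitivity (\sum_(1 <= k < N.+1) \sum_(1 <= n < (N %/ k).+1)
        (1 - chi0 k%:R) * vonM k * (chi0 n%:R * vonM n)).
      rewrite /A1 /A0 -sumrB; apply: eq_bigr => k _.
      by rewrite shiftE -mulr_sumr -/(psig _ _); ring.
    rewrite sum_hyperbola_sym; apply: eq_bigr => n _.
    rewrite /psi /psig -sumrB mulr_sumr; apply: eq_bigr => k _.
    by ring.
  have c01 n : 0 <= chi0 n%:R <= 1 by rewrite /chi0; case: (_ \is a _); rewrite ?lexx ?ler01.
  apply/andP; split.
    apply: sumr_ge0 => k _; have /andP[c0 _] := c01 k; rewrite !mulr_ge0 ?vonM_ge0// subr_ge0.
    by have /andP[] := p0 (N %/ k)%N.
  apply: (@le_trans _ _ (\sum_(1 <= k < N.+1) s * (vonM k * ln (N%:R / k%:R)))).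
    apply: ler_sum_nat => k kN; have /andP[c0 c1] := c01 k.
    have v0 := @vonM_ge0 R k.
    have /andP[d0 d1] := e _ (lnge _ kN); have d2 := lnle _ kN.
    apply: (@le_trans _ _ (vonM k * (psi (N %/ k) - psig chi0 (N %/ k)))).
      by rewrite ler_wpM2r// ler_piMl.
    by rewrite mulrCA ler_wpM2l//; lra.
  by rewrite -mulr_sumr (mulrC 8) -mulrA ler_wpM2l.
have /andP[e0 e1] := e _ N0.
have h3 : 0 <= (psi N - psig chi0 N) * ln N%:R <= 16 * s * N%:R.
  rewrite mulr_ge0//=.
  have : ln N%:R * ln N%:R <= 16 * N%:R :> R.
    have := @sqr_1Dln_le R N%:R; rewrite ler1n N0 => /(_ isT) q1.
    have q2 : Num.sqrt N%:R <= N%:R :> R.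
      rewrite -[leRHS]sqr_sqrtr ?ler0n// expr2 ler_peMl ?sqrtr_ge0//.
      by rewrite -[leLHS]sqrtr1 ler_sqrt ?ler0n// ler1n.
    by move: q1 q2 l0; move: (ln N%:R) (Num.sqrt _) => a b; nra.
  move=> h; apply: (le_trans (ler_wpM2r l0 e1)).
  by rewrite (mulrC 16) -!mulrA ler_wpM2l.
move: h1 h2 h3 SF => /andP[? ?] /andP[? ?] /andP[? ?].
by rewrite !ler_norml => /andP[? ?]; apply/andP; split; lra.
Qed.

End ResidueFunctions.

(** * The values L(1, g) *)

(** A cluster point in a compact box; what matters is that one N approximates all coordinates at
    once. *)
Lemma bolzano_weierstrass (R : realType) n (v : nat -> 'I_n -> R) (C : R) :
  (forall N b, 0 <= v N b <= C) ->
  exists p : 'I_n -> R, forall e N0, 0 < e ->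
    exists2 N, (N0 <= N)%N & forall b, `|v N b - p b| < e.
Proof.
move=> vC; pose w N : 'rV[R]_n := \row_j v N j.
have cpt := @rV_compact R n (fun=> `[0, C]%classic) (fun=> @segment_compact R 0 C).
have [|p [_ pc]] := cpt (w @ \oo) _.
  by exists 0%N => // N _ i /=; rewrite in_itv /= mxE.
exists (fun b => p ord0 b) => e N0 e0.
have A1 : (w @ \oo) (w @` [set N | (N0 <= N)%N]).
  by exists N0 => // N /= NN; exists N.
have A2 : nbhs p (ball p e) by exact: nbhsx_ballx.
have [_ [[N /= NN <-] [_ h]]] := pc _ _ A1 A2.
exists N => // b; have := h ord0 b; rewrite mxE /ball /= => hb.
by rewrite distrC.
Qed.

(** The limit is the supremum of the lower bounds u K - C / K, each of which lies below every upper
    bound u N + C / N; so the rate is inherited. *)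
Lemma cauchy_rate_limit (R : realType) (u : nat -> R) (C : R) : 0 <= C ->
  (forall K N, (0 < K <= N)%N -> `|u N - u K| <= C / K%:R) ->
  exists x, forall N, (0 < N)%N -> `|x - u N| <= C / N%:R.
Proof.
move=> C0 uC; pose A := [set u K.+1 - C / K.+1%:R | K in [set: nat]].
have key K N : (0 < K)%N -> (0 < N)%N -> u K - C / K%:R <= u N + C / N%:R.
  move=> K0 N0; have cK : 0 <= C / K%:R by rewrite divr_ge0.
  have cN : 0 <= C / N%:R by rewrite divr_ge0.
  have [KN|NK] := leqP K N.
    by have := uC K N; rewrite K0 KN => /(_ isT); rewrite ler_norml => /andP[]; lra.
  by have := uC N K; rewrite N0 (ltnW NK) => /(_ isT); rewrite ler_norml => /andP[]; lra.
have A0 : A !=set0 by exists (u 1%N - C / 1%:R); exists 0%N.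
have ubA N : (0 < N)%N -> ubound A (u N + C / N%:R).
  by move=> N0 _ [K _ <-]; exact: key.
exists (sup A) => N N0; rewrite ler_distl; apply/andP; split.
  apply: ub_le_sup; first by exists (u 1%N + C / 1%:R); exact: ubA.
  by case: N N0 => // N _; exists N.
by apply: ge_sup => //; exact: ubA.
Qed.

Section CharacterNonvanishing.
Context {R : realType} (q : nat).
Local Notation M := q.+2.
Local Notation Z := 'Z_M.
Implicit Types (g h : Z -> R) (a b c : Z) (n k d N K : nat).

Definition lsum g N : R := \sum_(1 <= n < N.+1) g n%:R / n%:R.

Lemma lsum_cauchy g K N : mean0 g -> (0 < K <= N)%N ->
  `|lsum g N - lsum g K| <= 2 * norm1 g / K%:R.
Proof.
move=> gm /andP[K0 KN]; rewrite /lsum (big_cat_nat _ (n := K.+1))//= [_ + _ - _]addrC addKr.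
apply: le_trans (@mean0_decr R q g (fun n => n%:R^-1) _ _ gm _ _) _.
- move=> n Kn; rewrite invr_ge0 ler0n /= lef_pV2 ?posrE ?ltr0n ?ler_nat//; lia.
- by rewrite invr_ge0 ler0n.
rewrite ler_wpM2l ?mulr_ge0 ?norm1_ge0// lef_pV2 ?posrE ?ltr0n ?ler_nat//.
Qed.

(** [mean0 g] is assumed inside the existential, which makes [Lval] a total function. *)
Lemma Lval_ex g : exists x : R, mean0 g ->
  forall N, (0 < N)%N -> `|x - lsum g N| <= 2 * norm1 g / N%:R.
Proof.
have [gm|gm] := pselect (mean0 g); last by exists 0.
have n0 : 0 <= 2 * norm1 g by rewrite mulr_ge0 ?norm1_ge0.
have [x xP] := cauchy_rate_limit n0 (fun K N => @lsum_cauchy g K N gm).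
by exists x.
Qed.

Definition Lval g : R := projT1 (cid (Lval_ex g)).

Lemma LvalP g N : mean0 g -> (0 < N)%N -> `|Lval g - lsum g N| <= 2 * norm1 g / N%:R.
Proof. by move=> gm; rewrite /Lval; case: cid => x /= /(_ gm); apply. Qed.

Lemma Lval_unique g x (C : R) : mean0 g ->
  (forall N, (0 < N)%N -> `|x - lsum g N| <= C / N%:R) -> x = Lval g.
Proof.
move=> gm h; apply/eqP; rewrite -subr_eq0 -normr_le0; apply/ler_addgt0Pr => e e0.
rewrite add0r; set D := C + 2 * norm1 g.
have [N0 hN hD] : exists2 N, (0 < N)%N & D / N%:R <= e.
  exists (Num.truncn (D / e)).+1 => //.
  by rewrite ler_pdivrMr ?ltr0n// mulrC -ler_pdivrMr// ltW// truncnS_gt.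
rewrite (_ : x - Lval g = (x - lsum g N0) - (Lval g - lsum g N0)); last by ring.
apply: le_trans (ler_normB _ _) _.
apply: le_trans (lerD (h _ hN) (LvalP gm hN)) _.
by rewrite -mulrDl.
Qed.

Lemma mean0_sum (I : finType) (c : I -> R) (G : I -> Z -> R) :
  (forall i, mean0 (G i)) -> mean0 (fun x => \sum_i c i * G i x).
Proof.
move=> Gm; split.
  by move=> a aU; rewrite big1// => i _; rewrite (Gm i).1// mulr0.
rewrite exchange_big big1//= => i _; by rewrite -mulr_sumr (Gm i).2 mulr0.
Qed.

Lemma Lval_sum (I : finType) (c : I -> R) (G : I -> Z -> R) :
  (forall i, mean0 (G i)) ->
  Lval (fun x => \sum_i c i * G i x) = \sum_i c i * Lval (G i).
Proof.
move=> Gm; symmetry; apply: (@Lval_unique _ _ (\sum_i `|c i| * (2 * norm1 (G i)))).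
  exact: mean0_sum.
move=> N N0; have -> : lsum (fun x => \sum_i c i * G i x) N = \sum_i c i * lsum (G i) N.
  under [RHS]eq_bigr do rewrite /lsum mulr_sumr.
  rewrite exchange_big /=; apply: eq_bigr => n _; rewrite mulr_suml.
  by apply: eq_bigr => i _; rewrite mulrA.
rewrite -sumrB mulr_suml; apply: le_trans (ler_norm_sum _ _ _) _.
apply: ler_sum => i _; rewrite -mulrBr normrM -mulrA ler_wpM2l//.
exact: LvalP.
Qed.

Lemma Lval0 : Lval (fun=> 0) = 0.
Proof.
symmetry; apply: (@Lval_unique _ _ 0); first by split => //; rewrite big1.
by move=> N _; rewrite /lsum big1 ?subrr ?normr0 ?mul0r// => i _; rewrite mul0r.
Qed.

(* The convolution [r = 1 * f] is nonnegative and at least [1] at squares, so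
   \sum_(n <= N) r n / sqrt n is unbounded; by the hyperbola method it equals
   [2 * sqrt N * Lval f + O(1)]. *)
Context (f : Z -> R) (f_mean0 : mean0 f) (fM : forall a b, f (a * b) = f a * f b).
Context (f1 : f 1 = 1) (f_real : forall a, a \is a GRing.unit -> f a = 1 \/ f a = -1).

Let r n : R := \sum_(d <- divisors n) f d%:R.

Let f_cases a : [\/ f a = 0, f a = 1 | f a = -1].
Proof.
have [aU|aU] := boolP (a \is a GRing.unit).
  by case: (f_real aU) => ->; [constructor 2 | constructor 3].
by constructor 1; rewrite f_mean0.1.
Qed.

Let fX a i : f (a ^+ i) = f a ^+ i.
Proof. by elim: i => [|i IH]; rewrite ?expr0// !exprS fM IH. Qed.

Let r_pfactor p k m : prime p -> (0 < m)%N -> ~~ (p %| m)%N ->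
  r (p ^ k * m) = r m * \sum_(0 <= i < k.+1) f p%:R ^+ i.
Proof.
move=> pp m0 pm; rewrite /r sum_divisors_pfactor// mulr_suml; apply: eq_bigr => d _.
by rewrite mulr_sumr; apply: eq_bigr => i _; rewrite natrM fM natrX fX mulrC.
Qed.

Let geo_ge0 a k : 0 <= \sum_(0 <= i < k) f a ^+ i.
Proof.
case: (f_cases a) => ->; try by apply: sumr_ge0 => i _; rewrite exprn_ge0.
suff : \sum_(0 <= i < k) (-1) ^+ i = (odd k)%:R :> R by move=> ->.
elim: k => [|k IH]; first by rewrite big_geq.
by rewrite big_nat_recr//= IH -signr_odd; case: (odd k); rewrite /= ?expr1 ?subrr ?expr0 ?add0r.
Qed.

Let geo_ge1 a k : 1 <= \sum_(0 <= i < (2 * k).+1) f a ^+ i.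
Proof.
rewrite big_ltn// expr0 lerDl mul2n big_add1 /=.
elim: k => [|k IH]; first by rewrite big_geq.
rewrite doubleS 2?big_nat_recr//= -addrA addr_ge0//.
rewrite !exprS; have : 0 <= f a ^+ k.*2 by rewrite -mul2n exprM exprn_ge0// sqr_ge0.
by move: (_ ^+ _) => t; case: (f_cases a) => ->; nra.
Qed.

Let r_ge0 n : (0 < n)%N -> 0 <= r n.
Proof.
move=> n0; elim/pfactor_ind: n / n0 => [|p k m pp k0 m0 pm IH].
  by rewrite /r big_seq1 f1.
by rewrite r_pfactor// mulr_ge0.
Qed.

Let r_sqr_ge1 n : (0 < n)%N -> 1 <= r (n ^ 2).
Proof.
move=> n0; elim/pfactor_ind: n / n0 => [|p k m pp k0 m0 pm IH].
  by rewrite /r big_seq1 f1.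
rewrite expnMn -expnM mulnC mulnC (mulnC k) r_pfactor ?expn_gt0 ?m0// ?Euclid_dvdX ?(negbTE pm)//.
by apply: le_trans (ler_pM ler01 ler01 IH (geo_ge1 p%:R k)); rewrite mulr1.
Qed.

Let zsum N : R := \sum_(1 <= b < N.+1) (Num.sqrt b%:R)^-1.

(** As in [harm_sub_ln], two stages are compared instead of naming the limit of zsum N - 2 sqrt N,
    which is zeta(1/2). *)
Let zsum_rate K N : (0 < K <= N)%N ->
  0 <= (zsum K - 2 * Num.sqrt K%:R) - (zsum N - 2 * Num.sqrt N%:R) <=
   (Num.sqrt K%:R)^-1 - (Num.sqrt N%:R)^-1.
Proof.
move=> /andP[K0]; elim: N => [|N IH]; first by rewrite leqNgt K0.
rewrite leq_eqVlt => /orP[/eqP<-|KN]; first by rewrite !subrr lexx.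
have /andP[h1 h2] := IH KN; rewrite {2 4}/zsum big_nat_recr//= -/(zsum N).
set x := Num.sqrt N%:R in h1 h2 *; set y := Num.sqrt N.+1%:R.
have x0 : 0 < x by rewrite sqrtr_gt0 ltr0n; lia.
have y0 : 0 < y by rewrite sqrtr_gt0 ltr0n.
have xy : y ^+ 2 = x ^+ 2 + 1 by rewrite !sqr_sqrtr ?ler0n// -natr1.
have xley : x <= y by rewrite -(@ler_pXn2r _ 2)// ?nnegrE ?ltW// xy; lra.
have e1 : y^-1 <= 2 * (y - x).
  by rewrite -(ler_pM2l y0) divff ?gt_eqF//; nra.
have e2 : 2 * (y - x) <= x^-1.
  by rewrite -(ler_pM2l x0) divff ?gt_eqF//; nra.
by move: (zsum N) (zsum K) (Num.sqrt K%:R) h1 h2 => *; apply/andP; split; lra.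
Qed.

Lemma real_char_Lval_neq0 : Lval f <> 0.
Proof.
move=> L0; set n1 := norm1 f; have n10 : 0 <= n1 := norm1_ge0 f.
(* The sum runs up to a square so that the hyperbola is cut at the integer Q = sqrt N. *)
have bound Q : (0 < Q)%N ->
  \sum_(1 <= n < (Q ^ 2).+1) r n / Num.sqrt n%:R <= 8 + 12 * n1.
  move=> Q0; set N := (Q ^ 2)%N.
  have Q0' : 0 < Q%:R :> R by rewrite ltr0n.
  have sN : Num.sqrt N%:R = Q%:R :> R by rewrite /N natrX sqrtr_sqr ger0_norm// ltW.
  have N0 : (0 < N)%N by rewrite expn_gt0 Q0.
  have QN : (Q <= N)%N by rewrite /N -{1}(expn1 Q) leq_pexp2l.
  have -> : \sum_(1 <= n < N.+1) r n / Num.sqrt n%:R =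
     \sum_(1 <= a < N.+1) \sum_(1 <= b < (N %/ a).+1)
       f a%:R / Num.sqrt a%:R * (Num.sqrt b%:R)^-1.
    rewrite -(sum_divisors_exchange (fun a b : nat => f a%:R / Num.sqrt a%:R * (Num.sqrt b%:R)^-1)).
    rewrite big_nat [RHS]big_nat; apply: eq_bigr => n /andP[n0 _].
    rewrite /r mulr_suml big_seq [RHS]big_seq; apply: eq_bigr => d.
    rewrite -dvdn_divisors// => dn; rewrite -{1}(divnK dn) mulnC natrM sqrtrM ?ler0n//.
    by rewrite invfM mulrA.
  (* [H1] has a <= Q and is summed over b first; [H2] has a > Q, which leaves only b <= Q, and is
     summed over a first, where f cancels. *)
  pose H1 (a b : nat) : R := (a <= Q)%N%:R * (f a%:R / Num.sqrt a%:R * (Num.sqrt b%:R)^-1).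
  pose H2 (a b : nat) : R := (Q < a)%N%:R * (f a%:R / Num.sqrt a%:R * (Num.sqrt b%:R)^-1).
  have -> : \sum_(1 <= a < N.+1) \sum_(1 <= b < (N %/ a).+1)
       f a%:R / Num.sqrt a%:R * (Num.sqrt b%:R)^-1 =
    \sum_(1 <= a < N.+1) \sum_(1 <= b < (N %/ a).+1) H1 a b +
    \sum_(1 <= b < N.+1) \sum_(1 <= a < (N %/ b).+1) H2 a b.
    rewrite -(sum_hyperbola_sym H2) -big_split; apply: eq_bigr => a _ /=.
    rewrite -big_split; apply: eq_bigr => b _ /=.
    by rewrite /H1 /H2; case: leqP => _; rewrite mul1r mul0r ?addr0 ?add0r.
  have part2 : \sum_(1 <= b < N.+1) \sum_(1 <= a < (N %/ b).+1) H2 a b <= 4 * n1.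
    apply: (@le_trans _ _ (\sum_(1 <= b < Q.+1) 2 * n1 / Num.sqrt Q%:R * (Num.sqrt b%:R)^-1)).
      rewrite (big_cat_nat _ (n := Q.+1))//= [X in _ + X]big_nat [X in _ + X]big1 ?addr0; last first.
        move=> b /andP[Qb _]; rewrite big_nat big1// => a /andP[_ aN]; rewrite /H2.
        have : (N %/ b <= Q)%N by rewrite -ltnS ltn_divLR; [rewrite /N; nia | lia].
        by case: ltnP => h; rewrite ?mul0r//; lia.
      apply: ler_sum_nat => b /andP[b0 bQ].
      have bN : (Q <= N %/ b)%N by rewrite leq_divRL// /N; nia.
      rewrite (big_cat_nat _ (n := Q.+1))//= big_nat big1 ?add0r; last first.
        by move=> a /andP[_ aQ]; rewrite /H2; case: ltnP => h; rewrite ?mul0r//; lia.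
      have -> : \sum_(Q.+1 <= a < (N %/ b).+1) H2 a b =
         (\sum_(Q.+1 <= a < (N %/ b).+1) f a%:R * (Num.sqrt a%:R)^-1) * (Num.sqrt b%:R)^-1.
        rewrite mulr_suml big_nat [RHS]big_nat; apply: eq_bigr => a /andP[Qa _].
        by rewrite /H2 Qa mul1r.
      rewrite ler_wpM2r// ?invr_ge0 ?sqrtr_ge0//.
      apply: le_trans (ler_norm _) _.
      apply: le_trans (@mean0_decr R q f (fun a : nat => (Num.sqrt a%:R)^-1) _ _ f_mean0 _ _) _.
      + move=> n Qn; rewrite invr_ge0 sqrtr_ge0 /= lef_pV2 ?posrE ?sqrtr_gt0 ?ltr0n//; last lia.
        by rewrite ler_sqrt ?ler0n// ler_nat.
      + by rewrite invr_ge0 sqrtr_ge0.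
      rewrite ler_wpM2l ?mulr_ge0// lef_pV2 ?posrE ?sqrtr_gt0 ?ltr0n//.
      by rewrite ler_sqrt ?ler0n// ler_nat.
    rewrite -mulr_sumr -/(zsum Q).
    have := @sum_inv_sqrt R Q; rewrite -/(zsum Q).
    have s0 : 0 < Num.sqrt Q%:R :> R by rewrite sqrtr_gt0.
    move: (Num.sqrt _) s0 (zsum Q) => s s0 z zs.
    rewrite -mulrA (_ : 4 * n1 = 2 * n1 * 2); last by ring.
    by rewrite ler_wpM2l ?mulr_ge0// mulrC ler_pdivrMr.
  rewrite (_ : 8 + 12 * n1 = (8 + 8 * n1) + 4 * n1); last by ring.
  rewrite lerD//; pose s : R := zsum N - 2 * Num.sqrt N%:R.
  have s2 : `|s| <= 2.
    have := @zsum_rate 1 N; rewrite N0 => /(_ isT).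
    rewrite /zsum big_nat1 sqrtr1 invr1 -/(zsum N) sN => /andP[a1 a2].
    have iQ : 0 <= Q%:R^-1 :> R by rewrite invr_ge0 ltW.
    by rewrite /s sN ler_norml; apply/andP; split; lra.
  have rate (a : nat) : (1 <= a < Q.+1)%N ->
      `|zsum (N %/ a) - 2 * (Q%:R / Num.sqrt a%:R) - s| <= 4 * (Num.sqrt a%:R / Q%:R).
    move=> /andP[a0 aQ]; set K := (N %/ a)%N.
    have K0 : (0 < K)%N by rewrite divn_gt0//; lia.
    have a0' : 0 < a%:R :> R by rewrite ltr0n.
    have /andP[z1 z2] := @zsum_rate K N (ltac:(by rewrite K0 leq_div)).
    have y1 := @divn_le_ratio R a N a0; have y2 := @ratio_lt_divn R a N a0.
    have sqy : Q%:R / Num.sqrt a%:R = Num.sqrt (N%:R / a%:R) :> R.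
      by rewrite sqrtrM ?ler0n// sqrtrV ?ler0n// sN.
    have sqV : Num.sqrt a%:R / Q%:R = (Num.sqrt (N%:R / a%:R))^-1 :> R.
      by rewrite -sqy invf_div.
    rewrite sqy sqV; move: y1 y2; rewrite -/K; move: (N%:R / a%:R) => y y1 y2.
    have K0' : 1 <= K%:R :> R by rewrite ler1n.
    move: z1 z2; rewrite -/s sN; set k := Num.sqrt K%:R; set t := Num.sqrt y.
    have k0 : 1 <= k by rewrite /k -[leLHS]sqrtr1 ler_sqrt//; lra.
    have kE : k ^+ 2 = K%:R by rewrite sqr_sqrtr//; lra.
    have tE : t ^+ 2 = y by rewrite sqr_sqrtr//; lra.
    have kt : k <= t by rewrite ler_sqrt//; lra.
    have kV : k^-1 <= 2 * t^-1.
      have -> : 2 * t^-1 = (t / 2)^-1 by rewrite invf_div.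
      by rewrite lef_pV2 ?posrE; [nra| lra|lra].
    have h2 : 2 * (t - k) <= k^-1.
      rewrite -(@ler_pM2l _ k); last by lra.
      by rewrite divff; [nra|rewrite gt_eqF//; lra].
    have iQ : 0 <= Q%:R^-1 :> R by rewrite invr_ge0 ltW.
    by move=> z1 z2; rewrite ler_norml; apply/andP; split; lra.
  have -> : \sum_(1 <= a < N.+1) \sum_(1 <= b < (N %/ a).+1) H1 a b =
    \sum_(1 <= a < Q.+1) f a%:R / Num.sqrt a%:R * zsum (N %/ a).
    rewrite (big_cat_nat _ (n := Q.+1))//= [X in _ + X]big_nat [X in _ + X]big1 ?addr0.
      rewrite big_nat [RHS]big_nat; apply: eq_bigr => a /andP[_ aQ].
      rewrite /zsum mulr_sumr; apply: eq_bigr => b _.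
      by rewrite /H1 (_ : (a <= Q)%N) ?mul1r.
    move=> a /andP[Qa _]; rewrite big1// => b _; rewrite /H1.
    by rewrite (_ : (a <= Q)%N = false) ?mul0r//; apply/negbTE; rewrite -ltnNge.
  have -> : \sum_(1 <= a < Q.+1) f a%:R / Num.sqrt a%:R * zsum (N %/ a) =
     2 * Q%:R * lsum f Q + s * (\sum_(1 <= a < Q.+1) f a%:R / Num.sqrt a%:R) +
     \sum_(1 <= a < Q.+1) f a%:R / Num.sqrt a%:R *
       (zsum (N %/ a) - 2 * (Q%:R / Num.sqrt a%:R) - s).
    rewrite /lsum !mulr_sumr -!big_split /= big_nat [RHS]big_nat; apply: eq_bigr => a /andP[a0 _].
    have : (Num.sqrt a%:R)^-1 * (Num.sqrt a%:R)^-1 = (a%:R)^-1 :> R.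
      by rewrite -invfM -expr2 sqr_sqrtr ?ler0n.
    move: (Num.sqrt a%:R)^-1 (zsum _) (f _) => u z v <-; ring.
  (* Lval f = 0 makes lsum f Q itself of order 1 / Q, so the main term stays bounded. *)
  have t1 : 2 * Q%:R * lsum f Q <= 4 * n1.
    have := LvalP f_mean0 Q0; rewrite L0 sub0r normrN -/n1.
    rewrite ler_pdivlMr// => h; have := ler_norm (lsum f Q).
    move=> lf; rewrite mulrAC -mulrA (_ : 4 * n1 = 2 * (2 * n1)); last by ring.
    by rewrite ler_pM2l// (le_trans _ h)// ler_wpM2r// ltW.
  have t2 : s * (\sum_(1 <= a < Q.+1) f a%:R / Num.sqrt a%:R) <= 4 * n1.
    apply: le_trans (ler_norm _) _; rewrite normrM.
    have h : `|\sum_(1 <= a < Q.+1) f a%:R / Num.sqrt a%:R| <= 2 * n1.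
      rewrite -[leRHS]mulr1 -[X in _ <= _ * X]invr1 -[X in X^-1]sqrtr1.
      apply: (@mean0_decr R q f (fun a : nat => (Num.sqrt a%:R)^-1) _ _ f_mean0 _ _) => //.
      move=> n n0; rewrite invr_ge0 sqrtr_ge0 /= lef_pV2 ?posrE ?sqrtr_gt0 ?ltr0n//.
      by rewrite ler_sqrt ?ler0n// ler_nat.
    rewrite (_ : 4 * n1 = 2 * (2 * n1)); last by ring.
    by apply: ler_pM.
  have t3 : \sum_(1 <= a < Q.+1) f a%:R / Num.sqrt a%:R *
       (zsum (N %/ a) - 2 * (Q%:R / Num.sqrt a%:R) - s) <= 4.
    apply: le_trans (ler_norm _) _; apply: le_trans (ler_norm_sum _ _ _) _.
    apply: (@le_trans _ _ (\sum_(1 <= a < Q.+1) 4 / Q%:R)).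
      apply: ler_sum_nat => a aQ; have ra := rate _ aQ; have /andP[a0 _] := aQ.
      have sa0 : 0 < Num.sqrt a%:R :> R by rewrite sqrtr_gt0 ltr0n.
      have fle : `|f a%:R| <= 1.
        by case: (f_cases a%:R) => ->; rewrite ?normrN ?normr0 ?normr1.
      have sV0 : 0 <= (Num.sqrt a%:R)^-1 :> R by rewrite invr_ge0 ltW.
      rewrite normrM normrM (ger0_norm sV0).
      apply: (@le_trans _ _ (1 / Num.sqrt a%:R * (4 * (Num.sqrt a%:R / Q%:R)))).
        by apply: ler_pM => //; rewrite ?mulr_ge0// ler_wpM2r.
      rewrite le_eqVlt; apply/orP; left; apply/eqP.
      by field; rewrite !gt_eqF.
    by rewrite sumr_const_nat subn1 /= -[leLHS]mulr_natr divfK// gt_eqF.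
  by lra.
(* The squares n = k ^ 2 alone contribute at least 1 / k each. *)
have lower Q : (0 < Q)%N -> ln Q%:R <= \sum_(1 <= n < (Q ^ 2).+1) r n / Num.sqrt n%:R.
  move=> Q0; have /andP[+ _] := @harm_ln R Q Q0; rewrite subr_ge0 => h.
  apply: le_trans h _; rewrite /harm.
  pose G n : R := if n is 0 then 0 else r n / Num.sqrt n%:R.
  have Gge n : 0 <= G n by case: n => //= n; rewrite divr_ge0 ?r_ge0 ?sqrtr_ge0.
  have -> : \sum_(1 <= n < (Q ^ 2).+1) r n / Num.sqrt n%:R = \sum_(1 <= n < (Q ^ 2).+1) G n.
    by rewrite big_nat [RHS]big_nat; apply: eq_bigr => -[].
  apply: (@le_trans _ _ (\sum_(1 <= k < Q.+1) G (k ^ 2)%N)).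
    apply: ler_sum_nat => k /andP[k0 _]; rewrite /G; case E : (k ^ 2)%N => [|j].
      by move: E => /eqP; rewrite expn_eq0 => /andP[/eqP kk]; rewrite kk in k0.
    rewrite -E natrX sqrtr_sqr ger0_norm ?ler0n// ler_pdivlMr ?ltr0n// mulVf ?r_sqr_ge1//.
    by rewrite pnatr_eq0; lia.
  elim: Q Q0 => // -[|Q] IH _; first by rewrite !big_nat1.
  rewrite big_nat_recr//= [leRHS](big_cat_nat _ (n := (Q.+1 ^ 2).+1))//=; last first.
    by rewrite ltnS leq_exp2r.
  rewrite lerD ?IH//.
  have hin : (Q.+2 ^ 2)%N \in index_iota (Q.+1 ^ 2).+1 (Q.+2 ^ 2).+1.
    by rewrite mem_index_iota ltnSn andbT ltn_exp2r.
  rewrite (bigD1_seq (Q.+2 ^ 2)%N) ?iota_uniq//= lerDl.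
  by apply: sumr_ge0.
pose Q := (Num.truncn (expR (8 + 12 * n1))).+1.
have := le_trans (@lower Q isT) (@bound Q isT).
apply/negP; rewrite -ltNge -{1}(expRK (8 + 12 * n1)) ltr_ln ?posrE ?expR_gt0 ?ltr0n//.
by rewrite /Q truncnS_gt.
Qed.

End CharacterNonvanishing.

(** * Dirichlet's theorem in bounded form *)

Section Dirichlet.
Context {R : realType} (q : nat).
Local Notation M := q.+2.
Local Notation Z := 'Z_M.
Implicit Types (g h : Z -> R) (a b c : Z) (n k d N K : nat).

Definition vsum g N : R := \sum_(1 <= n < N.+1) g n%:R * vonM n / n%:R.

(** Extended to complex values, it maps a non-principal character chi to L(1, chi) times chi: the
    operator is diagonalised by the characters, and its injectivity amounts to all these L(1, chi)
    being nonzero. *)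
Definition Lshift g : Z -> R := fun b => Lval (shift b g).

Lemma Lshift_mean0 g : mean0 g -> mean0 (Lshift g).
Proof.
move=> gm; split.
  by move=> a aU; rewrite /Lshift (shift_nonunit gm.1 aU) Lval0.
transitivity (\sum_b 1 * Lval (shift b g)); first by apply: eq_bigr => b _; rewrite mul1r.
rewrite -Lval_sum; last by move=> b; exact: mean0_shift.
rewrite -[RHS](@Lval0 R q); congr Lval; apply/funext => x.
have [xU|xU] := boolP (x \is a GRing.unit).
  rewrite -[RHS]gm.2 -(sum_shift id g xU); apply: eq_bigr => b _.
  by rewrite mul1r /shift mulrC.
rewrite big1// => b _; rewrite /shift gm.1 ?mulr0//.
by apply: contra xU; rewrite unitrM => /andP[].
Qed.

Lemma ln_div_decr n : (4 <= n)%N ->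
  0 <= (ln n.+1%:R : R) / n.+1%:R <= ln n%:R / n%:R.
Proof.
move=> n4; have n0 : (0 < n)%N by lia.
rewrite divr_ge0 ?ln_ge0 ?ler1n//=.
rewrite ler_pdivrMr ?ltr0n// mulrAC ler_pdivlMr ?ltr0n//.
have [_ l] := @ln_succ_bounds R _ n0.
have n0' : 0 < n%:R :> R by rewrite ltr0n.
have l1 : n%:R * (ln n.+1%:R - ln n%:R) <= 1 :> R.
  by rewrite -(ler_pM2l n0') divff ?gt_eqF// in l.
have l4 : 1 <= ln n%:R :> R.
  apply: (@le_trans _ _ (ln 4%:R)); last by rewrite ler_ln ?posrE ?ltr0n// ler_nat.
  rewrite (_ : 4%:R = 2 ^+ 2 :> R) ?lnXn//; last by ring.
  by have := @ln_ge_1subV R 2 (ltac:(lra)); rewrite -mulr_natl; lra.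
by move: (ln n.+1%:R) (ln n%:R) l1 l4 => x y l1 l4; rewrite -natr1; nra.
Qed.

(** Splitting ln by [sum_vonM], the sum of g n * ln n / n becomes that of vonM d / d * lsum (shift d
    g) (N / d). It is bounded by partial summation, and replacing each inner partial sum by its
    limit costs O(d / N), hence O(psi N / N) = O(1) altogether. *)
Lemma vsum_Lshift g : mean0 g -> exists C : R, forall N, (0 < N)%N -> `|vsum (Lshift g) N| <= C.
Proof.
move=> gm; set n1 := norm1 g; have n10 : 0 <= n1 := norm1_ge0 g.
have shiftb d : norm1 (shift d%:R g) <= n1 by exact: norm1_shift gm.1.
pose C0 : R := \sum_(1 <= n < 4) `|g n%:R * ln n%:R / n%:R|.
exists (C0 + 2 * n1 * (ln 4%:R / 4%:R) + 32 * n1) => N N0.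
have N0' : 0 < N%:R :> R by rewrite ltr0n.
have h1 : `|\sum_(1 <= n < N.+1) g n%:R * ln n%:R / n%:R| <= C0 + 2 * n1 * (ln 4%:R / 4%:R).
  have l4 : 0 <= ln 4%:R / 4%:R :> R.
    by apply: divr_ge0; [apply: ln_ge0; rewrite ler1n | rewrite ler0n].
  have [N4|N4] := ltnP N 4.
    apply: le_trans (ler_norm_sum _ _ _) _.
    have l5 : 0 <= 2 * n1 * (ln 4%:R / 4%:R) by rewrite mulr_ge0// mulr_ge0.
    rewrite -[leLHS]addr0 lerD//.
    rewrite /C0 [leRHS](big_cat_nat _ (n := N.+1))//= lerDl.
    exact: sumr_ge0.
  rewrite (big_cat_nat _ (n := 4))//=; last by lia.
  apply: le_trans (ler_normD _ _) _; rewrite lerD//; first exact: ler_norm_sum.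
  under eq_bigr do rewrite -mulrA.
  by apply: (@mean0_decr R q g (fun n => ln n%:R / n%:R)) => //; exact: ln_div_decr.
have -> : vsum (Lshift g) N = \sum_(1 <= n < N.+1) g n%:R * ln n%:R / n%:R +
   \sum_(1 <= d < N.+1) vonM d / d%:R * (Lval (shift d%:R g) - lsum (shift d%:R g) (N %/ d)).
  have -> : \sum_(1 <= n < N.+1) g n%:R * ln n%:R / n%:R =
     \sum_(1 <= d < N.+1) vonM d / d%:R * lsum (shift d%:R g) (N %/ d).
    transitivity (\sum_(1 <= d < N.+1) \sum_(1 <= k < (N %/ d).+1)
        vonM d * g (d * k)%:R / (d * k)%:R); last first.
      apply: eq_bigr => d _; rewrite /lsum mulr_sumr; apply: eq_bigr => k _.
      by rewrite /shift !natrM invfM; ring.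
    rewrite -(sum_divisors_exchange (fun d k => vonM d * g (d * k)%:R / (d * k)%:R)).
    rewrite big_nat [RHS]big_nat; apply: eq_bigr => n /andP[n0 _].
    rewrite -sum_vonM// mulr_sumr mulr_suml big_seq [RHS]big_seq; apply: eq_bigr => e.
    by rewrite -dvdn_divisors// mulrC [(e * _)%N]mulnC => /divnK->; rewrite mulrC (mulrC (g _)).
  by rewrite -big_split /=; apply: eq_bigr => d _; rewrite /Lshift; ring.
apply: le_trans (ler_normD _ _) _; rewrite lerD//.
apply: le_trans (ler_norm_sum _ _ _) _.
apply: (@le_trans _ _ (\sum_(1 <= d < N.+1) vonM d * (4 * n1 / N%:R))).
  apply: ler_sum_nat => d /andP[d0 dN].
  have K0 : (0 < N %/ d)%N by rewrite divn_gt0//; lia.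
  have K0' : 0 < (N %/ d)%:R :> R by rewrite ltr0n.
  have d0' : 0 < d%:R :> R by rewrite ltr0n.
  have v0 : 0 <= vonM d / d%:R :> R by rewrite divr_ge0 ?vonM_ge0.
  rewrite normrM (ger0_norm v0) -[leLHS]mulrA ler_wpM2l ?vonM_ge0//.
  apply: le_trans (ler_wpM2l _ (LvalP (mean0_shift d%:R gm) K0)) _.
    by rewrite invr_ge0 ltW.
  rewrite mulrC ler_pdivrMr// ler_pdivrMr// -mulrA.
  have := @ratio_lt_divn R d N d0; have K1 : 1 <= (N %/ d)%:R :> R by rewrite ler1n.
  rewrite ltr_pdivrMr// => h.
  have h2 : N%:R <= 2 * (d%:R * (N %/ d)%:R) :> R by nra.
  apply: (@le_trans _ _ (2 * n1)); first by rewrite ler_pM2l.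
  rewrite [leRHS]mulrAC ler_pdivlMr//.
  by move: (d%:R * _ : R) h2 => x h2; nra.
rewrite -mulr_suml -/(psi N).
rewrite (_ : 32 * n1 = (8 * N%:R) * (4 * n1 / N%:R)); last by field; rewrite gt_eqF.
by rewrite ler_wpM2r ?psi_le// divr_ge0 ?mulr_ge0// ltW.
Qed.

(** In the kernel lsum (shift d g) (N / d) is O(d / N), so the sums of g k / k over multiples of d
    are O(1 / N), and [tatuzawa_iseki] applies with C of that order. For a character this is the
    classical fact that L(1, chi) = 0 turns the sum of chi n * vonM n / n into - ln N + O(1). *)
Lemma vsum_ker g : mean0 g -> (forall b, Lval (shift b g) = 0) ->
  exists C : R, forall N, (0 < N)%N -> `|vsum g N + g 1 * ln N%:R| <= C.
Proof.
move=> gm gK; set n1 := norm1 g; have n10 : 0 <= n1 := norm1_ge0 g.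
exists (128 * n1) => N N0; have N0' : 0 < N%:R :> R by rewrite ltr0n.
have := @tatuzawa_iseki R (fun k => g k%:R / k%:R) N (4 * n1 / N%:R) N0.
rewrite divr1 (_ : 32 * (4 * n1 / N%:R) * N%:R = 128 * n1); last by field; rewrite gt_eqF.
rewrite addrC (_ : \sum_(1 <= k < N.+1) vonM k * (g k%:R / k%:R) = vsum g N); last first.
  by apply: eq_bigr => k _; ring.
apply; first by rewrite divr_ge0 ?mulr_ge0// ltW.
move=> d dN; have /andP[d0 dN'] := dN.
have K0 : (0 < N %/ d)%N by rewrite divn_gt0//; lia.
have K0' : 0 < (N %/ d)%:R :> R by rewrite ltr0n.
have d0' : 0 < d%:R :> R by rewrite ltr0n.
have -> : \sum_(1 <= m < (N %/ d).+1) g (d * m)%:R / (d * m)%:R =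
    lsum (shift d%:R g) (N %/ d) / d%:R.
  by rewrite /lsum mulr_suml; apply: eq_bigr => m _; rewrite /shift !natrM invfM; ring.
have := LvalP (mean0_shift d%:R gm) K0; rewrite gK sub0r normrN => h.
have sb : norm1 (shift d%:R g) <= n1 by exact: norm1_shift gm.1.
have l0 : 0 <= ln (N%:R / d%:R) :> R by rewrite ln_ge0// ratio_ge1.
apply: (@le_trans _ _ (4 * n1 / N%:R)); last first.
  by rewrite ler_peMr ?divr_ge0 ?mulr_ge0 ?(ltW N0')//; lra.
rewrite normrM [`|_^-1|]ger0_norm ?invr_ge0 ?(ltW d0')//.
rewrite ler_pdivrMr// mulrAC ler_pdivlMr//.
move: h; rewrite ler_pdivlMr// => h.
have := @ratio_lt_divn R d N d0; have K1 : 1 <= (N %/ d)%:R :> R by rewrite ler1n.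
rewrite ltr_pdivrMr// => h3.
have h2 : N%:R <= 2 * (d%:R * (N %/ d)%:R) :> R by nra.
move: h (normr_ge0 (lsum (shift d%:R g) (N %/ d))) sb h2 K0' d0'.
move: `|lsum _ _| (norm1 (shift _ _)) (d%:R : R) ((N %/ d)%:R : R) (N%:R : R) n1 n10.
move=> s s1 e K n m m0 h s0 sb h2 k0 e0.
apply: (@le_trans _ _ (s * (2 * (e * K)))); first by rewrite ler_wpM2l.
by rewrite (_ : s * _ = 2 * e * (s * K)); [nra | ring].
Qed.

Definition dirac_unit c : Z -> R := fun x => (x == c)%:R * chi0 x.

Lemma dirac_unit_supp c : unit_supp (dirac_unit c).
Proof. by move=> a aU; rewrite /dirac_unit (@chi0_unit_supp R q a)// mulr0. Qed.

Lemma sum_dirac_unit g x : unit_supp g -> \sum_b g b * dirac_unit b x = g x.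
Proof.
move=> gU; rewrite (bigD1 x)//= big1 => [|b /negbTE bx]; last first.
  by rewrite /dirac_unit eq_sym bx mul0r mulr0.
rewrite /dirac_unit eqxx mul1r addr0 /chi0; case: (boolP (x \is a _)); rewrite ?mulr1// => xU.
by rewrite gU// mul0r.
Qed.

Lemma vsum_dirac g N : unit_supp g -> vsum g N = \sum_b g b * vsum (dirac_unit b) N.
Proof.
move=> gU; rewrite /vsum; under [RHS]eq_bigr do rewrite mulr_sumr.
rewrite exchange_big /=; apply: eq_bigr => n _.
rewrite -[in LHS](sum_dirac_unit n%:R gU) !mulr_suml.
by apply: eq_bigr => b _; ring.
Qed.

(** No limiting density is known to exist yet, so one is taken along a subsequence common to all
    classes; the last clause says that it still evaluates every combination whose logarithmic mean
    is known. *)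
Lemma density_limit_point : exists p : Z -> R, [/\ forall b, 0 <= p b, unit_supp p &
  forall g l (C : R), unit_supp g ->
   (forall N, (0 < N)%N -> `|vsum g N - l * ln N%:R| <= C) -> \sum_b g b * p b = l].
Proof.
(* The index is shifted by 3 to keep ln away from 0; with ln >= 1/2 the Mertens bound ln + 8 gives
   the box bound 17. *)
pose v N (b : Z) : R := vsum (dirac_unit b) N.+3 / ln N.+3%:R.
have ln3 N : 2^-1 <= ln N.+3%:R :> R.
  apply: (@le_trans _ _ (ln 2%:R)); last by rewrite ler_ln ?posrE ?ltr0n// ler_nat.
  by apply: le_trans (ln_ge_1subV _); lra.
have d01 b x : 0 <= dirac_unit b x <= 1.
  rewrite /dirac_unit /chi0; case: eqP => _; case: (_ \is a _);
    by rewrite ?mul1r ?mul0r ?lexx ?ler01.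
have vs0 b N : 0 <= vsum (dirac_unit b) N.
  apply: sumr_ge0 => n _; rewrite divr_ge0// mulr_ge0 ?vonM_ge0//.
  by have /andP[] := d01 b n%:R.
have vC N b : 0 <= v N b <= 17.
  have l3 := ln3 N; have l0 : 0 < ln N.+3%:R :> R by lra.
  rewrite /v divr_ge0 ?vs0 ?(ltW l0)//= ler_pdivrMr//.
  have /andP[_ m] := @mertens R N.+3 isT.
  apply: (@le_trans _ _ (ln N.+3%:R + 8)); last by lra.
  apply: le_trans m; apply: ler_sum => n _; rewrite ler_wpM2r ?invr_ge0//.
  by rewrite ler_piMl ?vonM_ge0//; have /andP[] := d01 b n%:R.
have [p pP] := bolzano_weierstrass vC.
have p0 b : 0 <= p b.
  apply/ler_addgt0Pr => e e0; have [N _ /(_ b)] := pP e 0%N e0.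
  have /andP[h _] := vC N b; rewrite ltr_norml => /andP[]; lra.
exists p; split=> //.
  move=> b bU; apply/eqP; rewrite -normr_le0; apply/ler_addgt0Pr => e e0.
  have [N _ /(_ b)] := pP e 0%N e0; rewrite add0r.
  have -> : v N b = 0.
    rewrite /v /vsum big1 ?mul0r// => n _; rewrite /dirac_unit.
    by case: eqP => [->|_]; rewrite ?(@chi0_unit_supp R q _ bU) ?mulr0 ?mul0r.
  by rewrite sub0r normrN => /ltW.
move=> g l C gU h; apply/eqP; rewrite -subr_eq0 -normr_le0; apply/ler_addgt0Pr => e e0.
rewrite add0r; pose e1 := e / (2 * (norm1 g + 1)).
have n1 : 0 < norm1 g + 1 by have := norm1_ge0 g; lra.
have e10 : 0 < e1 by rewrite divr_gt0// mulr_gt0.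
pose C' := `|C| + 1; have C'0 : 0 < C' by rewrite ltr_wpDl.
have [N NN vp] := pP e1 (Num.truncn (expR (2 * C' / e))).+1 e10.
have l0 : 0 < ln N.+3%:R :> R by have := ln3 N; lra.
have lbig : C' / ln N.+3%:R <= e / 2.
  rewrite ler_pdivrMr// mulrC -ler_pdivrMr ?divr_gt0//.
  rewrite (_ : C' / (e / 2) = 2 * C' / e); last by field; rewrite gt_eqF.
  rewrite -[leLHS]expRK ler_ln ?posrE ?expR_gt0 ?ltr0n//.
  apply: le_trans (ltW (truncnS_gt _)) _.
  by rewrite ler_nat (leq_trans NN)// -addn3 leq_addr.
have -> : \sum_b g b * p b - l =
   (vsum g N.+3 - l * ln N.+3%:R) / ln N.+3%:R - \sum_b g b * (v N b - p b).
  have E : vsum g N.+3 / ln N.+3%:R = \sum_b g b * v N b.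
    by rewrite (vsum_dirac _ gU) mulr_suml; apply: eq_bigr => b _; rewrite /v mulrA.
  under [X in _ = _ - X]eq_bigr do rewrite mulrBr.
  rewrite sumrB /= mulrBl mulfK ?gt_eqF// E.
  by move: (\sum_b _ * v N b) (\sum_b _ * p b) => x y; ring.
apply: le_trans (ler_normB _ _) _; rewrite (splitr e) lerD//.
  apply: le_trans lbig; rewrite normrM (ger0_norm (_ : 0 <= _^-1)) ?invr_ge0 ?(ltW l0)//.
  rewrite ler_wpM2r ?invr_ge0 ?(ltW l0)//; apply: le_trans (h _ _) _ => //.
  by rewrite /C'; have := ler_norm C; lra.
apply: le_trans (ler_norm_sum _ _ _) _.
apply: (@le_trans _ _ (norm1 g * e1)).
  rewrite /norm1 mulr_suml; apply: ler_sum => b _; rewrite normrM ler_wpM2l//.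
  exact/ltW/vp.
rewrite /e1 mulrA ler_pdivrMr ?mulr_gt0// mulrA divfK ?pnatr_eq0//.
by rewrite mulrC ler_wpM2l ?(ltW e0)//; lra.
Qed.

End Dirichlet.

(** * Injectivity of [Lshift] by a maximum principle *)

Section RealCharacter.
Context {R : realType} (q : nat).
Local Notation M := q.+2.
Local Notation Z := 'Z_M.
Implicit Types (f g h w : Z -> R) (a b c x y : Z) (n k d N K : nat).

Lemma average_extremal w h (m : R) : (forall b, 0 <= w b) -> \sum_b w b = 1 ->
  (forall b, w b != 0 -> h b <= m) -> \sum_b w b * h b = m ->
  forall b, w b != 0 -> h b = m.
Proof.
move=> w0 w1 hm hE b wb.
have : \sum_b w b * (m - h b) = 0.
  by under eq_bigr do rewrite mulrBr; rewrite sumrB -mulr_suml w1 mul1r hE subrr.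
move/psumr_eq0P => H; have := H _ b isT.
have H0 c : 0 <= w c * (m - h c).
  by have [->|wc] := eqVneq (w c) 0; rewrite ?mul0r// mulr_ge0// subr_ge0 hm.
move=> /(_ (fun c _ => H0 c))/eqP; rewrite mulf_eq0 (negbTE wb) /= subr_eq0.
by move=> /eqP.
Qed.

(** The maximum m of |f| is attained by f at some c0, after one averaging step if the extremum was
    negative. The w-average of f (c0 b) being - m, f = - m on c0 * supp w. If m < 1, then f 1 <> 1,
    so w 1 <> 0 and f c0 = - m, absurd; hence m = 1. By cardinality c0 * supp w is the whole set of
    inverses of supp w, outside which f = 1 on units. So f is 1 or -1 on units, each b in supp w
    flips the sign of f, and supp w is where f = -1; multiplicativity follows. *)
Lemma real_character_of_average f w : (forall b, 0 <= w b) -> \sum_b w b = 1 ->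
  unit_supp w -> unit_supp f ->
  (forall x, x \is a GRing.unit -> f x <= 1) ->
  (forall x, x \is a GRing.unit -> (f x == 1) = (w x^-1 == 0)) ->
  (forall c, \sum_b w b * f (c * b) = - f c) -> (exists c, f c != 0) ->
  [/\ forall x, x \is a GRing.unit -> f x = 1 \/ f x = -1, f 1 = 1 &
      forall x y, f (x * y) = f x * f y].
Proof.
move=> w0 w1 wU fU fle f1E fw [c1 c1P].
have wUn b : w b != 0 -> b \is a GRing.unit.
  by move=> wb; apply: contraR wb => bU; rewrite wU.
pose c2 := [arg max_(x > c1) `|f x|]%O.
have cmax x : `|f x| <= `|f c2|.
  by rewrite /c2; case: arg_maxP => // i _ iP; exact: iP.
set m := `|f c2| in cmax.
have m0 : 0 < m by apply: lt_le_trans (cmax c1); rewrite normr_gt0.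
have fm x : f x <= m by apply: le_trans (ler_norm _) (cmax x).
have fNm x : - f x <= m by rewrite (le_trans (ler_norm _))// normrN.
have upP c : f c = m -> forall b, w b != 0 -> f (c * b) = - m.
  move=> cm b wb; have := @average_extremal w (fun b => - f (c * b)) m w0 w1 (fun b _ => fNm _).
  move=> /(_ _ b wb) H; rewrite -[LHS]opprK H//.
  by under eq_bigr do rewrite mulrN; rewrite sumrN fw opprK.
have dnP c : f c = - m -> forall b, w b != 0 -> f (c * b) = m.
  move=> cm b wb; apply: (@average_extremal w (fun b => f (c * b)) m) => //.
  by rewrite fw cm opprK.
have [s sP] : exists s, w s != 0.
  apply/existsP; apply: contraT; rewrite negb_exists => /forallP H.
  have : \sum_b w b = 0 by apply: big1 => b _; apply/eqP; have := H b; rewrite negbK.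
  by rewrite w1 => /eqP; rewrite oner_eq0.
have [c0 c0m] : exists c0, f c0 = m.
  have [f0|f0] := leP 0 (f c2); first by exists c2; rewrite /m ger0_norm.
  by exists (c2 * s); apply: dnP => //; rewrite /m ltr0_norm// opprK.
have c0U : c0 \is a GRing.unit.
  by apply: contraT => cU; move: m0; rewrite -c0m fU// ltxx.
have m1 : m = 1.
  apply/eqP; rewrite eq_le -{1}c0m fle//= leNgt; apply/negP => mlt.
  have w_1 : w 1 != 0.
    rewrite -invr1 -f1E ?unitr1//; apply/eqP => h; have := fm 1; rewrite h; lra.
  by have := upP _ c0m _ w_1; rewrite mulr1 c0m => h; lra.
pose S : {set Z} := [set b | w b != 0]%SET.
have SU b : b \in S -> b \is a GRing.unit by rewrite inE; exact: wUn.
have SV x : x \in S -> f x^-1 != 1.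
  by move=> xS; rewrite f1E ?unitrV ?SU// invrK; move: xS; rewrite inE.
have eqS : ([set c0 * b | b in S] = [set b^-1 | b in S])%SET.
  have cV : #|[set b^-1 | b in S]%SET| = #|S| by rewrite card_imset//; exact: invr_inj.
  have cc : #|[set c0 * b | b in S]%SET| = #|S|.
    by rewrite card_imset//; apply: can_inj (fun x => c0^-1 * x) _ => x; rewrite mulKr.
  apply/eqP; rewrite eqEcard cc cV leqnn andbT; apply/fintype.subsetP => x /imsetP[b bS ->].
  apply/imsetP; exists (c0 * b)^-1; last by rewrite invrK.
  rewrite inE -f1E ?unitrM ?c0U ?SU//.
  have := upP _ c0m b; rewrite m1 => ->; last by move: bS; rewrite inE.
  by apply/eqP; lra.
have fS x : x \is a GRing.unit -> f x = if x^-1 \in S then -1 else 1.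
  move=> xU; case: ifPn => [xS|]; last by rewrite inE negbK -f1E// => /eqP.
  have : x \in [set b^-1 | b in S]%SET by apply/imsetP; exists x^-1 => //; rewrite invrK.
  rewrite -eqS => /imsetP[b bS ->]; rewrite -m1; apply: upP => //.
  by move: bS; rewrite inE.
have f_pm x : x \is a GRing.unit -> f x = 1 \/ f x = -1.
  by move=> /fS ->; case: ifP => _; [right | left].
have f11 : f 1 = 1.
  have [//|h] := f_pm 1 (unitr1 _).
  have w_1 : w 1 != 0.
    by move: h; rewrite fS ?unitr1// invr1; case: ifP; rewrite inE// => _ h; lra.
  have := dnP 1; rewrite h m1 => /(_ erefl 1 w_1); rewrite mulr1 h; lra.
have fSm b : b \in S -> f b = -1.
  by rewrite inE => wb; rewrite -[b]mul1r -m1; apply: upP => //; rewrite m1.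
have mulS c b : b \in S -> f (c * b) = - f c.
  rewrite inE => wb; have [cU|cU] := boolP (c \is a GRing.unit).
    have [h|h] := f_pm c cU; first by rewrite h -m1; apply: upP; rewrite ?m1.
    by rewrite h opprK -m1; apply: dnP; rewrite ?m1.
  by rewrite !fU ?oppr0// unitrM negb_and cU.
have Sinv b : b \in S -> b^-1 \in S.
  move=> bS; have := fSm _ bS; rewrite fS ?SU//; case: ifP => // _ h; lra.
have memS x : x \is a GRing.unit -> f x = -1 -> x \in S.
  by move=> xU; rewrite fS//; case: ifP => [/Sinv|_ h]; [rewrite invrK | lra].
split => // x y.
have [xU|xU] := boolP (x \is a GRing.unit); last first.
  by rewrite (fU x)// mul0r fU// unitrM negb_and xU.
have [yU|yU] := boolP (y \is a GRing.unit); last first.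
  by rewrite (fU y)// mulr0 fU// unitrM negb_and yU orbT.
have [hy|hy] := f_pm y yU; last by rewrite hy mulrN1 mulS// memS.
have [hx|hx] := f_pm x xU; last by rewrite hx mulN1r mulrC mulS// memS.
have xyU : x * y \is a GRing.unit by rewrite unitrM xU.
have xVU : x^-1 \is a GRing.unit by rewrite unitrV.
rewrite hx hy mulr1; have [//|hxy] := f_pm _ xyU.
have := mulS x^-1 _ (memS _ xyU hxy); rewrite mulKr// hy.
have [->|hV] := f_pm _ xVU; first by move=> h; lra.
by have := Sinv _ (memS _ xVU hV); rewrite invrK => /fSm; lra.
Qed.

Lemma Lval_scale (s : R) g : mean0 g -> Lval (fun x => s * g x) = s * Lval g.
Proof.
move=> gm; have := @Lval_sum R q 'I_1 (fun=> s) (fun=> g) (fun=> gm).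
rewrite big_ord1 => <-; congr Lval; apply/funext => x; by rewrite big_ord1.
Qed.

(** The sum [D] over n not prime to M is bounded through N * D. As N / n is at most twice its
    integer part, this is at most a double sum; in the other order its inner sums are at most s * ln
    (N / k) by [sum_vonM_noncoprime], and ln N - ln k sums to at most N. *)
Lemma vsum_chi0 : exists C : R, forall N, (0 < N)%N -> `|vsum (@chi0 R q) N - ln N%:R| <= C.
Proof.
set s : R := (size (primes M))%:R; have s0 : 0 <= s by rewrite ler0n.
exists (8 + 2 * s) => N N0; have N0' : 0 < N%:R :> R by rewrite ltr0n.
pose D : R := \sum_(1 <= n < N.+1) (1 - chi0 (n%:R : Z)) * vonM n / n%:R.
have c01 n : 0 <= (1 : R) - chi0 (n%:R : Z).
  by rewrite /chi0; case: (_ \is a _); rewrite ?subrr ?subr0 ?ler01.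
have D0 : 0 <= D.
  by apply: sumr_ge0 => n _; rewrite divr_ge0// mulr_ge0// vonM_ge0.
have D1 : N%:R * D <= N%:R * (2 * s).
  apply: (@le_trans _ _ (2 * \sum_(1 <= n < N.+1) \sum_(1 <= k < (N %/ n).+1) (1 - chi0 (n%:R : Z)) * vonM n)).
    rewrite mulr_sumr mulr_sumr; apply: ler_sum_nat => n /andP[n0 nN].
    rewrite sumr_const_nat subn1 /= -[X in _ <= 2 * X]mulr_natl.
    have v0 : 0 <= ((1 : R) - chi0 (n%:R : Z)) * vonM n by rewrite mulr_ge0 ?vonM_ge0.
    move: (_ * vonM n) v0 => v v0.
    rewrite (_ : N%:R * (v / n%:R) = N%:R / n%:R * v); last by ring.
    rewrite mulrA ler_wpM2r//.
    have := @ratio_lt_divn R n N n0.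
    have K1 : 1 <= (N %/ n)%:R :> R by rewrite ler1n divn_gt0//; lia.
    lra.
  rewrite mulrCA ler_pM2l// sum_hyperbola_sym.
  apply: (@le_trans _ _ (s * \sum_(1 <= k < N.+1) (ln N%:R - ln k%:R))).
    rewrite mulr_sumr; apply: ler_sum_nat => k kN; have /andP[k0 kN'] := kN.
    have K0 : (0 < N %/ k)%N by rewrite divn_gt0//; lia.
    have /andP[_ +] := @sum_vonM_noncoprime R q _ K0.
    rewrite /psi /psig -sumrB (eq_bigr (fun n => (1 - chi0 (n%:R : Z)) * vonM n)); last first.
      by move=> n _; rewrite mulrBl mul1r.
    move=> h; apply: le_trans h _; rewrite -/s ler_wpM2l// -ln_div ?posrE ?ltr0n//.
    exact: divnS_ratio_ln.
  rewrite mulrC ler_wpM2r// sumrB sumr_const_nat subn1 /= -/(lnfact N).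
  have /andP[+ _] := @lnfact_bounds R _ N0; rewrite -mulr_natl; lra.
have vE : vsum (@chi0 R q) N = \sum_(1 <= n < N.+1) vonM n / n%:R - D.
  by rewrite /D /vsum -sumrB; apply: eq_bigr => n _; ring.
have /andP[m1 m2] := @mertens R _ N0.
rewrite ler_pM2l// in D1; rewrite vE; move: (\sum_(_ <= _ < _) _) m1 m2 => t m1 m2.
by rewrite ler_norml; apply/andP; split; lra.
Qed.

(** For h in the kernel, [vsum_ker] reads: the p-average of the translates of h is - h ([kp]). A
    nonzero g in the kernel would make p non-uniform, and the deviation f of p from uniformity would
    be a real character by [real_character_of_average], with Lval f = 0, against
    [real_char_Lval_neq0]. *)
Lemma Lshift_injective g : mean0 g -> (forall b, Lval (shift b g) = 0) -> forall x, g x = 0.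
Proof.
move=> gm gK x0; apply/eqP; apply: contraT => gx0.
have [p [p0 pU pP]] := @density_limit_point R q.
have kp h c : mean0 h -> (forall b, Lval (shift b h) = 0) ->
    \sum_b p b * h (c * b) = - h c.
  move=> hm hK; have hK' b : Lval (shift b (shift c h)) = 0 by rewrite shift_shift.
  have [C hC] := vsum_ker (mean0_shift c hm) hK'.
  have E : shift c h 1 = h c by rewrite /shift mulr1.
  rewrite -(pP (shift c h) (- h c) C (mean0_shift c hm).1).
    by apply: eq_bigr => b _; rewrite mulrC.
  by move=> N N0; rewrite mulNr opprK -E; exact: hC.
have Lp h : mean0 h -> \sum_b p b * Lval (shift b h) = 0.
  move=> hm; have [C hC] := vsum_Lshift hm.
  transitivity (\sum_b Lshift h b * p b); first by apply: eq_bigr => b _; rewrite mulrC.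
  apply: (pP _ _ C (Lshift_mean0 hm).1).
  by move=> N N0; rewrite mul0r subr0; exact: hC.
pose phi : R := \sum_(a : Z) chi0 a.
have phi0 : 0 < phi.
  rewrite /phi (bigD1 1)//= {1}/chi0 unitr1.
  by apply: ltr_pwDl => //; apply: sumr_ge0 => a _; rewrite ler0n.
have chip b : chi0 b * p b = p b.
  rewrite /chi0; case: (boolP (b \is a _)) => bU; rewrite ?mul1r//.
  by rewrite pU// mulr0.
have [C0 hC0] := vsum_chi0.
have p1 : \sum_b p b = 1.
  transitivity (\sum_b chi0 b * p b); first by apply: eq_bigr => b _; rewrite chip.
  apply: (pP _ _ C0 (@chi0_unit_supp R q)) => N N0; rewrite mul1r; exact: hC0.
(* Because of the inverse, each shift of f is - phi times a p-average of translates of a centred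
   point mass [G]. By [Lp] the p-average of any [Lshift] vanishes, so every shift of f has [Lval]
   0. *)
pose f x := chi0 x * (1 - phi * p x^-1).
have sum_pV : \sum_x chi0 x * p x^-1 = 1.
  rewrite -p1 [RHS](reindex_inj (h := fun x : Z => x^-1))/=; last exact: invr_inj.
  apply: eq_bigr => x _; rewrite -[RHS]chip /chi0 unitrV//.
have fm : mean0 f.
  split; first by move=> a aU; rewrite /f (@chi0_unit_supp R q a)// mul0r.
  rewrite /f; under eq_bigr do rewrite mulrBr mulr1 mulrCA.
  by rewrite sumrB -mulr_sumr sum_pV mulr1 subrr.
pose G c x : R := dirac_unit c x - chi0 x / phi.
have Gm c : c \is a GRing.unit -> mean0 (G c).
  move=> cU; split.
    by move=> a aU; rewrite /G dirac_unit_supp// (@chi0_unit_supp R q a)// mul0r subrr.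
  rewrite /G sumrB -mulr_suml divff ?gt_eqF//.
  rewrite (bigD1 c)//= big1 => [|b /negbTE bc]; last by rewrite /dirac_unit bc mul0r.
  by rewrite /dirac_unit eqxx /chi0 cU mulr1 addr0 subrr.
have fK c : Lval (shift c f) = 0.
  have [cU|cU] := boolP (c \is a GRing.unit); last first.
    by rewrite (shift_nonunit fm.1 cU) Lval0.
  have cVU : c^-1 \is a GRing.unit by rewrite unitrV.
  have -> : shift c f = (fun x => (- phi) * \sum_b p b * shift b (G c^-1) x).
    apply/funext => x; rewrite /shift /f.
    have [xU|xU] := boolP (x \is a GRing.unit); last first.
      have -> : chi0 (c * x) = 0 :> R by rewrite /chi0 unitrM (negbTE xU) andbF.
      rewrite mul0r big1 ?mulr0// => b _; rewrite (Gm _ cVU).1 ?mulr0//.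
      by rewrite unitrM negb_and xU orbT.
    have -> : chi0 (c * x) = 1 :> R by rewrite /chi0 unitrM cU xU.
    rewrite /G; under eq_bigr do rewrite mulrBr chi0M.
    rewrite sumrB (_ : \sum_b p b * (chi0 b * chi0 x / phi) = phi^-1); last first.
      rewrite -[RHS]mul1r -p1 mulr_suml; apply: eq_bigr => b _.
      by rewrite /(chi0 x) xU mulr1 mulrA [p b * _]mulrC chip.
    rewrite (bigD1 (c * x)^-1)//= big1 => [|b bc]; last first.
      rewrite /dirac_unit; case: eqP => [bx|_]; last by rewrite mul0r mulr0.
      by move: bc; rewrite -(mulrK xU b) bx invrM// mulrC eqxx.
    rewrite /dirac_unit (_ : (c * x)^-1 * x = c^-1); last first.
      by rewrite invrM// mulrAC mulVr// mul1r.
    rewrite eqxx /chi0 cVU !mulr1 addr0 mul1r.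
    by field; rewrite gt_eqF.
  have Sm b : mean0 (shift b (G c^-1)) by apply: mean0_shift; exact: Gm.
  rewrite Lval_scale; last exact: mean0_sum.
  by rewrite Lval_sum// Lp ?mulr0//; exact: Gm.
have fle x : x \is a GRing.unit -> f x <= 1.
  by move=> xU; rewrite /f /chi0 xU mul1r gerBl mulr_ge0// ltW.
have f1E x : x \is a GRing.unit -> (f x == 1) = (p x^-1 == 0).
  move=> xU; rewrite /f /chi0 xU mul1r -subr_eq0 addrAC subrr sub0r oppr_eq0.
  by rewrite mulf_eq0 (gt_eqF phi0).
have fw c : \sum_b p b * f (c * b) = - f c by exact: kp.
(* If f vanished, p would be uniform and [kp] would give g x0 = 0. *)
have fn0 : exists c, f c != 0.
  apply/existsP; apply: contraT; rewrite negb_exists => /forallP fz.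
  have pE x : x \is a GRing.unit -> p x = phi^-1.
    move=> xU; have := fz x^-1; rewrite negbK /f /chi0 unitrV xU mul1r invrK subr_eq0.
    by move=> /eqP h; rewrite -[RHS]mulr1 h mulKf// gt_eqF.
  have [x0U|x0U] := boolP (x0 \is a GRing.unit); last by rewrite gm.1// eqxx in gx0.
  have := kp g x0 gm gK; rewrite (eq_bigr (fun b => phi^-1 * shift x0 g b)).
    by rewrite -mulr_sumr (mean0_shift x0 gm).2 mulr0 => /esym/eqP; rewrite oppr_eq0 (negbTE gx0).
  move=> b _; rewrite /shift; have [bU|bU] := boolP (b \is a GRing.unit); first by rewrite pE.
  by rewrite pU// mul0r gm.1 ?mulr0// unitrM negb_and bU orbT.
have [fpm f1 fM] := real_character_of_average p0 p1 pU fm.1 fle f1E fw fn0.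
by have := fK 1; rewrite shift1 => /(real_char_Lval_neq0 fm fM f1 fpm).
Qed.

End RealCharacter.

(** * Surjectivity of [Lshift] and bounded logarithmic sums *)

Section DirichletBounded.
Context {R : realType} (q : nat).
Local Notation M := q.+2.
Local Notation Z := 'Z_M.
Implicit Types (f g h : Z -> R) (a b c i j x y : Z) (n k d N K : nat).

Lemma Lshift_surjective g : mean0 g -> exists2 h, mean0 h & Lshift h = g.
Proof.
move=> gm; pose phi : R := \sum_(a : Z) chi0 a.
have phi0 : 0 < phi.
  rewrite /phi (bigD1 1)//= {1}/chi0 unitr1.
  by apply: ltr_pwDl => //; apply: sumr_ge0 => a _; rewrite ler0n.
pose G i : Z -> R := fun x => chi0 i * (dirac_unit i x - chi0 x / phi).
have Gm i : mean0 (G i).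
  split.
    by move=> a aU; rewrite /G dirac_unit_supp// (@chi0_unit_supp R q a)// mul0r subrr mulr0.
  rewrite /G -mulr_sumr sumrB -mulr_suml divff ?gt_eqF//.
  rewrite (bigD1 i)//= big1 => [|b /negbTE bc]; last by rewrite /dirac_unit bc mul0r.
  rewrite /dirac_unit eqxx mul1r addr0 /chi0.
  by case: (_ \is a _); rewrite ?mul0r// subrr mulr0.
(* [Lshift] on the spanning family [G], completed to a square matrix on all functions: the middle
   term takes care of the direction of chi0, the last is the identity on non-units. Then injectivity
   of [Lshift] makes [A] invertible. *)
pose A : 'M[R]_((Zp_trunc M).+2) := \matrix_(i, j)
  (Lshift (G i) j + chi0 (i : Z) * chi0 (j : Z) / phi + (1 - chi0 (i : Z)) * (i == j)%:R).
have AP (u : 'rV[R]_((Zp_trunc M).+2)) g' : mean0 g' -> (forall j, (u *m A) ord0 j = g' j) ->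
    mean0 (fun x : Z => u ord0 x) /\ Lshift (fun x : Z => u ord0 x) = g'.
  move=> gm' uA; set w := fun x : Z => u ord0 x.
  have E j : g' j = \sum_i w i * Lshift (G i) j + (\sum_i w i * chi0 i) * chi0 j / phi
      + w j * (1 - chi0 j).
    rewrite -uA mxE -mulrA mulr_suml.
    rewrite (_ : w j * (1 - chi0 j) = \sum_i w i * ((1 - chi0 i) * (i == j)%:R)); last first.
      rewrite (bigD1 j)//= eqxx mulr1 big1 ?addr0// => i /negbTE ->.
      by rewrite !mulr0.
    rewrite -!big_split /=; apply: eq_bigr => i _; rewrite mxE /w; ring.
  have wU : unit_supp w.
    move=> j jU; have := E j; rewrite gm'.1// (@chi0_unit_supp R q j)//.
    rewrite mulr0 mul0r addr0 subr0 mulr1 big1 ?add0r// => i _.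
    by rewrite (Lshift_mean0 (Gm i)).1 ?mulr0.
  have wc i : w i * chi0 i = w i.
    by rewrite /chi0; case: (boolP (i \is a _)) => iU; rewrite ?mulr1// mulr0 wU.
  have w0 : \sum_i w i = 0.
    have := gm'.2; under eq_bigr do rewrite E mulrBr mulr1 wc subrr addr0.
    rewrite big_split /= exchange_big /= [X in X + _]big1 ?add0r => [|i _]; last first.
      by rewrite -mulr_sumr (Lshift_mean0 (Gm i)).2 mulr0.
    under eq_bigr do rewrite -mulrA.
    rewrite -mulr_sumr -mulr_suml divff ?gt_eqF// mulr1.
    by under eq_bigr do rewrite wc.
  split => //; apply/funext => j; rewrite E mulrBr mulr1 wc subrr addr0.
  under [X in _ + X * _ / _]eq_bigr do rewrite wc.
  rewrite w0 !mul0r addr0 /Lshift.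
  rewrite -Lval_sum; last by move=> i; exact: mean0_shift.
  congr Lval; apply/funext => x; rewrite /shift /G.
  under eq_bigr do rewrite mulrA wc mulrBr.
  by rewrite sumrB -mulr_suml w0 mul0r subr0 sum_dirac_unit.
have Aunit : A \in unitmx.
  rewrite -row_free_unit; apply: inj_row_free => u uA.
  have [um uL] : mean0 (fun x : Z => u ord0 x) /\ Lshift (fun x : Z => u ord0 x) = (fun=> 0).
    apply: AP; first by split => //; rewrite big1.
    by move=> j; rewrite uA mxE.
  apply/rowP => j; rewrite mxE; apply: (Lshift_injective um) => b.
  by rewrite -[LHS]/(Lshift _ b) uL.
pose v : 'rV[R]_((Zp_trunc M).+2) := \row_j g j.
have [um uL] := AP (v *m invmx A) g gm (fun j => ltac:(by rewrite mulmxKV// mxE)).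
by exists (fun x : Z => (v *m invmx A) ord0 x).
Qed.

Lemma dirichlet_bounded g : mean0 g ->
  exists C : R, forall N, (0 < N)%N -> `|vsum g N| <= C.
Proof. by move=> /Lshift_surjective[h hm <-]; exact: vsum_Lshift. Qed.

End DirichletBounded.

(** * Selberg's inequality for residue classes *)

Arguments chi0 {R q} a.

Section SelbergInequality.
Context {R : realType} (q : nat).
Local Notation M := q.+2.
Local Notation Z := 'Z_M.
Implicit Types (f g h : Z -> R) (a b c i j x y : Z) (n k d N K : nat).

Definition phiM : R := \sum_(a : Z) chi0 a.

Lemma phiM_gt0 : 0 < phiM.
Proof.
rewrite /phiM (bigD1 1)//= {1}/chi0 unitr1.
by apply: ltr_pwDl => //; apply: sumr_ge0 => a _; rewrite ler0n.
Qed.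

Lemma selberg_class h : unit_supp h -> exists2 C : R, 0 <= C & forall N, (0 < N)%N ->
  `|psig h N * ln N%:R + \sum_(1 <= k < N.+1) vonM k * psig (shift k%:R h) (N %/ k)
    - 2 * ((\sum_a h a) / phiM) * N%:R * ln N%:R| <= C * N%:R.
Proof.
move=> hU; set m := (\sum_a h a) / phiM; have phi0 := phiM_gt0.
pose g x := h x - m * chi0 x.
have gm : mean0 g.
  split; first by move=> a aU; rewrite /g hU// (@chi0_unit_supp R q a)// mulr0 subr0.
  by rewrite /g sumrB -mulr_sumr -/phiM /m divfK ?gt_eqF// subrr.
have [C C0 hC] := @selberg_chi0 R q.
exists (128 * norm1 g + `|m| * C) => [|N N0].
  by rewrite addr_ge0// mulr_ge0// norm1_ge0.
have E c K : psig (shift c h) K = psig (shift c g) K + m * psig (shift c chi0) K.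
  rewrite /psig mulr_sumr -big_split /=; apply: eq_bigr => n _.
  by rewrite /g /shift; ring.
have -> : \sum_(1 <= k < N.+1) vonM k * psig (shift k%:R h) (N %/ k) =
   \sum_(1 <= k < N.+1) vonM k * psig (shift k%:R g) (N %/ k) +
   m * \sum_(1 <= k < N.+1) vonM k * psig (shift (k%:R : Z) chi0) (N %/ k).
  by rewrite mulr_sumr -big_split /=; apply: eq_bigr => k _; rewrite E; ring.
have := E 1 N; rewrite !shift1 => ->.
have := @selberg_mean0 R q g N gm N0; have := hC _ N0.
move: (\sum_(1 <= k < N.+1) vonM k * psig (shift k%:R g) _) => A.
move: (\sum_(1 <= k < N.+1) vonM k * psig (shift k%:R chi0) _) => B h1 h2.
rewrite (_ : _ - _ = (psig g N * ln N%:R + A) + m * (psig (chi0 : Z -> R) N * ln N%:R + B - 2 * N%:R * ln N%:R)); last by ring.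
apply: le_trans (ler_normD _ _) _; rewrite [leRHS]mulrDl lerD//.
by rewrite normrM -[leRHS]mulrA ler_wpM2l.
Qed.

(** Selberg's function, the Dirichlet convolution of the Moebius function with the square of ln. *)
Definition vonM2 n : R := vonM n * ln n%:R + \sum_(d <- divisors n) vonM d * vonM (n %/ d).

(** Compared with [selberg_class] the factor ln N becomes ln n, at a cost O(N) by [sum_vonM_ln]. *)
Lemma sum_vonM2 h : unit_supp h -> exists2 C : R, 0 <= C & forall N, (0 < N)%N ->
  `|\sum_(1 <= n < N.+1) h n%:R * vonM2 n
    - 2 * ((\sum_a h a) / phiM) * N%:R * ln N%:R| <= C * N%:R.
Proof.
move=> hU; have [C C0 hC] := selberg_class hU.
have n0 := norm1_ge0 h.
exists (C + 8 * norm1 h) => [|N N0]; first by rewrite addr_ge0// mulr_ge0.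
have N0' : 0 < N%:R :> R by rewrite ltr0n.
have -> : \sum_(1 <= n < N.+1) h n%:R * vonM2 n =
  (psig h N * ln N%:R + \sum_(1 <= k < N.+1) vonM k * psig (shift k%:R h) (N %/ k))
   - \sum_(1 <= n < N.+1) h n%:R * (vonM n * ln (N%:R / n%:R)).
  have -> : \sum_(1 <= k < N.+1) vonM k * psig (shift k%:R h) (N %/ k) =
     \sum_(1 <= n < N.+1) h n%:R * \sum_(d <- divisors n) vonM d * vonM (n %/ d).
    transitivity (\sum_(1 <= d < N.+1) \sum_(1 <= k < (N %/ d).+1)
       h (d * k)%:R * (vonM d * vonM k)).
      apply: eq_bigr => d _; rewrite /psig mulr_sumr; apply: eq_bigr => k _.
      by rewrite /shift natrM; ring.
    rewrite -(sum_divisors_exchange (fun d k => h (d * k)%:R * (vonM d * vonM k))).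
    rewrite big_nat [RHS]big_nat; apply: eq_bigr => n /andP[k0 _].
    rewrite mulr_sumr big_seq [RHS]big_seq; apply: eq_bigr => d.
    by rewrite -dvdn_divisors// [(d * _)%N]mulnC => /divnK->.
  rewrite /psig mulr_suml -big_split -sumrB /= big_nat [RHS]big_nat.
  apply: eq_bigr => n /andP[k0 _].
  by rewrite ln_div ?posrE ?ltr0n// /vonM2; ring.
rewrite (_ : _ - _ - _ = (psig h N * ln N%:R + \sum_(1 <= k < N.+1) vonM k * psig (shift k%:R h) (N %/ k)
   - 2 * ((\sum_a h a) / phiM) * N%:R * ln N%:R)
   - \sum_(1 <= n < N.+1) h n%:R * (vonM n * ln (N%:R / n%:R))); last by ring.
apply: le_trans (ler_normB _ _) _; rewrite [leRHS]mulrDl lerD ?hC//.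
apply: le_trans (ler_norm_sum _ _ _) _.
apply: (@le_trans _ _ (norm1 h * \sum_(1 <= n < N.+1) vonM n * ln (N%:R / n%:R))).
  rewrite mulr_sumr; apply: ler_sum_nat => n nN; rewrite normrM.
  have l0 : 0 <= vonM n * ln (N%:R / n%:R) :> R.
    by rewrite mulr_ge0 ?vonM_ge0 ?ln_ge0 ?ratio_ge1.
  by rewrite (ger0_norm l0) ler_wpM2r// le_norm1.
by rewrite (mulrC 8) -mulrA ler_wpM2l// sum_vonM_ln.
Qed.

Lemma psig_shift_le g c K : unit_supp g -> `|psig (shift c g) K| <= 8 * norm1 g * K%:R.
Proof.
move=> gU; apply: le_trans (psig_le _ _) _; rewrite (mulrC 8) -mulrA.
by apply: ler_pM; rewrite ?norm1_ge0 ?psi_ge0 ?psi_le ?norm1_shift.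
Qed.

(** ln N times [selberg_mean0] at N, minus the sum over m of vonM m times the same formula at N / m
    for the shifted function. The terms vonM m * ln m and vonM m * vonM k enter with opposite signs;
    absolute values merge them into [vonM2]. [dl] measures the rounding of N / m. *)
Lemma selberg_iterated g N : mean0 g -> (0 < N)%N ->
  `|psig g N| * ln N%:R ^+ 2 <=
  \sum_(1 <= n < N.+1) vonM2 n * `|psig (shift n%:R g) (N %/ n)|
   + 1100 * norm1 g * N%:R * (1 + ln N%:R).
Proof.
move=> gm N0; set G := norm1 g; have G0 : 0 <= G := norm1_ge0 g.
have N0' : 0 < N%:R :> R by rewrite ltr0n.
have l0 : 0 <= ln N%:R :> R by rewrite ln_ge0// ler1n.
pose r d K := psig (shift d%:R g) K.
pose e m : R := r m (N %/ m)%N * ln (N %/ m)%:R +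
   \sum_(1 <= k < (N %/ m).+1) vonM k * r (m * k)%N (N %/ (m * k))%N.
pose dl m : R := ln (N%:R / m%:R) - ln (N %/ m)%:R.
have eb m : (0 < m < N.+1)%N -> `|e m| <= 128 * G * (N%:R / m%:R).
  move=> /andP[m0 mN]; have K0 : (0 < N %/ m)%N by rewrite divn_gt0//; lia.
  have := @selberg_mean0 R q _ _ (mean0_shift m%:R gm) K0.
  rewrite /e /r; under eq_bigr do rewrite shift_shift -natrM -divnMA.
  move=> h; apply: le_trans h _; apply: ler_pM.
  - by rewrite mulr_ge0// norm1_ge0.
  - by rewrite ler0n.
  - by rewrite ler_wpM2l// norm1_shift//; exact: gm.1.
  - exact: divn_le_ratio.
have rb d K : `|r d K| <= 8 * G * K%:R by exact: psig_shift_le gm.1.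
have db m : (0 < m < N.+1)%N -> `|r m (N %/ m)%N * dl m| <= 8 * G.
  move=> mN; have /andP[m0 mN'] := mN.
  have K0 : (0 < N %/ m)%N by rewrite divn_gt0//; lia.
  have K0' : 0 < (N %/ m)%:R :> R by rewrite ltr0n.
  have y0 : 0 < N%:R / m%:R :> R by rewrite divr_gt0// ltr0n.
  have d0 : 0 <= dl m by rewrite subr_ge0 divnS_ratio_ln.
  rewrite normrM (ger0_norm d0).
  apply: (@le_trans _ _ (8 * G * ((N %/ m)%:R * dl m))).
    by rewrite mulrA ler_wpM2r.
  rewrite -[leRHS]mulr1 ler_wpM2l ?mulr_ge0//.
  rewrite /dl -ln_div ?posrE//.
  apply: le_trans (ler_wpM2l (ltW K0') (ln_le_subr1 (divr_gt0 y0 K0'))) _.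
  rewrite mulrBr mulr1 mulrC divfK ?gt_eqF//.
  by have := @ratio_lt_divn R m N m0; lra.
have main : psig g N * ln N%:R ^+ 2 = e 1%N * ln N%:R
   - \sum_(1 <= m < N.+1) vonM m * (r m (N %/ m)%N * dl m)
   - \sum_(1 <= m < N.+1) vonM m * e m
   + (\sum_(1 <= m < N.+1) \sum_(1 <= k < (N %/ m).+1) vonM m * vonM k * r (m * k)%N (N %/ (m * k))%N
   - \sum_(1 <= m < N.+1) vonM m * ln m%:R * r m (N %/ m)%N).
  rewrite /e divn1; set S1 := \sum_(1 <= k < N.+1) vonM k * r (1 * k)%N _.
  have -> : r 1%N N = psig g N by rewrite /r shift1.
  have -> : \sum_(1 <= m < N.+1) vonM m * (r m (N %/ m)%N * dl m) =
     ln N%:R * S1 - \sum_(1 <= m < N.+1) vonM m * ln m%:R * r m (N %/ m)%N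
     - \sum_(1 <= m < N.+1) vonM m * (r m (N %/ m)%N * ln (N %/ m)%:R).
    rewrite /S1 mulr_sumr -!sumrB big_nat [RHS]big_nat; apply: eq_bigr => m /andP[m0 _].
    by rewrite /dl ln_div ?posrE ?ltr0n// mul1n; ring.
  have -> : \sum_(1 <= m < N.+1) vonM m * (r m (N %/ m)%N * ln (N %/ m)%:R +
        \sum_(1 <= k < (N %/ m).+1) vonM k * r (m * k)%N (N %/ (m * k))%N) =
     \sum_(1 <= m < N.+1) vonM m * (r m (N %/ m)%N * ln (N %/ m)%:R) +
     \sum_(1 <= m < N.+1) \sum_(1 <= k < (N %/ m).+1) vonM m * vonM k * r (m * k)%N (N %/ (m * k))%N.
    rewrite -big_split /=; apply: eq_bigr => m _; rewrite mulrDr mulr_sumr.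
    by congr (_ + _); apply: eq_bigr => k _; rewrite mulrA.
  move: (\sum_(_ <= _ < _) \sum_(_ <= _ < _) _) => X1.
  move: (\sum_(_ <= _ < _) vonM _ * ln _ * _) => X2.
  move: (\sum_(_ <= _ < _) vonM _ * (_ * _)) => X3.
  ring.
rewrite -[leLHS](_ : `|psig g N * ln N%:R ^+ 2| = _); last first.
  by rewrite normrM [`|_ ^+ 2|]ger0_norm// exprn_ge0.
rewrite main.
have b1 : `|e 1%N * ln N%:R| <= 128 * G * N%:R * ln N%:R.
  rewrite normrM (ger0_norm l0) ler_wpM2r//.
  by have := eb 1%N; rewrite divr1; apply.
have b2 : `|\sum_(1 <= m < N.+1) vonM m * (r m (N %/ m)%N * dl m)| <= 64 * G * N%:R.
  apply: le_trans (ler_norm_sum _ _ _) _.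
  apply: (@le_trans _ _ (\sum_(1 <= m < N.+1) vonM m * (8 * G))).
    apply: ler_sum_nat => m mN; rewrite normrM (ger0_norm (vonM_ge0 _)).
    by rewrite ler_wpM2l ?vonM_ge0// db.
  rewrite -mulr_suml -/(psi N); have := @psi_le R N.
  by move: (psi N) => p; nra.
have b3 : `|\sum_(1 <= m < N.+1) vonM m * e m| <= 128 * G * N%:R * (ln N%:R + 8).
  apply: le_trans (ler_norm_sum _ _ _) _.
  apply: (@le_trans _ _ (\sum_(1 <= m < N.+1) 128 * G * N%:R * (vonM m / m%:R))).
    apply: ler_sum_nat => m mN; rewrite normrM (ger0_norm (vonM_ge0 _)).
    apply: le_trans (ler_wpM2l (vonM_ge0 _) (eb _ mN)) _.
    by rewrite le_eqVlt; apply/orP; left; apply/eqP; ring.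
  rewrite -mulr_sumr ler_wpM2l ?mulr_ge0// ?ler0n//.
  by have /andP[] := @mertens R N N0.
have b4 : `|\sum_(1 <= m < N.+1) \sum_(1 <= k < (N %/ m).+1) vonM m * vonM k * r (m * k)%N (N %/ (m * k))%N
   - \sum_(1 <= m < N.+1) vonM m * ln m%:R * r m (N %/ m)%N| <=
   \sum_(1 <= n < N.+1) vonM2 n * `|r n (N %/ n)%N|.
  rewrite -(sum_divisors_exchange (fun m k => vonM m * vonM k * r (m * k)%N (N %/ (m * k))%N)).
  rewrite -sumrB; apply: le_trans (ler_norm_sum _ _ _) _; apply: ler_sum_nat => n /andP[n0 _].
  apply: le_trans (ler_normB _ _) _; rewrite /vonM2 mulrDl addrC lerD//.
    have v0 : 0 <= vonM n * ln n%:R :> R by rewrite mulr_ge0 ?vonM_ge0 ?ln_ge0 ?ler1n.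
    by rewrite normrM (ger0_norm v0).
  apply: le_trans (ler_norm_sum _ _ _) _; rewrite mulr_suml big_seq [leRHS]big_seq.
  apply: ler_sum => d; rewrite -dvdn_divisors// => /divnK; rewrite mulnC => ->.
  have v0 : 0 <= vonM d * vonM (n %/ d)%N :> R by rewrite mulr_ge0 ?vonM_ge0.
  by rewrite normrM (ger0_norm v0).
apply: le_trans (ler_normD _ _) _; rewrite addrC lerD//.
apply: le_trans (ler_normB _ _) _; apply: le_trans (lerD (ler_normB _ _) b3) _.
apply: le_trans (lerD (lerD b1 b2) (lexx _)) _.
have GN : 0 <= G * N%:R by rewrite mulr_ge0// ltW.
have GNl : 0 <= G * N%:R * ln N%:R by rewrite mulr_ge0.
rewrite [leLHS](_ : _ = 256 * (G * N%:R * ln N%:R) + 1088 * (G * N%:R)); last by ring.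
rewrite [leRHS](_ : _ = 1100 * (G * N%:R * ln N%:R) + 1100 * (G * N%:R)); last by ring.
by lra.
Qed.

Lemma sum_psi_div N : \sum_(1 <= n < N.+1) psi (N %/ n) = lnfact N :> R.
Proof.
rewrite lnfact_vonM /psi sum_hyperbola_sym; apply: eq_bigr => d _.
by rewrite sumr_const_nat subn1 mulr_natr.
Qed.

Lemma psi_mono N K : (N <= K)%N -> psi N <= psi K :> R.
Proof.
move=> NK; rewrite /psi [leRHS](big_cat_nat _ (n := N.+1))//= lerDl.
by apply: sumr_ge0 => n _; exact: vonM_ge0.
Qed.

Lemma psig_dist g N K : (N <= K)%N -> `|psig g K - psig g N| <= norm1 g * (psi K - psi N).
Proof.
move=> NK; rewrite /psig /psi (big_cat_nat _ (n := N.+1))//= [X in _ * (X - _)](big_cat_nat _ (n := N.+1))//=.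
rewrite [_ + _ - _]addrC addKr [X in _ * X]addrC addKr mulr_sumr.
apply: le_trans (ler_norm_sum _ _ _) _; apply: ler_sum => n _.
by rewrite normrM (ger0_norm (vonM_ge0 _)) ler_wpM2r ?vonM_ge0// le_norm1.
Qed.

Lemma lnfact_le N : (0 < N)%N -> lnfact N <= N%:R * ln N%:R :> R.
Proof.
move=> N0; have /andP[_] := @lnfact_bounds R N N0.
have N0' : 0 < N%:R :> R by rewrite ltr0n.
by have := ln_le_subr1 N0'; lra.
Qed.

(** Partial summation in each class b replaces [vonM2] by its mean 2 / phiM * ln. From n to n + 1,
    |psig (shift b g) (N / n)| varies by at most norm1 g times the drop of psi (N / n); weighted by
    n, these drops sum to at most the sum of all psi (N / n), which is lnfact N. *)
Lemma selberg_log_weights g : mean0 g -> exists2 C : R, 0 <= C & forall N, (0 < N)%N ->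
  `|psig g N| * ln N%:R ^+ 2 <=
  2 / phiM * (\sum_(1 <= n < N.+1) \sum_b ln n%:R * `|psig (shift b g) (N %/ n)|)
   + C * N%:R * (1 + ln N%:R).
Proof.
move=> gm; set G := norm1 g; have G0 : 0 <= G := norm1_ge0 g.
have phi0 := phiM_gt0.
have hb b : exists C : R, 0 <= C /\ forall N, (0 < N)%N ->
  `|\sum_(1 <= n < N.+1) dirac_unit b n%:R * vonM2 n - chi0 b * (2 / phiM) * N%:R * ln N%:R| <= C * N%:R.
  have [C C0 hC] := sum_vonM2 (@dirac_unit_supp R q b).
  exists C; split => // N N0; have := hC N N0.
  rewrite (_ : \sum_a dirac_unit b a = chi0 b).
    by rewrite (_ : 2 * (chi0 b / phiM) = chi0 b * (2 / phiM))//; ring.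
  rewrite (bigD1 b)//= big1 => [|c /negbTE bc]; last by rewrite /dirac_unit bc mul0r.
  by rewrite /dirac_unit eqxx mul1r addr0.
have [Cb CbP] := boolp.choice hb.
pose C := \sum_b G * (Cb b + 2 / phiM).
have C0 : 0 <= C.
  apply: sumr_ge0 => b _; rewrite mulr_ge0// addr_ge0 ?divr_ge0 ?(ltW phi0)//.
  by have [] := CbP b.
exists (C + 1100 * G) => [|N N0]; first by clear -C0 G0; lra.
have N0' : 0 < N%:R :> R by rewrite ltr0n.
have l0 : 0 <= ln N%:R :> R by rewrite ln_ge0// ler1n.
apply: le_trans (selberg_iterated gm N0) _.
rewrite [(C + _) * _]mulrDl [(_ + _) * (1 + _)]mulrDl addrA lerD//.
have -> : \sum_(1 <= n < N.+1) vonM2 n * `|psig (shift n%:R g) (N %/ n)| =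
   \sum_b \sum_(1 <= n < N.+1) dirac_unit b n%:R * vonM2 n * `|psig (shift b g) (N %/ n)|.
  rewrite exchange_big /=; apply: eq_bigr => n _.
  rewrite (bigD1 n%:R)//= [X in _ + X]big1 => [|b /negbTE bc]; last first.
    by rewrite /dirac_unit eq_sym bc !mul0r.
  rewrite addr0 /dirac_unit eqxx mul1r /chi0; case: (boolP (_ \is a _)) => nU; rewrite ?mul1r//.
  by rewrite (shift_nonunit gm.1 nU) /psig big1 ?normr0 ?mulr0// => i _; rewrite mul0r.
rewrite [X in _ <= _ * X + _]exchange_big /= mulr_sumr -/G.
apply: (@le_trans _ _ (\sum_b (2 / phiM * (\sum_(1 <= n < N.+1) ln n%:R * `|psig (shift b g) (N %/ n)|)
   + G * (Cb b + 2 / phiM) * N%:R * ln N%:R))); last first.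
  rewrite big_split /= lerD2l -!mulr_suml -/C -mulrA -[leRHS]mulrA ler_wpM2l//.
  by rewrite ler_wpM2l ?ltW//; lra.
apply: ler_sum => b _; rewrite -lerBlDl.
have Cb0 : 0 <= Cb b by have [] := CbP b.
rewrite mulr_sumr -sumrB.
apply: (@le_trans _ _ (\sum_(1 <= n < N.+1) (dirac_unit b n%:R * vonM2 n - chi0 b * (2 / phiM) * ln n%:R)
       * `|psig (shift b g) (N %/ n)|)).
  apply: ler_sum_nat => n /andP[n0 _]; rewrite mulrBl lerD2l lerN2 [leRHS]mulrA ler_wpM2r//.
  rewrite ler_wpM2r ?ln_ge0 ?ler1n//.
  by rewrite ler_piMl ?divr_ge0 ?(ltW phi0)// /chi0; case: (_ \is a _); rewrite ?lexx ?ler01.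
apply: le_trans (ler_norm _) _.
pose D n : R := \sum_(1 <= k < n.+1) (dirac_unit b k%:R * vonM2 k - chi0 b * (2 / phiM) * ln k%:R).
have Db n : (0 < n)%N -> `|D n| <= (Cb b + 2 / phiM) * n%:R.
  move=> n0; have := (CbP b).2 n n0.
  have c01 : 0 <= chi0 b * (2 / phiM) <= 2 / phiM.
    have p2 : 0 <= 2 / phiM :> R by rewrite divr_ge0// ltW.
    by rewrite /chi0; case: (_ \is a _); rewrite ?mul1r ?mul0r ?lexx p2.
  have -> : D n = (\sum_(1 <= k < n.+1) dirac_unit b k%:R * vonM2 k
       - chi0 b * (2 / phiM) * n%:R * ln n%:R) + chi0 b * (2 / phiM) * (n%:R * ln n%:R - lnfact n).
    by rewrite /D sumrB -mulr_sumr -/(lnfact n); ring.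
  move=> h; apply: le_trans (ler_normD _ _) _; rewrite [leRHS]mulrDl lerD//.
  have /andP[c0 c1] := c01; rewrite normrM (ger0_norm c0).
  have /andP[f1 _] := @lnfact_bounds R n n0; have f2 := lnfact_le n0.
  apply: ler_pM => //; rewrite ger0_norm; lra.
rewrite abel_sum// -/(D N) divnn N0.
have -> : psig (shift b g) 1 = 0 by rewrite /psig big_nat1 vonM1 mulr0.
rewrite normr0 mulr0 sub0r normrN.
apply: le_trans (ler_norm_sum _ _ _) _.
apply: (@le_trans _ _ (\sum_(1 <= n < N) (Cb b + 2 / phiM) * G * (n%:R * (psi (N %/ n) - psi (N %/ n.+1))))).
  apply: ler_sum_nat => n /andP[n0 nN]; rewrite normrM.
  have h2 : `| `|psig (shift b g) (N %/ n.+1)| - `|psig (shift b g) (N %/ n)| | <=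
       G * (psi (N %/ n) - psi (N %/ n.+1)).
    apply: le_trans (ler_dist_dist _ _) _; rewrite distrC.
    have le1 : (N %/ n.+1 <= N %/ n)%N by rewrite leq_div2l.
    apply: le_trans (psig_dist _ le1) _; rewrite ler_wpM2r ?norm1_shift//.
      by rewrite subr_ge0 psi_mono.
    exact: gm.1.
  apply: le_trans (ler_pM (normr_ge0 _) (normr_ge0 _) (Db _ n0) h2) _.
  by rewrite le_eqVlt; apply/orP; left; apply/eqP; ring.
rewrite -mulr_sumr [G * _]mulrC -!mulrA ler_wpM2l ?addr_ge0 ?divr_ge0 ?(ltW phi0)//.
rewrite ler_wpM2l//; apply: le_trans (lnfact_le N0).
rewrite -sum_psi_div.
have tel (j : nat) (u : nat -> R) : \sum_(1 <= n < j.+1) n%:R * (u n - u n.+1) =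
    \sum_(1 <= n < j.+1) u n - j%:R * u j.+1.
  elim: j => [|j IH]; first by rewrite !big_geq// mul0r subr0.
  by rewrite big_nat_recr//= IH [in RHS]big_nat_recr//= -(natr1 j); ring.
case: N N0 {N0' l0} => // N _; rewrite (tel N (fun n => psi (N.+1 %/ n))).
rewrite [leRHS]big_nat_recr//= lerD2l.
apply: (@le_trans _ _ 0); first by rewrite oppr_le0 mulr_ge0 ?psi_ge0.
exact: psi_ge0.
Qed.

End SelbergInequality.

(** * Equidistribution of prime powers in residue classes *)

Section SmallIntervals.
Context {R : realType} (q : nat).
Local Notation M := q.+2.
Local Notation Z := 'Z_M.
Implicit Types (f g h : Z -> R) (a b c x y : Z) (n k d N K : nat).

Lemma ln_le_eps (e : R) : 0 < e -> exists N0, forall n, (N0 <= n)%N -> ln n%:R <= e * n%:R.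
Proof.
move=> e0; exists (Num.truncn (4 / e ^+ 2)).+1 => n nN.
have n0 : 0 < n%:R :> R by rewrite ltr0n; lia.
set s := Num.sqrt (n%:R : R); have s0 : 0 < s by rewrite sqrtr_gt0.
have sE : s ^+ 2 = n%:R by rewrite sqr_sqrtr// ltW.
have h : 4 / e ^+ 2 <= s ^+ 2.
  by rewrite sE; apply: le_trans (ltW (truncnS_gt _)) _; rewrite ler_nat.
have es : 2 <= e * s.
  rewrite -(@ler_pXn2r _ 2)// ?nnegrE ?mulr_ge0 ?(ltW e0) ?(ltW s0)//.
  by rewrite exprMn mulrC -ler_pdivrMr ?exprn_gt0//; move: h; rewrite (_ : 2 ^+ 2 = 4)//; ring.
rewrite -sE lnXn// -mulr_natl; apply: (@le_trans _ _ (2 * s)).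
  by rewrite ler_pM2l//; have := ln_le_subr1 s0; lra.
by rewrite expr2 mulrA ler_pM2r.
Qed.

Lemma ln_ge_large (C : R) : exists N0, forall n, (N0 <= n)%N -> C <= ln n%:R.
Proof.
exists (Num.truncn (expR C)).+1 => n nN; have n0 : 0 < n%:R :> R by rewrite ltr0n; lia.
rewrite -[leLHS]expRK ler_ln ?posrE ?expR_gt0//.
by apply: le_trans (ltW (truncnS_gt _)) _; rewrite ler_nat.
Qed.

Lemma vonM_le_ln n : (0 < n)%N -> vonM n <= ln n%:R :> R.
Proof.
move=> n0; rewrite -sum_vonM// (bigD1_seq n) ?divisors_uniq ?divisors_id//= lerDl.
by apply: sumr_ge0 => d _; exact: vonM_ge0.
Qed.

(** [selberg_full] at t minus the same at K; the sum of vonM k * psi (N / k) grows with N and is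
    dropped. In 394, 130 + 2 * 130 are the two error terms and 4 comes from t * (ln t - ln K) <= 2
    K. *)
Lemma psi_short K t : (1 < K)%N -> (K <= t <= 2 * K)%N ->
  (psi t - psi K) * ln K%:R <= 2 * (t%:R - K%:R) * ln K%:R + 394 * K%:R :> R.
Proof.
move=> K1 /andP[Kt t2]; have K0' : 0 < K%:R :> R by rewrite ltr0n; lia.
have K0 : (0 < K)%N by lia.
have t0 : (0 < t)%N by lia.
have lK : 0 <= ln K%:R :> R by rewrite ln_ge0// ler1n.
have Kt' : K%:R <= t%:R :> R by rewrite ler_nat.
have t2' : t%:R <= 2 * K%:R :> R by rewrite -natrM ler_nat.
have := @selberg_full R _ K0; have := @selberg_full R _ t0.
rewrite !ler_norml => /andP[_ ht] /andP[hK _].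
have S : \sum_(1 <= k < K.+1) vonM k * psi (K %/ k) <= \sum_(1 <= k < t.+1) vonM k * psi (t %/ k) :> R.
  rewrite [leRHS](big_cat_nat _ (n := K.+1))//= -[leLHS]addr0 lerD//.
    by apply: ler_sum => k _; rewrite ler_wpM2l ?vonM_ge0// psi_mono// leq_div2r.
  by apply: sumr_ge0 => k _; rewrite mulr_ge0 ?vonM_ge0 ?psi_ge0.
have lt : ln K%:R <= ln t%:R :> R by rewrite ler_ln ?posrE ?ltr0n.
have d1 : t%:R * (ln t%:R - ln K%:R) <= 2 * K%:R :> R.
  have t0' : 0 < t%:R :> R by rewrite ltr0n.
  have : ln t%:R - ln K%:R <= t%:R / K%:R - 1 :> R.
    by rewrite -ln_div ?posrE//; apply: ln_le_subr1; rewrite divr_gt0.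
  have : t%:R / K%:R - 1 <= 1 :> R by rewrite lerBlDr ler_pdivrMr//; lra.
  by nra.
have p0 := @psi_ge0 R t.
have : (psi t - psi K) * ln K%:R <= psi t * ln t%:R - psi K * ln K%:R :> R by nra.
move: S ht hK d1; move: (\sum_(_ <= _ < _) _) (\sum_(_ <= _ < _) _) => S1 S2 *; nra.
Qed.

(** Partial summation of [dirichlet_bounded]: the discrete form of a bound for the integral of psig
    h t / t ^ 2. *)
Lemma sum_psig_bounded h : mean0 h -> exists B : R, forall K N, (0 < K <= N)%N ->
  `|\sum_(K <= n < N) psig h n * (n%:R^-1 - n.+1%:R^-1)| <= B.
Proof.
move=> hm; have [C hC] := dirichlet_bounded hm.
have B0 N : (0 < N)%N ->
  `|\sum_(1 <= n < N) psig h n * (n%:R^-1 - n.+1%:R^-1)| <= C + 8 * norm1 h.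
  move=> N0; have -> : \sum_(1 <= n < N) psig h n * (n%:R^-1 - n.+1%:R^-1) =
     vsum h N - psig h N * N%:R^-1.
    rewrite /vsum (abel_sum (fun n => h n%:R * vonM n) (fun n => n%:R^-1))// -/(psig h N).
    rewrite addrAC subrr add0r -sumrN; apply: eq_bigr => n _.
    by rewrite -mulrN opprB.
  apply: le_trans (ler_normB _ _) _; rewrite lerD ?hC//.
  have N0' : 0 < N%:R :> R by rewrite ltr0n.
  have nv : `|N%:R^-1| = N%:R^-1 :> R by rewrite ger0_norm// invr_ge0 ltW.
  rewrite normrM nv ler_pdivrMr//.
  by have := @psig_shift_le R q h 1 N hm.1; rewrite shift1.
exists (2 * (C + 8 * norm1 h)) => K N /andP[K0 KN].
have -> : \sum_(K <= n < N) psig h n * (n%:R^-1 - n.+1%:R^-1) =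
   \sum_(1 <= n < N) psig h n * (n%:R^-1 - n.+1%:R^-1) -
   \sum_(1 <= n < K) psig h n * (n%:R^-1 - n.+1%:R^-1).
  by rewrite [X in _ = X - _](big_cat_nat _ (n := K))//= [_ + _ - _]addrC addKr.
apply: le_trans (ler_normB _ _) _.
by rewrite mulr2n mulrDl mul1r lerD// B0//; lia.
Qed.

(** Otherwise psig h n keeps one sign on the whole interval, since a jump is at most norm1 h * ln n,
    too short to cross from - e n to e n. The sum of [sum_psig_bounded] would then exceed e times a
    harmonic sum, hence [B]. *)
Lemma psig_sign_change h (e : R) : mean0 h -> 0 < e ->
  exists lam K1, [/\ (1 < lam)%N, (0 < K1)%N & forall K, (K1 <= K)%N ->
    exists2 K', (K <= K' <= lam * K)%N & `|psig h K'| <= e * K'%:R].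
Proof.
move=> hm e0; have [B hB] := sum_psig_bounded hm.
set G := norm1 h; have G0 : 0 <= G := norm1_ge0 h.
have G10 : 0 < G + 1 by lra.
have [N0 hN0] := ln_le_eps (divr_gt0 e0 G10).
(* The second factor, [T] below, makes e * ln T exceed [B]; the 2 ensures (2 T K + 1) / (K + 1) >=
   T. *)
exists (2 * (Num.truncn (expR (B / e))).+1)%N, N0.+1; split => // [|K KN]; first by lia.
set T := (Num.truncn (expR (B / e))).+1.
have K0 : (0 < K)%N by lia.
apply: contrapT => nex.
have big n : (K <= n <= 2 * T * K)%N -> e * n%:R < `|psig h n|.
  move=> nK; rewrite ltNge; apply/negP => le; apply: nex.
  by exists n.
have [s [s1 sE]] : exists s : R, (s = 1 \/ s = -1) /\ 0 < s * psig h K.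
  have := big K; rewrite leqnn leq_pmull// => /(_ isT) bK.
  have eK : 0 <= e * K%:R by rewrite mulr_ge0// ltW.
  case: (ltrgt0P (psig h K)) bK => [p0 _|p0 _|->]; last by lra.
    by exists 1; split; [left|lra].
  by exists (-1); split; [right|lra].
have sgn n : (K <= n <= 2 * T * K)%N -> e * n%:R < s * psig h n.
  have cases m : (K <= m <= 2 * T * K)%N -> e * m%:R < s * psig h m \/ s * psig h m < - (e * m%:R).
    move=> /big; rewrite ltr_normr => /orP[] bm; case: s1 => ->; rewrite ?mul1r ?mulN1r.
    - by left.
    - by right; lra.
    - by right; lra.
    - by left.
  elim: n => [|n IH] nK; first by lia.
  have [//|bad] := cases _ nK.
  have [nE|nE] := eqVneq n.+1 K.
    have en : 0 <= e * n.+1%:R by rewrite mulr_ge0// ltW.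
    by move: bad sE; rewrite nE; rewrite -nE; lra.
  have {}IH := IH (ltac:(lia)).
  have n0 : (0 < n)%N by lia.
  have := @psig_dist R q h n n.+1 (leqnSn n).
  rewrite psiS [_ + _ - _]addrC addKr -/G => dst.
  have v := @vonM_le_ln n.+1 isT; have v0 := @vonM_ge0 R n.+1.
  have l1 := hN0 n.+1 (leq_trans (ltnW KN) (proj1 (andP nK))).
  have l2 : G * vonM n.+1 <= e * n.+1%:R.
    apply: (@le_trans _ _ ((G + 1) * ln n.+1%:R)); first by nra.
    apply: le_trans (ler_wpM2l (ltW G10) l1) _.
    by rewrite mulrA [(G + 1) * _]mulrC divfK// gt_eqF.
  have en : 0 < e * n%:R by rewrite mulr_gt0// ltr0n.
  have en1 : e * n%:R <= e * n.+1%:R by rewrite ler_wpM2l ?(ltW e0)// ler_nat.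
  move: dst; rewrite ler_norml => /andP[d1 d2].
  move: bad IH; case: s1 => ->; rewrite ?mul1r ?mulN1r => bad IH.
    lra.
  lra.
have Tgt : B / e < ln T%:R.
  by rewrite -[ltLHS]expRK ltr_ln ?posrE ?expR_gt0 ?ltr0n// truncnS_gt.
have := hB K (2 * T * K)%N; rewrite K0 leq_pmull// => /(_ isT); apply/negP; rewrite -ltNge.
apply: (@lt_le_trans _ _ (s * \sum_(K <= n < 2 * T * K) psig h n * (n%:R^-1 - n.+1%:R^-1))); last first.
  apply: le_trans (ler_norm _) _; rewrite normrM.
  by case: s1 => ->; rewrite ?normrN normr1 mul1r.
apply: (@lt_le_trans _ _ (e * \sum_(K <= n < 2 * T * K) (n.+1%:R : R)^-1)).
  apply: (@lt_le_trans _ _ (e * ln T%:R)); first by rewrite mulrC -ltr_pdivrMr.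
  rewrite ler_wpM2l ?(ltW e0)//.
  apply: (@le_trans _ _ (\sum_(K <= n < 2 * T * K) (ln n.+2%:R - ln n.+1%:R))).
    rewrite telescope_sumr /=; last by rewrite leq_pmull.
    rewrite -ln_div ?posrE ?ltr0n// ler_ln ?posrE ?divr_gt0 ?ltr0n//.
    rewrite ler_pdivlMr ?ltr0n// -natrM ler_nat; nia.
  by apply: ler_sum_nat => n nK; have [_] := @ln_succ_bounds R n.+1 isT.
rewrite !mulr_sumr; apply: ler_sum_nat => n /andP[n1 n2].
have n0 : 0 < n%:R :> R by rewrite ltr0n; lia.
have := sgn n; rewrite n1 (ltnW n2) => /(_ isT) hn.
rewrite [X in e * X <= _](_ : _ = n%:R * (n%:R^-1 - n.+1%:R^-1)); last first.
  by rewrite -natr1; field; rewrite !gt_eqF//; lra.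
rewrite !mulrA ler_wpM2r ?(ltW hn)// subr_ge0 lef_pV2 ?posrE ?ltr0n ?ler_nat//; lia.
Qed.

(** Beyond a point K' with |psig h K'| <= e K' / 2, [psi_short] limits the drift up to K' + K' / s
    to G times 2 K' / s + 394 K' / ln K'. Taking s > 8 G / e and ln K' >= 1576 (G + 1) / e, where
    1576 = 4 * 394, makes each part at most e K' / 4. *)
Lemma psig_small_interval h (e : R) : mean0 h -> 0 < e ->
  exists lam s K1, [/\ (1 < lam)%N, (0 < s)%N, (0 < K1)%N & forall K, (K1 <= K)%N ->
    exists2 K', (K <= K' <= lam * K)%N &
      forall t, (K' <= t <= K' + K' %/ s)%N -> `|psig h t| <= e * t%:R].
Proof.
move=> hm e0; have e20 : 0 < e / 2 by lra.
have [lam [K1 [lam1 K10 hK]]] := psig_sign_change hm e20.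
set G := norm1 h; have G0 : 0 <= G := norm1_ge0 h.
pose s := (Num.truncn (8 * G / e)).+1.
have [K2 hK2] := ln_ge_large (1576 * (G + 1) / e).
exists lam, s, (K1 + K2 + 2)%N; split => // [|K KK]; first by lia.
have [K' KK' hK'] := hK K (ltac:(lia)).
exists K' => // t /andP[t1 t2].
have K'0 : 0 < K'%:R :> R by rewrite ltr0n; lia.
have s0 : 0 < s%:R :> R by rewrite ltr0n.
have ts : t%:R - K'%:R <= K'%:R / s%:R :> R.
  apply: le_trans (divn_le_ratio _ (isT : 0 < s)%N).
  by rewrite lerBlDr -natrD ler_nat addnC.
have K's : (K' %/ s <= K')%N by exact: leq_div.
have [K'1 K'2 t3] : [/\ (1 < K')%N, (K2 <= K')%N & (K' <= t <= 2 * K')%N].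
  by move: KK KK' t1 t2 K's; move: (K' %/ s)%N; clear; move=> *; split; lia.
have := psi_short K'1 t3; have lK := hK2 K' K'2.
have c0 : 0 < 1576 * (G + 1) / e.
  by apply: divr_gt0 e0; clear -G0; lra.
have l0 : 0 < ln K'%:R :> R by exact: lt_le_trans lK.
have s1 : 8 * G / e < s%:R by exact: truncnS_gt.
have := @psig_dist R q h K' t t1; rewrite -/G.
set P := psi t - psi K'; have P0 : 0 <= P by rewrite subr_ge0 psi_mono.
move=> dst hP.
have hP2 : G * P <= e / 2 * K'%:R.
  have a1 : G * (K'%:R / s%:R) * 8 <= e * K'%:R.
    move: s1; rewrite ltr_pdivrMr// [s%:R * e]mulrC => /ltW h1.    rewrite (_ : _ * 8 = 8 * G * K'%:R / s%:R); last by ring.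
    by rewrite ler_pdivrMr// [leRHS]mulrAC ler_wpM2r// ltW.
  have a2 : 1576 * G * K'%:R <= e * K'%:R * ln K'%:R.
    move: lK; rewrite ler_pdivrMr// => lK; rewrite [leRHS]mulrAC ler_wpM2r ?(ltW K'0)//.
    by rewrite [leRHS]mulrC; apply: le_trans lK; clear -G0; lra.
  rewrite -(ler_pM2r l0).
  have a3 : 2 * (t%:R - K'%:R) * ln K'%:R <= 2 * (K'%:R / s%:R) * ln K'%:R :> R.
    by rewrite ler_wpM2r ?(ltW l0)// ler_wpM2l.
  have a4 : G * (P * ln K'%:R) <= G * (2 * (K'%:R / s%:R) * ln K'%:R + 394 * K'%:R).
    by rewrite ler_wpM2l//; move: hP a3; clear => *; lra.
  have a5 : G * (K'%:R / s%:R) * 8 * ln K'%:R <= e * K'%:R * ln K'%:R.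
    by rewrite ler_wpM2r// ltW.
  by move: a2 a4 a5; clear => *; lra.
have tK : K'%:R <= t%:R :> R by rewrite ler_nat.
have : `|psig h t| <= `|psig h K'| + G * P.
  rewrite -[X in `|X|](subrK (psig h K')); apply: le_trans (ler_normD _ _) _.
  by rewrite addrC lerD.
by move: hP2 tK hK' e0; clear => *; nra.
Qed.

(** The n in question fill the interval from N / K2.+1 to N / K; after rounding there are at least N
    / (2 K (s + 1)) of them, as N / K >= 2 (s + 1). On them 9 K ^ 2 <= N gives n ^ 2 >= N, so ln n
    >= ln N / 2, and 1 / n >= K / N. *)
Lemma block_weight s K N : (0 < s)%N -> (0 < K)%N -> (9 * K ^ 2 <= N)%N ->
  (2 * s.+1 * K <= N)%N ->
  ln N%:R / (4 * s.+1%:R) <=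
  \sum_(1 <= n < N.+1) (K <= N %/ n <= K + K %/ s)%N%:R * (ln n%:R / n%:R) :> R.
Proof.
move=> s0 K0 N9 N2; set K2 := (K + K %/ s)%N.
pose A := (N %/ K2.+1)%N; pose B := (N %/ K)%N.
have N0 : (0 < N)%N by lia.
have K2K : (K2.+1 <= 3 * K)%N by rewrite /K2; have := leq_div K s; lia.
have AB : (A <= B)%N by rewrite leq_div2l// leqW// leq_addr.
have BN : (B <= N)%N by exact: leq_div.
have N0' : 0 < N%:R :> R by rewrite ltr0n.
have K0' : 0 < K%:R :> R by rewrite ltr0n.
have s0' : 0 < s%:R :> R by rewrite ltr0n.
have lN : 0 <= ln N%:R :> R by rewrite ln_ge0// ler1n.
have w0 n : 0 <= (K <= N %/ n <= K2)%N%:R * (ln n%:R / n%:R) :> R.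
  case: n => [|n]; first by rewrite invr0 !mulr0.
  by rewrite mulr_ge0// divr_ge0// ln_ge0// ler1n.
rewrite (big_cat_nat _ (n := A.+1))//=; last by lia.
rewrite [X in _ <= _ + X](big_cat_nat _ (n := B.+1))//=.
rewrite -[leLHS]add0r lerD ?sumr_ge0// -[leLHS]addr0 lerD ?sumr_ge0//.
apply: (@le_trans _ _ (\sum_(A.+1 <= n < B.+1) ln N%:R / 2 * (K%:R / N%:R))); last first.
  apply: ler_sum_nat => n /andP[An nB].
  have n0 : (0 < n)%N by lia.
  have n0' : 0 < n%:R :> R by rewrite ltr0n.
  have nK : (n * K <= N)%N by rewrite -leq_divRL.
  have nK2 : (N < n * K2.+1)%N by rewrite -ltn_divLR.
  have -> : (K <= N %/ n <= K2)%N.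
    rewrite leq_divRL// mulnC nK /= -ltnS ltn_divLR// mulnC//.
  rewrite mul1r; apply: ler_pM.
  - by rewrite divr_ge0.
  - by rewrite divr_ge0// ltW.
  - rewrite ler_pdivrMr// mulr_natr -lnXn// ler_ln ?posrE ?exprn_gt0// -natrX ler_nat.
    have : (N < n * (3 * K))%N by apply: leq_trans nK2 _; rewrite leq_mul2l K2K orbT.
    rewrite -(@ltn_exp2r _ _ 2)// => h1.
    have h2 : ((n * (3 * K)) ^ 2 = 9 * K ^ 2 * n ^ 2)%N by clear; lia.
    rewrite ltnW// -(@ltn_pmul2l N)// mulnn.
    by apply: leq_trans h1 _; rewrite h2 leq_mul2r N9 orbT.
  - by rewrite ler_pdivrMr// [leRHS]mulrC ler_pdivlMr// -natrM ler_nat mulnC.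
rewrite sumr_const_nat subSS -[leRHS]mulr_natl natrB//.
have b1 : N%:R / K%:R < B%:R + 1 :> R by exact: ratio_lt_divn.
have a1 : A%:R <= N%:R / K2.+1%:R :> R by exact: divn_le_ratio.
set y : R := N%:R / K%:R in b1.
have a2 : A%:R * s.+1%:R <= y * s%:R.
  have k2 : K%:R * s.+1%:R <= K2.+1%:R * s%:R :> R.
    by rewrite -!natrM ler_nat /K2; have := ltn_ceil K s0; nia.
  rewrite /y [leRHS]mulrAC ler_pdivlMr// -mulrA.
  apply: le_trans (ler_wpM2l (ler0n _ _) _) _; first by rewrite mulrC; exact: k2.
  by rewrite mulrA ler_wpM2r ?(ltW s0')// -natrM ler_nat leq_divM.
have y2 : 2 * s.+1%:R <= y.
  by rewrite /y ler_pdivlMr// -!natrM ler_nat.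
have KN : K%:R / N%:R = y^-1 by rewrite invf_div.
rewrite KN; have y0 : 0 < y by rewrite divr_gt0.
have sS : s.+1%:R = s%:R + 1 :> R by rewrite -natr1.
have main : y <= (B%:R - A%:R) * (2 * s.+1%:R).
  by move: a2 b1 y2; rewrite sS; nra.
rewrite mulrCA mulrAC -mulrA ler_pdivrMr; last by rewrite mulr_gt0.
rewrite [leRHS](_ : _ = ln N%:R * ((B%:R - A%:R) * (2 * s.+1%:R) / y)); last first.
  by field; rewrite gt_eqF.
by rewrite ler_peMr// ler_pdivlMr// mul1r.
Qed.

End SmallIntervals.

(** * The contraction argument *)

Section Contraction.
Context {R : realType} (q : nat).
Local Notation M := q.+2.
Local Notation Z := 'Z_M.
Implicit Types (f g h : Z -> R) (a b c x y : Z) (n k d N K j : nat).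

Lemma disjoint_blocks (u : nat -> nat) t J : {homo u : i j / (i <= j)%N} ->
  \sum_(0 <= j < J) (u j <= t < u j.+1)%N%:R <= 1 :> R.
Proof.
move=> um; suff : \sum_(0 <= j < J) (u j <= t < u j.+1)%N%:R <= (t < u J)%N%:R :> R.
  by move=> h; apply: le_trans h _; case: (_ < _)%N; rewrite ?lexx ?ler01.
elim: J => [|J IH]; first by rewrite big_geq.
rewrite big_nat_recr//=; have uu : (u J <= u J.+1)%N by apply: um.
have [h|h] := ltnP t (u J).
  by rewrite (leq_trans h uu) /= addr0; move: IH; rewrite h.
by move: IH; rewrite ltnNge h /=; case: (_ < _)%N; lra.
Qed.

(** Each of the disjoint blocks from u j to u j.+1 contains an interval of [psig_small_interval]; of
    order ln N blocks contribute of order ln N each. *)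
Lemma small_values_weight h (e : R) : mean0 h -> 0 < e ->
  exists2 c : R, 0 < c & exists N1, forall N, (N1 <= N)%N ->
    c * ln N%:R ^+ 2 <= \sum_(1 <= n < N.+1)
      (`|psig h (N %/ n)| <= e * (N %/ n)%:R)%R%:R * (ln n%:R / n%:R).
Proof.
move=> hm e0; have [lam [s [K1 [lam1 s0 K10 hK]]]] := psig_small_interval hm e0.
(* A ratio for which K' + K' / s <= 2 lam * u j stays below u j.+1. *)
pose L := (2 * lam).+1; have L1 : (1 < L)%N by rewrite /L; lia.
pose u j := (K1 * L ^ j)%N.
have u0 j : (0 < u j)%N by rewrite /u muln_gt0 K10 expn_gt0; lia.
have uS j : u j.+1 = (L * u j)%N by rewrite /u expnS; lia.
have um : {homo u : i j / (i <= j)%N}.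
  by move=> i j ij; rewrite /u leq_mul2l leq_pexp2l ?orbT//; lia.
have K1u j : (K1 <= u j)%N by have := um 0%N j isT; rewrite {1}/u expn0 muln1.
have hKu j := hK (u j) (K1u j).
(* [D] absorbs the constants of [block_weight]; together with the base L ^ 2 in [J] it makes its
   hypotheses hold at u j.+1 for j < J. *)
pose D := (9 * K1 ^ 2 * (2 * s.+1))%N.
have D0 : (0 < D)%N by rewrite /D !muln_gt0 K10.
have lL : 0 < ln L%:R :> R by rewrite ln_gt0// ltr1n.
have s0' : 0 < s.+1%:R :> R by rewrite ltr0n.
exists ((16 * s.+1%:R * ln L%:R)^-1); first by rewrite invr_gt0 !mulr_gt0.
have [N1 hN1] := @ln_ge_large R (2 * ln D%:R + 4 * ln L%:R).
exists (N1 + D)%N => N NN; have N0 : (0 < N)%N by lia.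
have lN := hN1 N (leq_trans (leq_addr _ _) NN).
have lN0 : 0 <= ln N%:R :> R by rewrite ln_ge0// ler1n.
pose J := trunc_log (L ^ 2) (N %/ D).
have L21 : (1 < L ^ 2)%N by rewrite -(exp1n 2) ltn_exp2r.
have ND : (0 < N %/ D)%N by rewrite divn_gt0// (leq_trans (leq_addl _ _) NN).
have /andP[J1 J2] := trunc_log_bounds L21 ND; rewrite -/J in J1 J2.
have Jge : ln N%:R / (4 * ln L%:R) <= J%:R :> R.
  have h1 : (N < D * L ^ (2 * J.+1))%N.
    by rewrite mulnC -ltn_divLR// expnM.
  have h2 : ln N%:R <= ln D%:R + (2 * J.+1)%:R * ln L%:R :> R.
    have L0 : 0 < L%:R :> R by rewrite ltr0n.
    rewrite mulr_natl -lnXn// -lnM ?posrE ?exprn_gt0 ?ltr0n//.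
    rewrite ler_ln ?posrE ?mulr_gt0 ?exprn_gt0 ?ltr0n// -natrX -natrM ler_nat.
    exact: ltnW.
  rewrite ler_pdivrMr ?mulr_gt0//; move: h2; rewrite natrM -natr1.
  move: lN lL lN0; clear => *; nra.
have uJ j : (j < J)%N -> (9 * u j.+1 ^ 2 <= N)%N /\ (2 * s.+1 * u j.+1 <= N)%N.
  move=> jJ; have DN : (D * (L ^ 2) ^ J <= N)%N by rewrite mulnC -leq_divRL.
  have e1 : (u j.+1 ^ 2 <= K1 ^ 2 * (L ^ 2) ^ J)%N.
    rewrite /u expnMn leq_mul2l -!expnM [(2 * J)%N]mulnC leq_pexp2l ?orbT//; lia.
  have u1 := u0 j.+1; move: DN e1; rewrite /D; move: (_ ^ J)%N (K1 ^ 2)%N (u j.+1) u1.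
  by clear => X Y v v0 h1 h2; split; nia.
pose F n : R := ln n%:R / n%:R.
have F0 n : 0 <= F n.
  by case: n => [|n]; rewrite /F ?invr0 ?mulr0// divr_ge0// ln_ge0// ler1n.
pose good t := `|psig h t| <= e * t%:R.
apply: (@le_trans _ _ (\sum_(1 <= n < N.+1) \sum_(0 <= j < J)
   (good (N %/ n)%N)%:R * (u j <= N %/ n < u j.+1)%N%:R * F n)); last first.
  apply: ler_sum => n _; rewrite -mulr_suml.
  rewrite ler_wpM2r//.
  by rewrite -mulr_sumr -[leRHS]mulr1 ler_wpM2l// disjoint_blocks.
rewrite exchange_big /=.
apply: (@le_trans _ _ (\sum_(0 <= j < J) ln N%:R / (4 * s.+1%:R))).
  rewrite sumr_const_nat subn0 -[leRHS]mulr_natl.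
  apply: (@le_trans _ _ (ln N%:R / (4 * ln L%:R) * (ln N%:R / (4 * s.+1%:R)))).
    rewrite le_eqVlt; apply/orP; left; apply/eqP; field.
    by rewrite !gt_eqF.
  by rewrite ler_wpM2r// divr_ge0// mulr_ge0// ltW.
apply: ler_sum_nat => j /andP[_ jJ]; have [uJ1 uJ2] := uJ _ jJ.
have [K' /andP[K'1 K'2] K'P] := hKu j.
have K'u : (K' + K' %/ s < u j.+1)%N.
  have := leq_div K' s; have := u0 j; rewrite uS /L.
  by move: (K' %/ s)%N (u j) K'2; clear => *; nia.
have K'0 : (0 < K')%N by apply: leq_trans K'1.
have K'le : (K' <= u j.+1)%N by apply: leq_trans (ltnW K'u); exact: leq_addr.
have w1 : (9 * K' ^ 2 <= N)%N.
  by apply: leq_trans uJ1; rewrite leq_mul2l leq_exp2r// K'le.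
have w2 : (2 * s.+1 * K' <= N)%N by apply: leq_trans uJ2; rewrite leq_mul2l K'le orbT.
apply: le_trans (block_weight s0 K'0 w1 w2) _.
apply: ler_sum => n _; rewrite ler_wpM2r ?F0//.
case tK : (K' <= N %/ n <= K' + K' %/ s)%N; last by rewrite mulr_ge0.
have /andP[t1 t2] := tK; rewrite /good K'P//.
by rewrite (leq_trans K'1 t1) (leq_ltn_trans t2 K'u) mul1r.
Qed.

(** The leading constant 1/2 has to be exact: against the 2 of [selberg_log_weights] it returns
    precisely al. The extra - 1 / N in the proof is what makes the induction close. *)
Lemma sum_ln_div N : (0 < N)%N ->
  \sum_(1 <= n < N.+1) ln n%:R / n%:R <= ln N%:R ^+ 2 / 2 + 1 :> R.
Proof.
move=> N0; suff : \sum_(1 <= n < N.+1) ln n%:R / n%:R <= ln N%:R ^+ 2 / 2 + 1 - N%:R^-1 :> R.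
  by move=> h; apply: le_trans h _; rewrite gerBl invr_ge0.
elim: N N0 => // -[_ _|N IH _]; first by rewrite big_nat1 ln1; lra.
rewrite big_nat_recr//=; have {IH} := IH isT; have [l1 l2] := @ln_succ_bounds R N.+1 isT.
set s := \sum_(_ <= _ < _) _ => h.
set x : R := N.+1%:R in h l1 l2 *; have x0 : 1 <= x by rewrite ler1n.
have xE : N.+2%:R = x + 1 :> R by rewrite -natr1.
rewrite xE in l1 l2 *.
set u := (x + 1)^-1 in l1 *; have uE : u * (x + 1) = 1 by rewrite mulVf// gt_eqF//; lra.
set v := x^-1 in l2 h *; have vE : v * x = 1 by rewrite mulVf// gt_eqF//; lra.
have u0 : 0 < u by rewrite invr_gt0; lra.
have v0 : 0 < v by rewrite invr_gt0; lra.
have uv : u * v = v - u.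
  have : (u * v - (v - u)) * (x * (x + 1)) = 0.
    rewrite (_ : _ * _ = (u * (x + 1)) * (v * x) - (v * x) * (x + 1) + (u * (x + 1)) * x); last by ring.
    by rewrite uE vE; ring.
  by move=> /eqP; rewrite mulf_eq0 subr_eq0 => /orP[/eqP//|/eqP]; nra.
have la : 0 <= ln x by rewrite ln_ge0.
move: h l1 l2 la; move: (ln x) (ln (x + 1)) => A B h l1 l2 A0.
have k1 : (B - A) * (B + A) >= u * (B + A) by rewrite ler_wpM2r//; lra.
have k2 : u * (B - A) <= u * v by rewrite ler_pM2l.
by rewrite expr2 in h *; nra.
Qed.

Lemma finite_pos_lower (I : finType) (P : I -> R -> Prop) :
  (forall i (d d' : R), 0 < d' <= d -> P i d -> P i d') ->
  (forall i, exists2 d : R, 0 < d & P i d) -> exists2 d, 0 < d & forall i, P i d.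
Proof.
move=> Pm Pex.
suff [d d0 dP] : exists2 d : R, 0 < d & forall i, i \in enum I -> P i d.
  by exists d => // i; apply: dP; rewrite mem_enum.
elim: (enum I) => [|i s [d d0 IH]]; first by exists 1.
have [d' d'0 hd'] := Pex i; exists (Num.min d d'); first by rewrite lt_min d0.
move=> k; rewrite inE => /orP[/eqP->|ks].
  by apply: Pm hd'; rewrite lt_min d0 d'0 /= ge_min lexx orbT.
by apply: Pm (IH k ks); rewrite lt_min d0 d'0 /= ge_min lexx.
Qed.

Lemma finite_nat_upper (I : finType) (P : I -> nat -> Prop) :
  (forall i n m, (n <= m)%N -> P i n -> P i m) ->
  (forall i, exists n, P i n) -> exists n, forall i, P i n.
Proof.
move=> Pm Pex.
suff [n nP] : exists n, forall i, i \in enum I -> P i n.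
  by exists n => i; apply: nP; rewrite mem_enum.
elim: (enum I) => [|i s [n IH]]; first by exists 0%N.
have [n' hn'] := Pex i; exists (maxn n n') => k; rewrite inE => /orP[/eqP->|ks].
  by apply: Pm hn'; rewrite leq_maxr.
by apply: Pm (IH k ks); rewrite leq_maxl.
Qed.

(** All shifts at once, because [selberg_log_weights] mixes them. *)
Definition eventually_le g (al : R) :=
  exists N0, forall N, (N0 <= N)%N -> forall b, `|psig (shift b g) N| <= al * N%:R.

(** Inserting al for every shift gives back al. For the shift b = 1, however, the n of
    [small_values_weight] have at most be / 2 <= al - be / 2 in place of al. The saving depends on
    be but not on al, which is what allows iteration. *)
Lemma contraction1 g (be : R) c : mean0 g -> 0 < be -> c \is a GRing.unit ->
  exists2 d : R, 0 < d & forall al, be <= al -> eventually_le g al ->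
    exists N0, forall N, (N0 <= N)%N -> `|psig (shift c g) N| <= (al - d) * N%:R.
Proof.
move=> gm be0 cU; have phi0 := @phiM_gt0 R q.
set h := shift c g; have hm : mean0 h by exact: mean0_shift.
have be20 : 0 < be / 2 by lra.
have [w w0 [N1 hw]] := small_values_weight hm be20.
have [C C0 hC] := selberg_log_weights hm.
exists (be * w / (2 * (@phiM R q))); first by rewrite !divr_gt0 ?mulr_gt0.
move=> al beal [K0 hK0]; set G := norm1 g; have G0 : 0 <= G := norm1_ge0 g.
have al0 : 0 < al by exact: lt_le_trans beal.
(* Covers the n with N / n below [K0], about which the hypothesis says nothing. *)
pose E0 := 8 * G * K0%:R; have E00 : 0 <= E0 by rewrite !mulr_ge0.
have bound b K : `|psig (shift b g) K| <= al * K%:R + E0.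
  have [KK|KK] := leqP K0 K; first by apply: le_trans (hK0 _ KK b) _; rewrite lerDl.
  apply: le_trans (psig_shift_le b K gm.1) _; rewrite -[leLHS]add0r lerD//.
    by rewrite mulr_ge0// ltW.
  by rewrite /E0 ler_wpM2l ?mulr_ge0// ler_nat ltnW.
(* The gain is 2 d * N * ln N ^ 2; half of it pays for all terms of lower order once d * ln N >=
   T. *)
pose T := 2 * (al + E0 + C) + 1.
have [N2 hN2] := @ln_ge_large R (2 * (@phiM R q) * T / (be * w) + 1).
exists (N1 + N2 + 1)%N => N NN.
have N0 : (0 < N)%N by apply: leq_trans NN; rewrite addn1.
have N0' : 0 < N%:R :> R by rewrite ltr0n.
have l1 : 2 * (@phiM R q) * T / (be * w) + 1 <= ln N%:R.
  by apply: hN2; apply: leq_trans NN; rewrite -addnA addnCA leq_addr.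
have T0 : 0 < T by rewrite /T; lra.
have bw0 : 0 < be * w by rewrite mulr_gt0.
have pT0 : 0 < 2 * (@phiM R q) * T / (be * w) by rewrite divr_gt0// mulr_gt0// mulr_gt0.
have l0 : 1 < ln N%:R :> R by apply: lt_le_trans l1; rewrite ltrDr.
have ln0 n : 0 <= ln n%:R :> R.
  by case: n => [|n]; [rewrite ln0 | rewrite ln_ge0// ler1n].
pose S1 : R := \sum_(1 <= n < N.+1) ln n%:R / n%:R.
pose S0 : R := \sum_(1 <= n < N.+1) ln n%:R.
have hS1 : S1 <= ln N%:R ^+ 2 / 2 + 1 by exact: sum_ln_div.
have hS0 : S0 <= N%:R * ln N%:R by exact: lnfact_le.
have each b : \sum_(1 <= n < N.+1) ln n%:R * `|psig (shift b h) (N %/ n)| <=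
    al * N%:R * S1 + E0 * S0.
  rewrite /S1 /S0 !mulr_sumr -big_split /=; apply: ler_sum_nat => n /andP[n0 _].
  rewrite /h shift_shift; apply: le_trans (ler_wpM2l (ln0 n) (bound _ _)) _.
  rewrite mulrDr [ln _ * E0]mulrC lerD2r.
  rewrite (_ : al * N%:R * _ = ln n%:R * (al * (N%:R / n%:R))); last by ring.
  by rewrite ler_wpM2l// ler_wpM2l ?(ltW al0)// divn_le_ratio.
have self : \sum_(1 <= n < N.+1) ln n%:R * `|psig (shift 1 h) (N %/ n)| <=
    al * N%:R * S1 + E0 * S0 - be / 2 * N%:R * (w * ln N%:R ^+ 2).
  have := hw N (leq_trans (leq_addr _ _) (leq_trans (leq_addr _ _) NN)).
  set S2 := \sum_(_ <= _ < _) _ => hS2.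
  apply: (@le_trans _ _ (al * N%:R * S1 + E0 * S0 - be / 2 * N%:R * S2)); last first.
    by rewrite lerD2l lerN2 ler_wpM2l// mulr_ge0// ltW.
  rewrite /S1 /S0 /S2 !mulr_sumr -big_split -sumrB /=; apply: ler_sum_nat => n /andP[n0 _].
  rewrite shift1; have n0' : 0 < n%:R :> R by rewrite ltr0n.
  have dl := @divn_le_ratio R n N n0; have K0' : 0 <= (N %/ n)%:R :> R by rewrite ler0n.
  rewrite (_ : al * N%:R * _ + _ - _ = ln n%:R * (al * (N%:R / n%:R) + E0 -
      be / 2 * (`|psig h (N %/ n)| <= be / 2 * (N %/ n)%:R)%R%:R * (N%:R / n%:R))); last by ring.
  rewrite ler_wpM2l//; case: (boolP (_ <= be / 2 * _)) => hh.
    move: hh dl K0' E00 beal be0; rewrite mulr1.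
    by move: (N%:R / n%:R) ((N %/ n)%:R : R) `|psig h _|; clear => *; nra.
  rewrite mulr0 mul0r subr0; apply: le_trans (bound _ _) _; rewrite lerD2r.
  by rewrite ler_wpM2l// ltW.
have := hC N N0; rewrite exchange_big /=.
have total : \sum_b \sum_(1 <= n < N.+1) ln n%:R * `|psig (shift b h) (N %/ n)| <=
   (@phiM R q) * (al * N%:R * S1 + E0 * S0) - be / 2 * N%:R * (w * ln N%:R ^+ 2).
  rewrite {1}/phiM mulr_suml (bigD1 1)//= [X in _ <= X - _](bigD1 1)//= addrAC lerD//.
    by rewrite {1}/chi0 unitr1 mul1r.
  apply: ler_sum => b _; rewrite /chi0; case: (boolP (b \is a _)) => bU; first by rewrite mul1r.
  rewrite mul0r big1// => n _; rewrite (shift_nonunit hm.1 bU) /psig big1 ?normr0 ?mulr0//.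
  by move=> i _; rewrite mul0r.
move=> hfin; rewrite -(@ler_pM2r _ (ln N%:R ^+ 2)); last by rewrite exprn_gt0//; lra.
apply: le_trans hfin _.
apply: le_trans (lerD (ler_wpM2l _ total) (lexx _)) _; first by rewrite divr_ge0// ltW.
set p := (@phiM R q) in phi0 l1 pT0 *.
rewrite (_ : 2 / p * _ = 2 * (al * N%:R * S1 + E0 * S0) - be / p * N%:R * (w * ln N%:R ^+ 2)); last first.
  by field; rewrite gt_eqF.
have l2 : T <= be * w / (2 * p) * ln N%:R.
  have : 2 * p * T / (be * w) <= ln N%:R by lra.
  by rewrite ler_pdivrMr// => h2; rewrite mulrAC ler_pdivlMr ?mulr_gt0//; lra.
set d := be * w / (2 * p) in l2 *.
have dE : be / p * N%:R * (w * ln N%:R ^+ 2) = 2 * d * N%:R * ln N%:R ^+ 2.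
  by rewrite /d; field; rewrite gt_eqF.
rewrite dE; rewrite /T in l2.
have {hS1 hS0 l0 l2 N0' al0 E00} := conj hS1 (conj hS0 (conj l0 (conj l2 (conj N0' (conj al0 E00))))).
clearbody S1 S0 d E0; move: (N%:R : R) (ln N%:R : R) => n l.
move=> [hS1 [hS0 [l0 [l2 [n0 [al0 E00]]]]]].
have e1 : al * n * S1 <= al * n * (l ^+ 2 / 2 + 1) by rewrite ler_wpM2l// mulr_ge0// ltW.
have e2 : E0 * S0 <= E0 * (n * l) by rewrite ler_wpM2l.
have e3 : n * l * (2 * (al + E0 + C) + 1) <= n * l * (d * l).
  by rewrite ler_wpM2l// mulr_ge0//; lra.
have nl : n <= n * l by rewrite ler_peMr; lra.
have e4 : al * n <= al * (n * l) by rewrite ler_wpM2l// ltW.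
have e5 : C * n <= C * (n * l) by rewrite ler_wpM2l.
rewrite expr2 in e1 *; lra.
Qed.

Lemma contraction g (be : R) : mean0 g -> 0 < be ->
  exists2 d : R, 0 < d & forall al, be <= al -> eventually_le g al -> eventually_le g (al - d).
Proof.
move=> gm be0.
pose P (c : Z) (d : R) := forall al, be <= al -> eventually_le g al ->
    exists N0, forall N, (N0 <= N)%N -> `|psig (shift c g) N| <= (al - d) * N%:R.
have [|c|d d0 dP] := @finite_pos_lower _ P.
- move=> c d d' /andP[d'0 dd] Pd al bal ev; have [N0 hN] := Pd al bal ev.
  exists N0 => N NN; apply: le_trans (hN N NN) _; rewrite ler_wpM2r//; lra.
- have [cU|cU] := boolP (c \is a GRing.unit); first exact: contraction1.
  exists be => // al bal _; exists 0%N => N _.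
  rewrite (shift_nonunit gm.1 cU) /psig big1 ?normr0; last by move=> i _; rewrite mul0r.
  by rewrite mulr_ge0// subr_ge0.
exists d => // al bal ev.
have [|c|N0 hN] := @finite_nat_upper Z (fun c N0 => forall N, (N0 <= N)%N ->
   `|psig (shift c g) N| <= (al - d) * N%:R).
- by move=> c n m nm h N mN; apply: h; exact: leq_trans mN.
- exact: dP.
by exists N0 => N NN b; exact: hN.
Qed.

(** From the trivial constant 8 * norm1 g, each contraction lowers al by the same d as long as al >=
    e, so finitely many steps reach e. *)
Lemma psig_littleo g (e : R) : mean0 g -> 0 < e ->
  exists N0, forall N, (N0 <= N)%N -> `|psig g N| <= e * N%:R.
Proof.
move=> gm e0; have [d d0 dP] := contraction gm e0.
have mono al al' : al <= al' -> eventually_le g al -> eventually_le g al'.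
  move=> aa [N0 h]; exists N0 => N NN b; apply: le_trans (h N NN b) _.
  by rewrite ler_wpM2r.
set a0 := 8 * norm1 g.
have ind k : eventually_le g (Num.max e (a0 - k%:R * d)).
  elim: k => [|k IH].
    apply: (@mono a0); first by rewrite mul0r subr0 le_max lexx orbT.
    by exists 0%N => N _ b; exact: psig_shift_le gm.1.
  have := dP _ _ IH; rewrite le_max lexx => /(_ isT); apply: mono.
  rewrite -natr1 mulrDl mul1r opprD addrA.
  by case: (leP e (a0 - k%:R * d)) => h; rewrite le_max; apply/orP; [right | left; lra].
pose k := (Num.truncn (a0 / d)).+1.
have [N0 hN] := ind k; exists N0 => N NN; have := hN N NN 1; rewrite shift1.
rewrite max_l//; have : a0 / d < k%:R by exact: truncnS_gt.
by rewrite ltr_pdivrMr//; lra.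
Qed.

End Contraction.

(** * Equidistribution of primes *)

Section PrimeSums.
Context {R : realType}.
Implicit Types (n k d p N K s : nat).

Lemma nat_sqrt N : exists s, (s ^ 2 <= N < s.+1 ^ 2)%N.
Proof.
elim: N => [|N [s /andP[s1 s2]]]; first by exists 0%N.
have [h|h] := ltnP N.+1 (s.+1 ^ 2); first by exists s; rewrite h andbT ltnW.
by exists s.+1; rewrite h /=; move: s2 h; rewrite !expnS !expn0; lia.
Qed.

(** A proper prime power p ^ k <= N is determined by p <= s and k <= log2 N. *)
Lemma sum_vonM_nonprime s N : (s ^ 2 <= N < s.+1 ^ 2)%N ->
  \sum_(1 <= n < N.+1) (~~ prime n)%:R * vonM n <= (s * (trunc_log 2 N).+1)%:R * ln N%:R :> R.
Proof.
move=> /andP[s1 s2].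
pose P n := ~~ prime n && (size (primes n) == 1%N).
apply: (@le_trans _ _ (\sum_(1 <= n < N.+1) (P n)%:R * ln N%:R)).
  apply: ler_sum_nat => n /andP[n0 nN]; rewrite /P; case: (prime n) => /=; first by rewrite !mul0r.
  rewrite mul1r; case: eqP => [_|/eqP h].
    rewrite mul1r (le_trans (vonM_le_ln n0))// ler_ln ?posrE ?ltr0n//; first by rewrite ler_nat.
    by lia.
  rewrite mul0r /vonM; case: (primes n) h => [//|a [|//]].
  by rewrite eqxx.
rewrite -mulr_suml ler_wpM2r//.
  by case: (N) => [|m]; [rewrite ln0|rewrite ln_ge0// ler1n].
rewrite -natr_sum ler_nat -big_mkcond /= sum1_count -size_filter.
rewrite -[s in leqRHS](size_iota 1) -(size_iota 0 (trunc_log 2 N).+1).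
rewrite -(size_allpairs (fun p k => (p ^ k)%N)); apply: uniq_leq_size.
  by rewrite filter_uniq// iota_uniq.
move=> n; rewrite mem_filter mem_index_iota /P => /andP[/andP[np sz] /andP[n0 nN]].
case E : (primes n) sz => [//|p [|//]] _.
have pn : p \in primes n by rewrite E inE.
have pp : prime p by move: pn; rewrite mem_primes => /andP[].
have nE : n = (p ^ logn p n)%N.
  by rewrite [LHS]prod_prime_decomp// prime_decompE E big_seq1.
have k0 : (0 < logn p n)%N by rewrite logn_gt0.
have k2 : (2 <= logn p n)%N.
  rewrite ltn_neqAle k0 andbT; apply/eqP => h.
  by move: np; rewrite nE -h expn1 pp.
rewrite nE; apply: allpairs_f; rewrite mem_iota.
  rewrite prime_gt0//= add1n -ltn_sqr.
  by rewrite (leq_ltn_trans _ s2)// (leq_trans _ (_ : n <= N)%N)// [leqRHS]nE leq_pexp2l// prime_gt0.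
rewrite /= add0n ltnS trunc_log_max//.
by rewrite (leq_trans _ (_ : n <= N)%N)// [leqRHS]nE leq_exp2r// prime_gt1.
Qed.

(** Primes n <= s are bounded trivially; for n > s, ln N <= 2 ln n lets vonM n stand in for the
    indicator, and [sum_vonM_ln] applies. *)
Lemma sum_prime_ln_ratio s N : (1 < N)%N -> (s ^ 2 <= N < s.+1 ^ 2)%N ->
  \sum_(1 <= n < N.+1) (prime n)%:R * ln (N%:R / n%:R) <= s%:R * ln N%:R + 16 * N%:R / ln N%:R :> R.
Proof.
move=> N1 /andP[s1 s2]; have lN : 0 < ln N%:R :> R by rewrite ln_gt0// ltr1n.
have N0 : 0 < N%:R :> R by rewrite ltr0n; lia.
apply: (@le_trans _ _ (\sum_(1 <= n < N.+1) ((n <= s)%N%:R * ln N%:R +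
    2 / ln N%:R * (vonM n * ln (N%:R / n%:R))))).
  apply: ler_sum_nat => n /andP[n0 nN]; have n0' : 0 < n%:R :> R by rewrite ltr0n.
  have r0 : 0 <= ln (N%:R / n%:R) :> R by rewrite ln_ge0// ratio_ge1// n0.
  have rE : ln (N%:R / n%:R) = ln N%:R - ln n%:R :> R by rewrite ln_div.
  have v0 : 0 <= 2 / ln N%:R * (vonM n * ln (N%:R / n%:R)) :> R.
    by rewrite !mulr_ge0 ?invr_ge0 ?vonM_ge0 ?(ltW lN).
  case: (boolP (prime n)) => pn; last first.
    by rewrite mul0r addr_ge0// mulr_ge0// ltW.
  have ln0 : 0 <= ln n%:R :> R by rewrite ln_ge0// ler1n.
  rewrite mul1r; case: leqP => ns.
    by rewrite mul1r -[leLHS]addr0 lerD// rE; lra.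
  rewrite mul0r add0r mulrA -[leLHS]mul1r ler_wpM2r// vonM_prime//.
  rewrite mulrAC ler_pdivlMr// mul1r -[2]/(2%:R) mulr_natl -lnXn//.
  rewrite ler_ln ?posrE ?exprn_gt0// -natrX ler_nat.
  by rewrite (leq_trans (ltnW s2))// leq_exp2r.
rewrite big_split /= -mulr_suml -mulr_sumr lerD//.
  rewrite ler_wpM2r ?(ltW lN)// -natr_sum ler_nat.
  have sN : (s <= N)%N by apply: leq_trans s1; rewrite expnS expn1; nia.
  rewrite (big_cat_nat _ (n := s.+1))//= [X in (_ + X)%N]big1_seq; last first.
    by move=> i /andP[_]; rewrite mem_index_iota => /andP[h _]; rewrite leqNgt h.
  rewrite addn0 (eq_big_nat _ _ (F2 := fun=> 1%N)); first by rewrite sum_nat_const_nat muln1 subn1.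
  by move=> i /andP[_]; rewrite ltnS => ->.
rewrite mulrAC [leRHS](_ : _ = 2 * (8 * N%:R) / ln N%:R); last by field; rewrite gt_eqF.
by rewrite ler_pM2r ?invr_gt0// ler_pM2l// sum_vonM_ln.
Qed.

Lemma sqrt_ln_sqr_small (e : R) : 0 < e -> exists N0, forall N s, (N0 <= N)%N ->
  (s ^ 2 <= N < s.+1 ^ 2)%N ->
  s%:R * (1 + ln N%:R) ^+ 2 <= e * N%:R.
Proof.
move=> e0; pose K := (Num.truncn (128 / e)).+1.
have hK : 128 / e <= K%:R by rewrite ltW// truncnS_gt.
exists (K ^ 4)%N => N s NK /andP[s1 s2].
have sK : (K ^ 2 < s.+1)%N.
  by rewrite -ltn_sqr (leq_ltn_trans _ s2)// -expnM.
have s0 : (0 < s)%N by move: sK; rewrite expnS; lia.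
have N0 : (0 < N)%N by apply: leq_trans s1; rewrite expn_gt0 s0.
set y := ln s.+1%:R : R; have y0 : 0 <= y by rewrite ln_ge0// ler1n.
have lN : ln N%:R <= 2 * y.
  rewrite /y -[2]/(2%:R) mulr_natl -lnXn ?ltr0n//.
  by rewrite ler_ln ?posrE ?exprn_gt0 ?ltr0n// -natrX ler_nat ltnW.
have lN0 : 0 <= ln N%:R :> R by rewrite ln_ge0// ler1n.
have y1 : (1 + y) ^+ 2 <= 16 * Num.sqrt s.+1%:R by apply: sqr_1Dln_le; rewrite ler1n.
set t := Num.sqrt _ in y1; have t0 : 0 <= t by rewrite sqrtr_ge0.
have tE : t ^+ 2 = s%:R + 1 by rewrite sqr_sqrtr// natr1.
have tK : K%:R <= t.
  have -> : K%:R = Num.sqrt (K ^ 2)%:R :> R by rewrite natrX sqrtr_sqr ger0_norm.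
  by rewrite ler_wsqrtr// ler_nat ltnW.
have s1' : 1 <= s%:R :> R by rewrite ler1n.
have sN : s%:R ^+ 2 <= N%:R :> R by rewrite -natrX ler_nat.
have te : 128 <= e * t by move: hK; rewrite ler_pdivrMr// mulrC => h; rewrite (le_trans h)// ler_pM2l.
apply: (@le_trans _ _ (s%:R * (64 * t))).
  rewrite ler_wpM2l//; apply: le_trans (_ : (2 * (1 + y)) ^+ 2 <= _); last by rewrite exprMn; lra.
  by rewrite ler_sqr ?nnegrE; lra.
apply: (@le_trans _ _ (e * s%:R ^+ 2)); last by rewrite ler_pM2l.
rewrite expr2 [leRHS]mulrCA ler_wpM2l//.
have e2 : 128 * t <= e * t ^+ 2 by rewrite expr2 mulrA ler_wpM2r.
move: e2; rewrite tE => e2.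
have e3 : e <= e * s%:R by rewrite ler_peMr// ltW.
by lra.
Qed.

Lemma nonprime_small (e : R) : 0 < e -> exists N0, forall N, (N0 <= N)%N ->
  \sum_(1 <= n < N.+1) (~~ prime n)%:R * vonM n <= e * N%:R :> R.
Proof.
move=> e0; have e2 : 0 < e / 2 by lra.
have [N0 hN0] := sqrt_ln_sqr_small e2; exists N0.+1 => N NN.
have [s hs] := nat_sqrt N; have := hN0 N s (ltnW NN) hs.
have Np : (0 < N)%N by lia.
have lN0 : 0 <= ln N%:R :> R by rewrite ln_ge0// ler1n.
move=> h; apply: le_trans (sum_vonM_nonprime hs) _.
have hT : (trunc_log 2 N)%:R <= 2 * ln N%:R :> R.
  have := trunc_logP (isT : (1 < 2)%N) Np; rewrite -(@ler_nat R) natrX => hh.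
  have : ln (2 ^+ trunc_log 2 N) <= ln N%:R :> R.
    by rewrite ler_ln ?posrE ?exprn_gt0 ?ltr0n.
  rewrite lnXn// -[X in X <= _]mulr_natl; have := @ln_ge_1subV R 2 (ltr0n _ 2).
  move: ((trunc_log 2 N)%:R : R) (ler0n R (trunc_log 2 N)); clear => T T0 h1 h2.
  have : T * (1 - 2^-1) <= T * ln 2 by rewrite ler_wpM2l.
  by lra.
rewrite natrM -mulrA -[trunc_log 2 N]/(trunc_log 2 N) -natr1.
have s0 : 0 <= s%:R :> R by [].
have -> : e * N%:R = 2 * (e / 2 * N%:R) by lra.
apply: le_trans (_ : 2 * (s%:R * (1 + ln N%:R) ^+ 2) <= _); last by rewrite ler_pM2l.
rewrite [leRHS]mulrCA ler_wpM2l//.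
by move: (ln _) lN0 hT; clear => l l0 hT; nra.
Qed.

(** At primes the weights ln N and vonM n differ by ln (N / n), small on average by
    [sum_prime_ln_ratio]; elsewhere only proper prime powers contribute. The threshold is uniform in
    f. *)
Lemma log_prime_sum (G e : R) : 0 <= G -> 0 < e -> exists N0, forall N, (N0 <= N)%N ->
  forall f : nat -> R, (forall n, `|f n| <= G) ->
  `|ln N%:R * (\sum_(1 <= n < N.+1) (prime n)%:R * f n) -
    \sum_(1 <= n < N.+1) f n * vonM n| <= e * N%:R.
Proof.
move=> G0 e0; set e' := e / (3 * (G + 1)).
have e'0 : 0 < e' by rewrite divr_gt0// mulr_gt0//; lra.
have [N1 hN1] := nonprime_small e'0; have [N2 hN2] := sqrt_ln_sqr_small e'0.
have [N3 hN3] := ln_ge_large (16 / e').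
exists (N1 + N2 + N3).+2 => N NN f fG.
have Np : (1 < N)%N by lia.
have lN0 : 0 < ln N%:R :> R by rewrite ln_gt0// ltr1n.
have n1 := hN1 N ltac:(lia).
have [s hs] := nat_sqrt N; have n2 := hN2 N s ltac:(lia) hs.
have n3 := hN3 N ltac:(lia); have n4 := sum_prime_ln_ratio Np hs.
have N0 : 0 < N%:R :> R by rewrite ltr0n; lia.
rewrite mulr_sumr -sumrB.
apply: (@le_trans _ _ (\sum_(1 <= n < N.+1)
   (G * ((prime n)%:R * ln (N%:R / n%:R)) + G * ((~~ prime n)%:R * vonM n)))).
  apply: le_trans (ler_norm_sum _ _ _) _; apply: ler_sum_nat => n /andP[n0 nN].
  have n0' : 0 < n%:R :> R by rewrite ltr0n.
  case: (boolP (prime n)) => pn.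
    rewrite mul0r mulr0 addr0 !mul1r vonM_prime// ln_div ?posrE//.
    rewrite mulrC -mulrBr normrM ler_pM// ger0_norm// subr_ge0 ler_ln ?posrE// ler_nat.
    by rewrite -ltnS.
  by rewrite !mul0r !mulr0 !mul1r sub0r normrN normrM add0r ler_pM// ger0_norm// vonM_ge0.
rewrite big_split /= -!mulr_sumr -mulrDr.
have n5 : 16 * N%:R / ln N%:R <= e' * N%:R.
  rewrite ler_pdivrMr// mulrAC ler_wpM2r ?(ltW N0)//.
  by move: n3; rewrite ler_pdivrMr// mulrC.
have n6 : s%:R * ln N%:R <= e' * N%:R.
  apply: le_trans n2; rewrite ler_wpM2l//.
  by move: (ln _) lN0; clear => l l0; nra.
apply: (@le_trans _ _ (G * (3 * (e' * N%:R)))); first by rewrite ler_wpM2l//; lra.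
have eE : e = e' * (3 * (G + 1)) by rewrite /e' divfK// gt_eqF// mulr_gt0//; lra.
rewrite [X in _ <= X * _]eE.
have : 0 <= e' * N%:R by rewrite mulr_ge0// ltW.
by clearbody e'; move: (N%:R : R); clear -G0 => n h; nra.
Qed.

Definition prime_count N : R := \sum_(1 <= n < N.+1) (prime n)%:R.

Lemma prime_count_bounds : exists N0, forall N, (N0 <= N)%N ->
  N%:R / 4 <= ln N%:R * prime_count N <= 9 * N%:R.
Proof.
have e0 : 0 < 1 / 16 :> R by lra.
have [N0 hN0] := @log_prime_sum 1 _ ler01 e0.
have [N1 hN1] := ln_le_eps e0.
exists (N0 + N1 + 100)%N => N NN.
have := hN0 N ltac:(lia) (fun=> 1) ltac:(by move=> n; rewrite normr1).
rewrite (eq_bigr (fun n => (prime n)%:R)); last by move=> n _; rewrite mulr1.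
rewrite -/(prime_count N) [X in _ - X](eq_bigr (fun n => vonM n)); last by move=> n _; rewrite mul1r.
rewrite -/(psi N); have := @psi_le R N; have := @psi_lower R N ltac:(lia).
have := hN1 N ltac:(lia); have : 100 <= N%:R :> R by rewrite (ler_nat _ 100); lia.
rewrite ler_norml; move: (N%:R : R) (ln N%:R) (ln _ * _) (psi N) => n l A p; clear => h1 h2 h3 h4 /andP[h5 h6].
by apply/andP; split; lra.
Qed.

Lemma prime_count_ge0 N : 0 <= prime_count N.
Proof. by apply: sumr_ge0. Qed.

Lemma prime_count_gt (C : R) : exists N0, forall N, (N0 <= N)%N -> C <= prime_count N.
Proof.
have e0 : 0 < (4 * (`|C| + 1))^-1 by rewrite invr_gt0 mulr_gt0// ltr_wpDl.
have [N0 hN0] := prime_count_bounds; have [N1 hN1] := ln_le_eps e0.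
exists (N0 + N1 + 2)%N => N NN; have /andP[h _] := hN0 N ltac:(lia).
have h1 := hN1 N ltac:(lia); have lN : 0 < ln N%:R :> R by rewrite ln_gt0// ltr1n; lia.
apply: le_trans (ler_norm C) _; apply: (@le_trans _ _ (`|C| + 1)); first lra.
rewrite -(ler_pM2l lN); apply: le_trans h.
have c0 : 0 < 4 * (`|C| + 1) by rewrite mulr_gt0// ltr_wpDl.
by move: h1; rewrite mulrC ler_pdivlMr// => h1; lra.
Qed.

End PrimeSums.

(** * Sums over primes of functions of the residue class *)

Section PrimesInClasses.
Context {R : realType} (q : nat).
Local Notation M := q.+2.
Local Notation Z := 'Z_M.
Implicit Types (f g h : Z -> R) (n N K : nat).

Lemma sum_mean0_primes g (e : R) : mean0 g -> 0 < e -> exists N0, forall N, (N0 <= N)%N ->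
  `|\sum_(1 <= n < N.+1) (prime n)%:R * g n%:R| <= e * prime_count N.
Proof.
move=> gm e0; have e8 : 0 < e / 8 by lra.
have [N0 hN0] := log_prime_sum (norm1_ge0 g) e8.
have [N1 hN1] := psig_littleo gm e8; have [N2 hN2] := @prime_count_bounds R.
exists (N0 + N1 + N2 + 2)%N => N NN.
have h0 := hN0 N ltac:(lia) (fun n => g n%:R) (fun n => le_norm1 g n%:R).
have h1 := hN1 N ltac:(lia); have /andP[h2 _] := hN2 N ltac:(lia).
have lN : 0 < ln N%:R :> R by rewrite ln_gt0// ltr1n; lia.
rewrite -(ler_pM2l lN) -{1}(gtr0_norm lN) -normrM.
set A := ln _ * \sum_(_ <= _ < _) _ in h0 *; rewrite -/(psig g N) in h0.
have := ler_normD (A - psig g N) (psig g N); rewrite subrK => h3.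
have h4 : e * (N%:R / 4) <= e * (ln N%:R * prime_count N) by rewrite ler_pM2l.
by rewrite [leRHS]mulrCA; lra.
Qed.

Lemma sum_class_primes_le f (e : R) : (forall a, 0 <= f a) -> unit_supp f -> 0 < e ->
  exists N0, forall N, (N0 <= N)%N ->
  \sum_(1 <= n < N.+1) (prime n)%:R * f n%:R <= ((\sum_a f a) / @phiM R q + e) * prime_count N.
Proof.
move=> f0 fs e0; have p0 := @phiM_gt0 R q; set c := _ / _.
have c0 : 0 <= c by rewrite divr_ge0 ?sumr_ge0// ltW.
pose g := fun a => f a - c * chi0 a.
have gm : mean0 g.
  split; first by move=> a aU; rewrite /g fs// chi0_unit_supp// mulr0 subr0.
  by rewrite sumrB -mulr_sumr -/(@phiM R q) divfK ?subrr// gt_eqF.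
have [N0 hN0] := sum_mean0_primes gm e0; exists N0 => N NN.
have := hN0 N NN; rewrite ler_norml => /andP[_].
have -> : \sum_(1 <= n < N.+1) (prime n)%:R * g n%:R = \sum_(1 <= n < N.+1) (prime n)%:R * f n%:R -
    c * \sum_(1 <= n < N.+1) (prime n)%:R * chi0 (n%:R : Z).
  by rewrite mulr_sumr -sumrB; apply: eq_bigr => n _; rewrite mulrBr [in LHS](mulrCA _ c).
have : \sum_(1 <= n < N.+1) (prime n)%:R * chi0 (n%:R : Z) <= prime_count N :> R.
  by apply: ler_sum => n _; rewrite ler_piMr// chi0_natr lern1 leq_b1.
move=> h1 h2; have : c * \sum_(1 <= n < N.+1) (prime n)%:R * chi0 (n%:R : Z) <= c * prime_count N.
  by rewrite ler_wpM2l.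
by lra.
Qed.

End PrimesInClasses.

(** * Large prime factors of p + l and p - l *)

Section PrimeDivisorTail.
Context {R : realType}.
Implicit Types (a r n k d p N K L s l y : nat).

Lemma vonM_prime_mul r d : prime r -> (0 < d)%N -> (r %| d)%N -> vonM (r * d) = vonM d :> R.
Proof.
move=> pr d0 rd; rewrite /vonM; suff /eq_primes-> : primes (r * d) =i primes d by [].
move=> p; rewrite primesM ?(prime_gt0 pr)// primes_prime// inE.
by case: eqP => // ->; rewrite mem_primes pr d0 rd.
Qed.

(** Only the powers of r count: this is Legendre's formula for the power of r in L!, in logarithmic
    form, and factoring out one r reduces L to L / r. *)
Lemma sum_vonM_multiples_div r L : prime r ->
  \sum_(1 <= d < L.+1 | (r %| d)%N) vonM d * (L %/ d)%:R <= ln r%:R * L%:R :> R.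
Proof.
move=> pr; have r1 := prime_gt1 pr; have r0 := prime_gt0 pr.
have lr : 0 <= ln r%:R :> R by rewrite ln_ge0// ler1n.
elim/ltn_ind: L => L IH; case: L IH => [|L'] IH; first by rewrite big_geq// mulr0.
set L := L'.+1 in IH *.
rewrite sum_dvdn_mul//; have hL : (2 * (L %/ r) <= L)%N.
  by apply: leq_trans (leq_divM L r); rewrite mulnC leq_mul2l r1 orbT.
have IHL := IH (L %/ r)%N ltac:(lia).
apply: (@le_trans _ _ (ln r%:R * (L %/ r)%:R + ln r%:R * (L %/ r)%:R)); last first.
  by rewrite -mulrDr -natrD ler_wpM2l// ler_nat; lia.
apply: le_trans (lerD IHL (lexx _)).
have [E|M0] := posnP (L %/ r); first by rewrite E !big_geq// mulr0 addr0.
rewrite [X in _ <= X + _]big_mkcond [X in _ <= X + _]big_ltn// [leLHS]big_ltn//=.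
rewrite muln1 dvdn1 gtn_eqF// add0r vonM_prime// [leRHS]addrC lerD//.
apply: ler_sum_nat => k /andP[k1 _]; rewrite divnMA.
case: ifP => rk; first by rewrite vonM_prime_mul// ltnW.
have := @vonM_pfactor R r 1 k pr (ltnW k1); rewrite rk expn1 => ->//.
by rewrite gtn_eqF// mul0r.
Qed.

(** Each run of d consecutive k contains a solution of r k + a = 0 modulo d, r being invertible;
    [k0] is - a times the inverse u. *)
Lemma leq_sum_ap_dvdn d r a L : (0 < d)%N -> (0 < r)%N -> coprime r d ->
  (L %/ d <= \sum_(0 <= k < L) (d %| r * k + a)%N)%N.
Proof.
move=> d0 r0 /(coprimeP _ r0) [[u v] /= uv].
have main j : (j <= \sum_(0 <= k < j * d) (d %| r * k + a)%N)%N.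
  elim: j => [|j IH]; first by rewrite mul0n big_geq.
  rewrite mulSn addnC (big_cat_nat _ (n := (j * d)%N)) ?leq_addr//= -addn1 leq_add//.
  set k0 := ((u * (d - a %% d)) %% d)%N; have k0d : (k0 < d)%N by rewrite ltn_mod.
  rewrite (bigD1_seq (j * d + k0)%N) ?iota_uniq//= ?mem_index_iota ?leq_addr ?ltn_add2l//.
  have -> : (d %| r * (j * d + k0) + a)%N; last by rewrite leq_addr.
  have ur : (u * r = 1 + v * d)%N by lia.
  have ad := ltn_pmod a d0.
  rewrite mulnDr mulnA -addnA dvdn_addr ?dvdn_mull//.
  rewrite /dvdn -modnDml /k0 modnMmr mulnA [(r * u)%N]mulnC ur mulnDl mul1n.
  rewrite modnDml -mulnA [(d * _)%N]mulnC mulnA addnAC addnC modnMDl.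
  by rewrite -modnDmr subnK ?modnn// ltnW.
apply: leq_trans (main (L %/ d)%N) _.
by rewrite [leqRHS](big_cat_nat _ (n := (L %/ d * d)%N)) ?leq_divM//= leq_addr.
Qed.

Definition theta_ap r a N : R :=
  \sum_(1 <= n < N.+1) (prime n && (n %% r == a)%N)%:R * ln n%:R.

Lemma ln_sum_vonM n N : (0 < n <= N)%N ->
  ln n%:R = \sum_(1 <= d < N.+1) (d %| n)%:R * vonM d :> R.
Proof.
move=> /andP[n0 nN]; rewrite -sum_vonM// (@sum_divisors_le _ _ _ N) ?n0// big_mkcond.
by apply: eq_bigr => d _; case: ifP; rewrite ?mul1r ?mul0r.
Qed.

(** Chebyshev's method for the product of the r k + a with k < L, compared with L!. A prime power d
    <= L prime to r divides at least L / d of the factors, and a prime of class a between L and r L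
    is itself a factor. The power of r in L!, which the product lacks, costs one of the two L * ln
    r. *)
Lemma theta_ap_step r a L : prime r -> (0 < a < r)%N -> (0 < L)%N ->
  theta_ap r a (r * L) - theta_ap r a L <= 2 * L%:R * ln r%:R.
Proof.
move=> pr /andP[a0 ar] L0; have r1 := prime_gt1 pr; have r0 := prime_gt0 pr.
have lr : 0 <= ln r%:R :> R by rewrite ln_ge0// ler1n.
have LrL : (L <= r * L)%N by rewrite leq_pmull.
have range k : (k < L)%N -> (0 < r * k + a <= r * L)%N.
  move=> kL; rewrite addn_gt0 a0 orbT/=; apply: (@leq_trans (r * k.+1)); last by rewrite leq_mul2l kL orbT.
  by rewrite mulnS addnC leq_add2r ltnW.
have up : \sum_(0 <= k < L) ln (r * k + a)%:R <= L%:R * ln r%:R + lnfact L :> R.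
  rewrite /lnfact big_add1 /= -[L in X in _ <= X + _]subn0 mulr_natl -sumr_const_nat -big_split /=.
  apply: ler_sum_nat => k /andP[_ kL].
  rewrite -lnM ?posrE ?ltr0n// -natrM ler_ln ?posrE ?ltr0n ?muln_gt0 ?r0//.
    by rewrite ler_nat mulnS addnC leq_add2r ltnW.
  by have /andP[] := range _ kL.
have low : lnfact L - \sum_(1 <= d < (r * L).+1 | (r %| d)%N) vonM d * (L %/ d)%:R +
    (theta_ap r a (r * L) - theta_ap r a L) <= \sum_(0 <= k < L) ln (r * k + a)%:R.
  have -> : \sum_(0 <= k < L) ln (r * k + a)%:R = \sum_(1 <= d < (r * L).+1)
      vonM d * (\sum_(0 <= k < L) (d %| r * k + a)%N)%:R :> R.
    rewrite (eq_big_nat _ _ (F2 := fun k => \sum_(1 <= d < (r * L).+1) (d %| r * k + a)%:R * vonM d)).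
      by rewrite exchange_big /=; apply: eq_bigr => d _; rewrite natr_sum mulr_sumr; apply: eq_bigr => k _; rewrite mulrC.
    by move=> k /andP[_ kL]; rewrite (@ln_sum_vonM _ (r * L))// range.
  rewrite (lnfact_vonM_le LrL) [X in _ - X + _]big_mkcond /=.
  have -> : theta_ap r a (r * L) - theta_ap r a L = \sum_(1 <= n < (r * L).+1)
      (prime n && (n %% r == a)%N && (L < n)%N)%:R * ln n%:R.
    rewrite /theta_ap (big_cat_nat _ (n := L.+1))//= addrAC subrr add0r.
    rewrite [RHS](big_cat_nat _ (n := L.+1))//= [X in _ = X + _]big1_seq ?add0r.
      by apply: eq_big_nat => n /andP[Ln _]; rewrite Ln andbT.
    by move=> n /andP[_]; rewrite mem_index_iota ltnS => /andP[_ nL]; rewrite ltnNge nL andbF mul0r.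
  rewrite -sumrB -big_split /=; apply: ler_sum_nat => d /andP[d0 dL].
  have [dle|dgt] := leqP d L.
    rewrite andbF mul0r addr0; case: ifP => rd.
      by rewrite subrr mulr_ge0// vonM_ge0.
    rewrite subr0 ler_wpM2l ?vonM_ge0// ler_nat leq_sum_ap_dvdn//.
    by rewrite prime_coprime// rd.
  rewrite andbT divn_small// mulr0 if_same subrr add0r.
  case: (boolP (_ && _)) => [/andP[pd /eqP da]|_]; last by rewrite mul0r mulr_ge0// vonM_ge0.
  rewrite mul1r vonM_prime// ler_peMr ?ln_ge0 ?ler1n//.
  have dE : d = (r * (d %/ r) + a)%N by rewrite -da mulnC -divn_eq.
  have dr : (d %/ r < L)%N by rewrite ltn_divLR// ltn_neqAle mulnC -ltnS dL andbT;
    apply/eqP => h; move: da; rewrite h modnMr => h0; rewrite -h0 in a0.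
  rewrite (bigD1_seq (d %/ r)%N) ?iota_uniq ?mem_index_iota//=.
  by rewrite -dE dvdnn.
have third : \sum_(1 <= d < (r * L).+1 | (r %| d)%N) vonM d * (L %/ d)%:R <= ln r%:R * L%:R :> R.
  apply: le_trans (sum_vonM_multiples_div L pr).
  rewrite (big_cat_nat _ (n := L.+1))//= [X in _ + X]big1_seq ?addr0//.
  by move=> d /andP[_]; rewrite mem_index_iota => /andP[Ld _]; rewrite divn_small// mulr0.
by have := le_trans low up; lra.
Qed.

Lemma theta_ap_mono r a K N : (K <= N)%N -> theta_ap r a K <= theta_ap r a N.
Proof.
move=> KN; rewrite /theta_ap [leRHS](big_cat_nat _ (n := K.+1))//= lerDl big_nat.
by apply: sumr_ge0 => n /andP[nK _]; rewrite mulr_ge0// ln_ge0// ler1n; lia.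
Qed.

(** Iteration along N, N / r, ...: r >= 3 gives 12 L / r + 2 L <= 6 L, and L <= 2 N / r closes the
    induction with 12. The factor ln r lost for large N is harmless, since the bound is later summed
    against 1 / r. *)
Lemma theta_ap_le r a N : prime r -> (2 < r)%N -> (0 < a < r)%N ->
  theta_ap r a N <= ln r%:R * (1 + 12 * N%:R / r%:R).
Proof.
move=> pr r3 /andP[a0 ar]; have r0 := prime_gt0 pr; have r0' : 0 < r%:R :> R by rewrite ltr0n.
have lr : 0 <= ln r%:R :> R by rewrite ln_ge0// ler1n.
have r3' : 3 <= r%:R :> R by rewrite (ler_nat _ 3).
elim/ltn_ind: N => N IH; have [Nr|Nr] := ltnP N r.
  apply: (@le_trans _ _ (ln r%:R)); last first.
    by rewrite ler_peMr// lerDl divr_ge0// mulr_ge0.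
  have [aN|aN] := leqP a N; last first.
    rewrite /theta_ap big1_seq// => n /andP[_]; rewrite mem_index_iota => /andP[n0 nN].
    by rewrite modn_small 1?ltn_eqF ?andbF ?mul0r//; lia.
  rewrite /theta_ap (bigD1_seq a) ?iota_uniq ?mem_index_iota ?a0//= big1_seq ?addr0.
    apply: (@le_trans _ _ (ln a%:R)).
      by rewrite ler_piMl ?ln_ge0 ?ler1n// lern1 leq_b1.
    by rewrite ler_ln ?posrE ?ltr0n// ler_nat ltnW.
  move=> n /andP[na]; rewrite mem_index_iota => /andP[n0 nN].
  by rewrite modn_small ?(negbTE na) ?andbF ?mul0r//; lia.
set K := (N %/ r)%N; set L := K.+1.
have K1 : (0 < K)%N by rewrite divn_gt0.
have NL : (N < r * L)%N by rewrite mulnC ltn_ceil.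
have rK : (r * K <= N)%N by rewrite mulnC leq_divM.
have LN : (L < N)%N by rewrite /L; nia.
have h1 := @theta_ap_step r a L pr ltac:(by rewrite a0 ar) isT.
have h2 := IH L LN; have h3 := theta_ap_mono r a (ltnW NL).
have LK : L%:R <= 2 * (N%:R / r%:R) :> R.
  by rewrite mulrA ler_pdivlMr// -!natrM ler_nat /L; nia.
have x0 : 0 <= N%:R / r%:R :> R by rewrite divr_ge0.
apply: le_trans h3 _; apply: (@le_trans _ _ (ln r%:R * (1 + 12 * L%:R / r%:R + 2 * L%:R))).
  by rewrite mulrDr; lra.
rewrite ler_wpM2l// -addrA lerD2l.
have e1 : 12 * L%:R / r%:R <= 4 * L%:R :> R by rewrite ler_pdivrMr//; have := ler0n R L; nra.
by rewrite -[leRHS]mulrA; lra.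
Qed.

End PrimeDivisorTail.

(** * First moment of the large prime factors *)

Section TailBound.
Context {R : realType}.
Implicit Types (a r n k d p N K s l y : nat).

(** By [sqr_1Dln_le] the terms are at most 16 r ^ (-3/2), which the differences of 32 / sqrt r
    dominate. *)
Lemma sum_ln_sqr_tail y K : (0 < y <= K)%N ->
  \sum_(y.+1 <= r < K.+1) ln r%:R / r%:R ^+ 2 <= 32 / Num.sqrt y%:R - 32 / Num.sqrt K%:R :> R.
Proof.
move=> /andP[y0]; elim: K => [|K IH]; first by rewrite leqNgt y0.
rewrite leq_eqVlt => /orP[/eqP <-|]; first by rewrite big_geq// subrr.
rewrite ltnS => yK; rewrite big_nat_recr//=; have {IH} := IH yK.
have K0 : (0 < K)%N by apply: leq_trans yK.
have r1 : 1 <= K.+1%:R :> R by rewrite ler1n.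
have := sqr_1Dln_le r1; have : 0 <= ln K.+1%:R :> R by rewrite ln_ge0.
set v := Num.sqrt K.+1%:R; set u := Num.sqrt K%:R; set l := ln _ => l0 lv IH.
have u0 : 0 < u by rewrite sqrtr_gt0 ltr0n.
have v0 : 0 < v by rewrite sqrtr_gt0 ltr0n.
have uE : u ^+ 2 = K%:R by rewrite sqr_sqrtr.
have vE : v ^+ 2 = K.+1%:R by rewrite sqr_sqrtr.
have uv : v ^+ 2 = u ^+ 2 + 1 by rewrite uE vE natr1.
rewrite -vE; suff h : l / (v ^+ 2) ^+ 2 <= 32 / u - 32 / v by lra.
have uv' : u <= v by rewrite -ler_sqr ?nnegrE ?(ltW u0) ?(ltW v0)// uv; lra.
have -> : 32 / u - 32 / v = 32 / (u * v * (u + v)).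
  have -> : 32 / (u * v * (u + v)) = 32 * (v ^+ 2 - u ^+ 2) / (u * v * (u + v)) by rewrite uv; congr (_ / _); ring.
  by field; rewrite !gt_eqF// addr_gt0.
apply: (@le_trans _ _ (16 * v / (v ^+ 2) ^+ 2)).
  by rewrite ler_pM2r ?invr_gt0 ?exprn_gt0//; nra.
rewrite [leLHS](_ : _ = 16 / (v * v * v)); last by field; rewrite gt_eqF.
rewrite ler_pdivrMr ?mulr_gt0// mulrAC ler_pdivlMr ?mulr_gt0 ?addr_gt0//.
have : u * v * (u + v) <= v * v * (v + v) by rewrite !ler_pM ?mulr_ge0 ?addr_ge0 ?lerD ?(ltW u0) ?(ltW v0).
by lra.
Qed.

(** 1 / r stands for [lam r], up to a factor 2; the bound 2 N covers all prime factors of n + l when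
    n and l are at most N. *)
Definition large_factor_sum l y N n : R :=
  \sum_(y.+1 <= r < (2 * N).+1) (prime r)%:R * ((r %| n + l)%:R + (r %| n - l)%:R) / r%:R.

Lemma large_factor_sum_ge0 l y N n : 0 <= large_factor_sum l y N n.
Proof. by apply: sumr_ge0 => r _; rewrite !mulr_ge0 ?addr_ge0 ?invr_ge0. Qed.

Lemma large_factor_sum_le l y N n : (0 < N)%N ->
  large_factor_sum l y N n <= 4 * (1 + ln N%:R).
Proof.
move=> N0; have N0' : 0 < N%:R :> R by rewrite ltr0n.
have l2 : ln 2 <= 1 :> R by have := @ln_le_subr1 R 2 (ltr0n _ 2); lra.
have l0 : 0 <= ln N%:R :> R by rewrite ln_ge0// ler1n.
apply: (@le_trans _ _ (2 * harm (2 * N))); last first.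
  have := @harm_ln R (2 * N) ltac:(lia); rewrite natrM lnM ?posrE// => /andP[_]; lra.
rewrite /harm mulr_sumr; have [yN|yN] := leqP y (2 * N); last first.
  by rewrite /large_factor_sum big_geq ?sumr_ge0// 1?ltnW// => i _; rewrite mulr_ge0 ?invr_ge0.
rewrite [leRHS](big_cat_nat _ (n := y.+1))//= -[leLHS]add0r lerD//.
  by apply: sumr_ge0 => i _; rewrite mulr_ge0 ?invr_ge0.
apply: ler_sum => r _; rewrite ler_wpM2r ?invr_ge0//.
by case: (prime r); case: (r %| _)%N; case: (r %| _)%N; rewrite ?mul0r ?mul1r /=; lra.
Qed.

Lemma sum_ln_dvd_shift l r N : prime r -> (2 < r)%N -> (0 < l < r)%N -> (r <= 2 * N)%N ->
  \sum_(1 <= n < N.+1) (prime n && (l < n)%N)%:R * ln n%:R * ((r %| n + l)%:R + (r %| n - l)%:R)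
    <= 28 * N%:R * (ln r%:R / r%:R) :> R.
Proof.
move=> pr r3 /andP[l0 lr] rN; have r0 : 0 < r%:R :> R by rewrite ltr0n prime_gt0.
have lr0 : 0 <= ln r%:R :> R by rewrite ln_ge0// ler1n prime_gt0.
apply: (@le_trans _ _ (theta_ap r (r - l) N + theta_ap r l N)).
  rewrite /theta_ap -big_split /=; apply: ler_sum_nat => n /andP[n0 _].
  have ln0 : 0 <= ln n%:R :> R by rewrite ln_ge0// ler1n.
  case: (prime n) => /=; last by rewrite !mul0r addr0.
  case: (ltnP l n) => l_n; last by rewrite !mul0r addr_ge0 ?mulr_ge0.
  rewrite mul1r mulrDr lerD// mulrC ler_wpM2r//.
    rewrite ler_nat; case: (boolP (r %| _)%N) => // h; suff -> : (n %% r == r - l)%N by [].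
    have : (n + l == (r - l) + l %[mod r])%N by rewrite subnK ?(ltnW lr)// modnn -/(dvdn r _).
    by rewrite eqn_modDr [X in _ == X]modn_small//; lia.
  rewrite ler_nat; case: (boolP (r %| _)%N) => // h.
  suff -> : (n %% r == l)%N by [].
  by rewrite -(subnK (ltnW l_n)) -modnDml (eqP h) add0n modn_small.
have x0 : 1 <= 2 * N%:R / r%:R :> R by rewrite ler_pdivlMr// mul1r -natrM ler_nat.
have h1 := @theta_ap_le R r (r - l) N pr r3 ltac:(lia).
have h2 := @theta_ap_le R r l N pr r3 ltac:(lia).
apply: le_trans (lerD h1 h2) _.
rewrite [leRHS](_ : _ = ln r%:R * (14 * N%:R / r%:R) + ln r%:R * (14 * N%:R / r%:R)).
  by apply: lerD; rewrite ler_wpM2l//; lra.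
by field; rewrite gt_eqF.
Qed.

(** For n above sqrt N the weight 2 ln n / ln N >= 1 may be inserted; exchanging sums,
    [sum_ln_dvd_shift] then leaves N times a tail of the sum of ln r / r ^ 2. For n below sqrt N the
    trivial bound is enough. *)
Lemma large_factor_tail l (e : R) : (0 < l)%N -> 0 < e ->
  exists y0, forall y, (y0 <= y)%N -> exists N0, forall N, (N0 <= N)%N ->
  \sum_(1 <= n < N.+1) (prime n && (l < n)%N)%:R * large_factor_sum l y N n <= e * prime_count N.
Proof.
(* The main estimate is 2 * 28 * N * 32 / sqrt y, and its allowance e / 2 * ln N * prime_count N is
   at least e * N / 8. *)
move=> l0 e0; pose C : R := 8 * 56 * 32 / e.
have C0 : 0 < C by rewrite divr_gt0// !mulr_gt0.
exists (l + 2 + (Num.truncn (C ^+ 2)).+1)%N => y yy.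
have ly : (l + 2 <= y)%N := leq_trans (leq_addr _ _) yy.
have sy : C <= Num.sqrt y%:R.
  rewrite -[leLHS]ger0_norm ?(ltW C0)// -sqrtr_sqr ler_wsqrtr//.
  by apply: le_trans (ltW (truncnS_gt (C ^+ 2))) _; rewrite ler_nat (leq_trans _ yy)// leq_addl.
have e64 : 0 < e / 64 by lra.
have [N1 hN1] := sqrt_ln_sqr_small e64; have [N2 hN2] := @prime_count_bounds R.
exists (N1 + N2 + y + 2)%N => N NN.
have [s hs] := nat_sqrt N; have h1 := hN1 N s ltac:(lia) hs.
have /andP[h2 _] := hN2 N ltac:(lia); have N0 : (0 < N)%N by lia.
have lN : 0 < ln N%:R :> R by rewrite ln_gt0// ltr1n; lia.
have [s1 s2] := andP hs.
apply: (@le_trans _ _ (\sum_(1 <= n < N.+1) ((n <= s)%N%:R * (4 * (1 + ln N%:R)) +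
    2 / ln N%:R * ((prime n && (l < n)%N)%:R * ln n%:R * large_factor_sum l y N n)))).
  apply: ler_sum_nat => n /andP[n0 nN]; have ln0 : 0 <= ln n%:R :> R by rewrite ln_ge0// ler1n.
  have t0 := large_factor_sum_ge0 l y N n.
  have v0 b : 0 <= 2 / ln N%:R * (b%:R * ln n%:R * large_factor_sum l y N n).
    by rewrite !mulr_ge0// invr_ge0 ltW.
  case: (leqP n s) => ns.
    rewrite mul1r -[leLHS]addr0 lerD//; apply: le_trans (large_factor_sum_le l y n N0).
    by rewrite ler_piMl// lern1 leq_b1.
  rewrite mul0r add0r mulrA ler_wpM2r// mulrCA -[leLHS]mulr1 ler_wpM2l//.
  rewrite mulrAC ler_pdivlMr// mul1r -[2]/(2%:R) mulr_natl -lnXn ?ltr0n//.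
  rewrite ler_ln ?posrE ?exprn_gt0 ?ltr0n// -natrX ler_nat.
  by rewrite (leq_trans (ltnW s2))// leq_exp2r.
rewrite big_split /= -mulr_suml -mulr_sumr.
have -> : e * prime_count N = e / 2 * prime_count N + e / 2 * prime_count N by lra.
have NE : e * N%:R <= 4 * e * (ln N%:R * prime_count N).
  by have := ler_wpM2l (ltW e0) h2; lra.
apply: lerD.
  apply: (@le_trans _ _ (s%:R * (4 * (1 + ln N%:R)))).
    rewrite ler_wpM2r ?mulr_ge0 ?addr_ge0 ?(ltW lN)// -natr_sum ler_nat.
    have sN : (s <= N)%N by case: (s) s1 => // i; apply: leq_trans; rewrite -[leqLHS]expn1 leq_pexp2l.
    rewrite (big_cat_nat _ (n := s.+1))//= [X in (_ + X)%N]big1_seq; last first.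
      by move=> i /andP[_]; rewrite mem_index_iota => /andP[h _]; rewrite leqNgt h.
    rewrite addn0 (eq_big_nat _ _ (F2 := fun=> 1%N)); first by rewrite sum_nat_const_nat muln1 subn1.
    by move=> i /andP[_]; rewrite ltnS => ->.
  rewrite -(ler_pM2l lN) [leRHS]mulrCA.
  apply: (@le_trans _ _ (4 * (s%:R * (1 + ln N%:R) ^+ 2))); last first.
    have : 0 <= e * (ln N%:R * prime_count N) by rewrite !mulr_ge0 ?prime_count_ge0 ?(ltW e0) ?(ltW lN).
    move: (N%:R : R) (ln N%:R * prime_count N) (s%:R * (1 + ln N%:R) ^+ 2) h1 NE.
    by clear => a b c; lra.
  have s0 := ler0n R s; move: (s%:R : R) s0 (ln N%:R) lN; clear => s s0 l lN.
  have : 0 <= s * (1 + l) by rewrite mulr_ge0//; lra.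
  by rewrite expr2; nra.
rewrite mulrAC ler_pdivrMr//.
apply: (@le_trans _ _ (2 * (28 * N%:R * (32 / Num.sqrt y%:R)))).
  rewrite ler_pM2l//.
  apply: (@le_trans _ _ (28 * N%:R * \sum_(y.+1 <= r < (2 * N).+1) ln r%:R / r%:R ^+ 2)).
    rewrite /large_factor_sum; under eq_bigr do rewrite mulr_sumr.
    rewrite exchange_big /= mulr_sumr; apply: ler_sum_nat => r /andP[yr rN].
    have r1 : (0 < r)%N by apply: leq_trans yr.
    have r0 : 0 < r%:R :> R by rewrite ltr0n.
    case: (boolP (prime r)) => pr; last first.
      rewrite big1 => [|n _]; last by rewrite !mul0r mulr0.
      by rewrite !mulr_ge0 ?invr_ge0 ?exprn_ge0// ln_ge0// ler1n.
    have r3 : (2 < r)%N by move: ly yr; clear; lia.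
    have lr : (0 < l < r)%N by move: l0 ly yr; clear; lia.
    have h := sum_ln_dvd_shift pr r3 lr rN.
    have {}h := ler_wpM2r (_ : 0 <= r%:R^-1) h.
    have {}h := h ltac:(by rewrite invr_ge0).
    rewrite [leRHS](_ : _ = 28 * N%:R * (ln r%:R / r%:R) / r%:R); last by field; rewrite gt_eqF.
    apply: le_trans h; rewrite mulr_suml; apply: ler_sum => n _.
    by rewrite mul1r mulrA.
  rewrite ler_wpM2l ?mulr_ge0//.
  have yN : (0 < y <= 2 * N)%N by move: ly NN; clear; lia.
  have := sum_ln_sqr_tail yN.
  have : 0 <= 32 / Num.sqrt (2 * N)%:R :> R by rewrite divr_ge0// sqrtr_ge0.
  by lra.
have sy0 : 0 < Num.sqrt y%:R :> R by apply: lt_le_trans sy.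
have ce : 8 * 56 * 32 <= e * Num.sqrt y%:R by move: sy; rewrite /C ler_pdivrMr// [X in _ <= X]mulrC.
have k1 : 32 / Num.sqrt y%:R <= e / (8 * 56).
  by rewrite ler_pdivrMr// mulrAC ler_pdivlMr ?mulr_gt0//; lra.
have := ler_wpM2l (ltW (_ : 0 < 56 * N%:R)) k1.
have n0 : 0 < 56 * N%:R :> R by rewrite mulr_gt0 ?ltr0n.
by move=> /(_ n0); lra.
Qed.

End TailBound.

(** * Anticoncentration over the residue classes *)

Section PrimeReciprocals.
Context {R : realType}.
Implicit Types (n k N z w r : nat).

Lemma sum_nonprime_div (e : R) : 0 < e -> exists C : R, forall N, (0 < N)%N ->
  \sum_(1 <= n < N.+1) (~~ prime n)%:R * vonM n / n%:R <= C + e * ln N%:R.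
Proof.
move=> e0; have [N0 hN0] := nonprime_small e0.
pose A N : R := \sum_(1 <= n < N.+1) (~~ prime n)%:R * vonM n.
have A_le n : A n <= e * n%:R + 8 * N0%:R.
  have [nN|nN] := leqP N0 n; first by rewrite -[leLHS]addr0 lerD ?mulr_ge0// hN0.
  rewrite -[leLHS]add0r lerD ?mulr_ge0 ?(ltW e0)//; apply: (@le_trans _ _ (psi n)).
    by apply: ler_sum => i _; rewrite ler_piMl ?vonM_ge0// lern1 leq_b1.
  by apply: le_trans (psi_le n) _; rewrite ler_wpM2l// ler_nat ltnW.
exists (2 * e + 16 * N0%:R) => N Np.
rewrite (abel_sum _ (fun n => n%:R^-1) Np) -/(A N).
have N0' : 0 < N%:R :> R by rewrite ltr0n.
have h1 : A N * N%:R^-1 <= e + 8 * N0%:R.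
  rewrite ler_pdivrMr//; apply: le_trans (A_le N) _; rewrite [leRHS]mulrDl lerD2l.
  by rewrite ler_peMr ?mulr_ge0// ler1n.
suff : - (\sum_(1 <= n < N) A n * (n.+1%:R^-1 - n%:R^-1)) <= e * harm N + 8 * N0%:R.
  by have /andP[_ hh] := @harm_ln R N Np; have := ler_wpM2l (ltW e0) hh; rewrite mulrBr; lra.
have tel : \sum_(1 <= n < N) (n%:R^-1 - n.+1%:R^-1) <= 1 :> R.
  rewrite (eq_bigr (fun n => - n.+1%:R^-1 - - n%:R^-1)); last by move=> n _; rewrite opprK addrC.
  by rewrite telescope_sumr// invr1 opprK -[leRHS]add0r lerD// oppr_le0 invr_ge0.
rewrite -sumrN; apply: (@le_trans _ _ (\sum_(1 <= n < N) (e * n.+1%:R^-1 + 8 * N0%:R * (n%:R^-1 - n.+1%:R^-1)))).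
  apply: ler_sum_nat => n /andP[n0 _]; rewrite -mulrN opprB.
  have n0' : 0 < n%:R :> R by rewrite ltr0n.
  have d0 : 0 <= n%:R^-1 - n.+1%:R^-1 :> R.
    by rewrite subr_ge0 lef_pV2 ?posrE ?ltr0n// ler_nat.
  apply: le_trans (ler_wpM2r d0 (A_le n)) _; rewrite mulrDl lerD2r -mulrA ler_wpM2l ?(ltW e0)//.
  rewrite -natr1 [leLHS](_ : _ = (n%:R + 1)^-1)//.
  by field; rewrite !gt_eqF// addr_gt0.
rewrite big_split /= -!mulr_sumr lerD//.
  rewrite ler_wpM2l ?(ltW e0)// /harm [leRHS]big_ltn// big_add1/=.
  by rewrite -[leLHS]add0r lerD// ?invr1.
by rewrite -[leRHS]mulr1 ler_wpM2l// mulr_ge0.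
Qed.

Lemma sum_prime_inv_large z (K : R) : exists2 w, (z <= w)%N &
  K <= \sum_(z.+1 <= r < w.+1 | prime r) r%:R^-1.
Proof.
have step y : exists2 w, (y <= w)%N & 2^-1 <= \sum_(y.+1 <= r < w.+1 | prime r) r%:R^-1 :> R.
  have e4 : 0 < 4^-1 :> R by rewrite invr_gt0.
  have [C hC] := sum_nonprime_div e4.
  (* Mertens loses 1 at w and 8 + ln y.+1 below y, and proper prime powers take C + ln w / 4; the
     rest must still be at least ln w / 2. *)
  have [N0 hN0] := ln_ge_large (4 * (C + ln y.+1%:R + 9)).
  pose w := (N0 + y + 2)%N; exists w; first by rewrite /w -addnA addnCA leq_addr.
  have w0 : (0 < w)%N by rewrite /w; lia.
  have yw : (y < w)%N by rewrite /w; lia.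
  have lw := hN0 w ltac:(by rewrite /w; lia).
  have /andP[m1 _] := @mertens R w w0; have /andP[_ m2] := @mertens R y.+1 isT.
  have c1 := hC w w0.
  have lw0 : 0 < ln w%:R :> R by rewrite ln_gt0// ltr1n /w; lia.
  have small : \sum_(1 <= n < y.+1) vonM n / n%:R <= ln y.+1%:R + 8 :> R.
    by apply: le_trans m2; rewrite [leRHS]big_nat_recr//= lerDl divr_ge0// vonM_ge0.
  have big : \sum_(1 <= n < w.+1) vonM n / n%:R <=
      \sum_(1 <= n < y.+1) vonM n / n%:R + \sum_(1 <= n < w.+1) (~~ prime n)%:R * vonM n / n%:R
      + ln w%:R * \sum_(y.+1 <= r < w.+1 | prime r) r%:R^-1 :> R.
    rewrite (big_cat_nat _ (n := y.+1))//= -?addrA ?lerD2l; last by rewrite ltnW.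
    rewrite [X in _ <= X + _](big_cat_nat _ (n := y.+1))//=; last by rewrite ltnW.
    rewrite -addrA -[leLHS]add0r lerD//.
      by apply: sumr_ge0 => n _; rewrite !mulr_ge0 ?invr_ge0 ?vonM_ge0.
    rewrite [X in _ * X]big_mkcond mulr_sumr -big_split /=; apply: ler_sum_nat => n /andP[yn nw].
    have n0 : (0 < n)%N by apply: leq_trans yn.
    case: ifP => pn; last by rewrite mul1r mulr0 addr0.
    rewrite !mul0r add0r vonM_prime// ler_wpM2r ?invr_ge0//.
    by rewrite ler_ln ?posrE ?ltr0n// ler_nat -ltnS.
  rewrite -(ler_pM2l lw0); move: (_ * \sum_(_ <= _ < _ | _) _) big small c1 m1 lw lw0.
  by move: (\sum_(_ <= _ < _) _) (\sum_(_ <= _ < _) _) => a b; clear => *; lra.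
have main k : exists2 w, (z <= w)%N & k%:R / 2 <= \sum_(z.+1 <= r < w.+1 | prime r) r%:R^-1 :> R.
  elim: k => [|k [w zw IH]]; first by exists z; rewrite ?mul0r ?big_geq.
  have [w' ww' h] := step w; exists w'; first exact: leq_trans ww'.
  by rewrite (big_cat_nat _ (n := w.+1))//= -natr1; lra.
have [w zw h] := main (Num.truncn (2 * K)).+1; exists w => //; apply: le_trans h.
by have := ltW (truncnS_gt (2 * K)); lra.
Qed.

(** (r - 3) / (r - 1) <= 1 - 2 / r <= exp (- 2 / r), and the sum of 1 / r over primes diverges. *)
Lemma prod_prime_small z (e : R) : (3 < z)%N -> 0 < e -> exists2 w, (z <= w)%N &
  \prod_(z.+1 <= r < w.+1 | prime r) ((r - 3)%:R / r.-1%:R) <= e.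
Proof.
move=> z3 e0; have [w zw h] := sum_prime_inv_large z (- ln e / 2); exists w => //.
apply: (@le_trans _ _ (\prod_(z.+1 <= r < w.+1 | prime r) expR (- 2 * r%:R^-1))).
  rewrite big_seq_cond [leRHS]big_seq_cond; apply: ler_prod => r /andP[]; rewrite mem_index_iota => /andP[zr _] _.
  rewrite divr_ge0//=; apply: le_trans (expR_ge1Dx _).
  have -> : r = (r - 4).+4 by lia.
  rewrite /= subSS !subSS subn0; move: (r - 4)%N => m.
  have m0 := ler0n R m; rewrite ler_pdivrMr ?ltr0n// -!natr1.
  rewrite -subr_ge0 [X in 0 <= X](_ : _ = 2 / (m%:R + 1 + 1 + 1 + 1)).
    by rewrite divr_ge0//; lra.
  by field; rewrite gt_eqF//; lra.
rewrite -expR_sum -mulr_sumr -[leRHS]lnK ?posrE// ler_expR; lra.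
Qed.

End PrimeReciprocals.

(** * Residue patterns modulo primorials *)

Section PrimeByPrime.
Context {R : realType}.
Implicit Types (a b c l n r y z w M : nat).

Lemma sum_crt M r (F : nat -> nat -> R) : (0 < M)%N -> (0 < r)%N -> coprime M r ->
  \sum_(0 <= a < M * r) F (a %% M)%N (a %% r)%N = \sum_(0 <= b < M) \sum_(0 <= c < r) F b c.
Proof.
move=> M0 r0 cMr; set s := [seq (a %% M, a %% r)%N | a <- index_iota 0 (M * r)].
have us : uniq s.
  rewrite map_inj_in_uniq ?iota_uniq// => a b; rewrite !mem_index_iota => /andP[_ aM] /andP[_ bM] [e1 e2].
  have : (a == b %[mod M * r])%N by rewrite chinese_remainder// e1 e2 !eqxx.
  by rewrite !modn_small// => /eqP.
have sub : {subset s <= [seq (b, c) | b <- index_iota 0 M, c <- index_iota 0 r]}.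
  move=> x /mapP[a _ ->]; apply/allpairsP; exists (a %% M, a %% r)%N.
  by rewrite !mem_index_iota !ltn_mod M0 r0.
have [|_ e] := uniq_min_size us sub.
  by rewrite size_map size_allpairs !size_iota !subn0.
rewrite -(big_map (fun a => (a %% M, a %% r)%N) predT (fun x => F x.1 x.2)) -/s.
rewrite (perm_big [seq (b, c) | b <- index_iota 0 M, c <- index_iota 0 r]) ?big_allpairs//.
apply: uniq_perm => //; apply: allpairs_uniq => //; first exact: iota_uniq.
  exact: iota_uniq.
by move=> [b c] [b' c'].
Qed.

Definition primorial y := (\prod_(1 <= r < y.+1 | prime r) r)%N.

Lemma primorial_gt0 y : (0 < primorial y)%N.
Proof. by apply: prodn_cond_gt0 => r; exact: prime_gt0. Qed.

Lemma primorialS y : primorial y.+1 = (primorial y * (if prime y.+1 then y.+1 else 1))%N.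
Proof. by rewrite /primorial [LHS]big_mkcond big_nat_recr//= -big_mkcond. Qed.

Lemma dvdn_primorial r y : prime r -> (r <= y)%N -> (r %| primorial y)%N.
Proof.
move=> pr; elim: y => [|y IH]; first by rewrite leqn0 => /eqP r0; rewrite r0 in pr.
rewrite leq_eqVlt primorialS => /orP[/eqP<-|]; first by rewrite pr dvdn_mull.
by rewrite ltnS => /IH; exact: dvdn_mulr.
Qed.

Lemma coprime_primorial y r : prime r -> (y < r)%N -> coprime (primorial y) r.
Proof.
move=> pr; elim: y => [|y IH] yr; first by rewrite /primorial big_geq// coprime1n.
rewrite primorialS coprimeMl IH ?(ltnW yr)//=; case: ifP => py; last by rewrite coprime1n.
by rewrite coprime_sym prime_coprime// dvdn_prime2// gtn_eqF.
Qed.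

Lemma totient_primorialS y : prime y.+1 -> totient (primorial y.+1) = (totient (primorial y) * y)%N.
Proof.
by move=> py; rewrite primorialS py /= totient_coprime ?coprime_primorial// [totient y.+1]totient_prime.
Qed.

Lemma sum_units_primorialS y (F : nat -> nat -> R) : prime y.+1 ->
  \sum_(0 <= a < primorial y.+1) (coprime (primorial y.+1) a)%:R * F (a %% primorial y)%N (a %% y.+1)%N =
  \sum_(0 <= b < primorial y) (coprime (primorial y) b)%:R *
    \sum_(0 <= c < y.+1) (coprime y.+1 c)%:R * F b c.
Proof.
move=> py; have M0 := primorial_gt0 y; have cM := coprime_primorial py (ltnSn y).
rewrite !primorialS py.
under eq_bigr => a _ do rewrite coprimeMl -(coprime_modr _ a) -(coprime_modr y.+1 a) -mulnb natrM -mulrA.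
rewrite (sum_crt (fun b c => (coprime (primorial y) b)%:R * ((coprime y.+1 c)%:R * F b c)))//.
by apply: eq_bigr => b _; rewrite mulr_sumr.
Qed.

(* A congruence rather than [r %| n - l], whose truncated subtraction is wrong
   for [n < l]. *)
Definition side l r n : R := (r %| n + l)%N%:R - (n == l %[mod r])%N%:R.

Definition lam r : R := ln r%:R - ln r.-1%:R.

Definition side_sum l y n : R := \sum_(1 <= r < y.+1 | prime r) lam r * side l r n.

Lemma side_mod l r n M : (r %| M)%N -> side l r (n %% M) = side l r n.
Proof.
by move=> rM; rewrite /side modn_dvdm// /dvdn -modnDml modn_dvdm// modnDml.
Qed.

Lemma side_sum_mod l y n M : (primorial y %| M)%N -> side_sum l y (n %% M) = side_sum l y n.
Proof.
move=> yM; rewrite /side_sum [LHS]big_seq_cond [RHS]big_seq_cond; apply: eq_bigr => r.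
rewrite mem_index_iota ltnS => /andP[/andP[_ ry] pr].
by rewrite side_mod// (dvdn_trans _ yM)// dvdn_primorial.
Qed.

Lemma side_sumS l y n : prime y.+1 ->
  side_sum l y.+1 n = lam y.+1 * side l y.+1 n + side_sum l y n.
Proof. by move=> py; rewrite /side_sum [LHS]big_mkcond big_nat_recr//= -big_mkcond py addrC. Qed.

Lemma side_sum_notprime l y n : ~~ prime y.+1 -> side_sum l y.+1 n = side_sum l y n.
Proof. by move=> py; rewrite /side_sum [LHS]big_mkcond big_nat_recr//= -big_mkcond (negbTE py) addr0. Qed.

(** Among the r - 1 nonzero residues, [side] is -1 only at l, 1 only at r - l, and 0 at the other r
    - 3, so 0 is a most frequent value. *)
Lemma side_residue_le l r (t : R) : (0 < l)%N -> (l + 3 < r)%N -> (2 * l < r)%N ->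
  \sum_(0 <= c < r) (coprime r c)%:R * (side l r c == t)%:R <= (r - 3)%:R :> R.
Proof.
move=> l0 lr l2.
have sl : side l r l = - 1.
  rewrite /side eqxx addnn -mul2n /dvdn modn_small// gtn_eqF ?sub0r//; lia.
have sr : side l r (r - l) = 1.
  rewrite /side subnK ?dvdnn; last by lia.
  by rewrite !modn_small ?gtn_eqF ?subr0//; lia.
have s00 : side l r 0 = 0.
  have lr' : (l < r)%N by lia.
  by rewrite /side add0n mod0n /dvdn modn_small// [0%N == l]eq_sym gtn_eqF// subr0.
have s0 c : (c < r)%N -> c != l -> c != (r - l)%N -> c != 0%N -> side l r c = 0.
  move=> cr cl crl c0; rewrite /side [(c %% r)%N]modn_small// [(l %% r)%N]modn_small//; last by lia.
  rewrite (negbTE cl) subr0; case: (boolP (r %| c + l)%N) => // /dvdnP[k hk].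
  by have : k = 1%N by [nia]; move=> k1; move: hk crl; rewrite k1; lia.
have [->|t0] := eqVneq t 0.
  have -> : (r - 3)%:R = \sum_(0 <= c < r) ((c != 0%N) && (c != l) && (c != (r - l)%N))%:R :> R.
    rewrite -natr_sum -big_mkcond /= sum1_count -size_filter; congr (_%:R).
    have := count_predC [in [:: 0%N; l; (r - l)%N]] (index_iota 0 r).
    rewrite size_iota subn0 -!size_filter.
    have -> : size [seq x <- index_iota 0 r | x \in [:: 0%N; l; (r - l)%N]] = 3.
      have -> : 3 = size [:: 0%N; l; (r - l)%N] by [].
      apply/perm_size/uniq_perm; rewrite ?filter_uniq ?iota_uniq//=.
        by rewrite !inE !negb_or; apply/and3P; split=> //; lia.
      move=> x; rewrite mem_filter mem_index_iota andb_idr// !inE => /or3P[]/eqP->; lia.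
    move=> /(congr1 (subn^~ 3)) /=; rewrite addKn => <-; congr size.
    by apply: eq_filter => x; rewrite /= !inE !negb_or andbA.
  apply: ler_sum_nat => c /andP[_ cr]; have [->|c0] := eqVneq c 0%N.
    by rewrite /coprime gcdn0 gtn_eqF ?mul0r//; lia.
  have [->|cl] := eqVneq c l; first by rewrite sl oppr_eq0 oner_eq0 mulr0 ler0n.
  have [->|crl] := eqVneq c (r - l)%N; first by rewrite sr oner_eq0 mulr0 ler0n.
  by rewrite -natrM ler_nat; case: (_ == _); case: (coprime _ _).
have single c0 : (c0 < r)%N -> (forall c, (c < r)%N -> side l r c = t -> c = c0) ->
    \sum_(0 <= c < r) (coprime r c)%:R * (side l r c == t)%:R <= (r - 3)%:R :> R.
  move=> c0r h; apply: (@le_trans _ _ 1); last by rewrite ler1n; lia.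
  rewrite (bigD1_seq c0) ?iota_uniq ?mem_index_iota//= big1_seq ?addr0.
    by rewrite -natrM lern1; case: (_ == _); case: (coprime _ _).
  move=> c /andP[cc0]; rewrite mem_index_iota => /andP[_ cr].
  by case: eqP => [/(h _ cr) e|_]; rewrite ?mulr0//; rewrite e eqxx in cc0.
have [t1|t1] := eqVneq t 1.
  apply: (single (r - l)%N) => [|c cr st]; first by lia.
  apply/eqP/negPn/negP => crl; have [c0|c0] := eqVneq c 0%N.
    by move: st; rewrite c0 s00 t1 => /eqP; rewrite eq_sym oner_eq0.
  have [cl|cl] := eqVneq c l; first by move: st; rewrite cl sl t1; lra.
  by move: t0; rewrite -st s0// eqxx.
apply: (single l) => [|c cr st]; first by lia.
apply/eqP/negPn/negP => cl; have [crl|crl] := eqVneq c (r - l)%N.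
  by move: t1; rewrite -st crl sr eqxx.
have [c0|c0] := eqVneq c 0%N; first by move: t0; rewrite -st c0 s00 eqxx.
by move: t0; rewrite -st s0// eqxx.
Qed.

(** The Chinese remainder theorem multiplies the proportions (r - 3) / (r - 1) prime by prime.
    Primes up to z are left free: for them the classes of l, - l and 0 may coincide. *)
Lemma pattern_count_le l z w (s : nat -> R) : (0 < l)%N -> (2 * l + 4 <= z)%N -> (z <= w)%N ->
  \sum_(0 <= a < primorial w) (coprime (primorial w) a)%:R *
     \prod_(z.+1 <= r < w.+1 | prime r) (side l r a == s r)%:R
  <= (totient (primorial w))%:R * \prod_(z.+1 <= r < w.+1 | prime r) ((r - 3)%:R / r.-1%:R) :> R.
Proof.
move=> l0 lz; elim: w => [|w IH].
  by rewrite leqn0 => /eqP z0; move: lz; rewrite z0; lia.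
rewrite leq_eqVlt => /orP[/eqP <-|].
  rewrite big_geq// mulr1 totient_count_coprime natr_sum; apply: ler_sum => a _.
  by rewrite big_geq// mulr1.
rewrite ltnS => zw; have {}IH := IH zw; have zw' : (z.+1 <= w.+1)%N by [].
case: (boolP (prime w.+1)) => pw; last first.
  rewrite primorialS (negbTE pw) muln1.
  rewrite [X in _ <= _ * X]big_mkcond big_nat_recr//= -big_mkcond (negbTE pw) mulr1.
  apply: le_trans IH; apply: ler_sum => a _.
  by rewrite [X in _ * X <= _]big_mkcond big_nat_recr//= -big_mkcond (negbTE pw) mulr1.
rewrite totient_primorialS// [X in _ <= _ * X]big_mkcond big_nat_recr//= -big_mkcond pw.
pose F b c : R := (\prod_(z.+1 <= r < w.+1 | prime r) (side l r b == s r)%:R) * (side l w.+1 c == s w.+1)%:R.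
rewrite (eq_bigr (fun a => (coprime (primorial w.+1) a)%:R * F (a %% primorial w)%N (a %% w.+1)%N)); last first.
  move=> a _; congr (_ * _); rewrite [LHS]big_mkcond big_nat_recr//= -big_mkcond pw /F side_mod//.
  congr (_ * _); rewrite [LHS]big_seq_cond [RHS]big_seq_cond; apply: eq_bigr => r.
  rewrite mem_index_iota ltnS => /andP[/andP[_ rw] pr].
  by rewrite side_mod// dvdn_primorial.
rewrite sum_units_primorialS// /F.
rewrite [X in X <= _](eq_bigr (fun b => (coprime (primorial w) b)%:R *
    \prod_(z.+1 <= r < w.+1 | prime r) (side l r b == s r)%:R *
    \sum_(0 <= c < w.+1) (coprime w.+1 c)%:R * (side l w.+1 c == s w.+1)%:R)); last first.
  by move=> b _; rewrite -mulrA [in RHS]mulr_sumr; congr (_ * _); apply: eq_bigr => c _; rewrite mulrCA.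
rewrite -mulr_suml natrM -mulrA [X in _ <= _ * X](_ : _ =
    (\prod_(z.+1 <= r < w.+1 | prime r) ((r - 3)%:R / r.-1%:R)) * (w.+1 - 3)%:R); last first.
  have w0 : w%:R != 0 :> R by rewrite pnatr_eq0; lia.
  by rewrite /=; field.
rewrite mulrA ler_pM//.
- by apply: sumr_ge0 => b _; rewrite mulr_ge0// prodr_ge0.
- by apply: sumr_ge0 => b _; rewrite mulr_ge0.
by apply: side_residue_le => //; lia.
Qed.

End PrimeByPrime.

(** * Separation of the values and anticoncentration *)

Section Concentration.
Context {R : realType}.
Implicit Types (a b c l n r y z w M : nat) (u v : nat -> nat).

Lemma ln_prodn (s : seq nat) (P : pred nat) (F : nat -> nat) :
  (forall r, P r -> (0 < F r)%N) ->
  ln (\prod_(r <- s | P r) F r)%N%:R = \sum_(r <- s | P r) ln (F r)%:R :> R.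
Proof.
move=> F0; elim: s => [|r s IH]; first by rewrite !big_nil ln1.
rewrite !big_cons; case: ifP => // Pr.
by rewrite natrM lnM ?posrE ?ltr0n ?F0 ?prodn_cond_gt0// IH.
Qed.

(* Exponentiating, the largest prime [p] with [u p != v p] would divide exactly
   one side to a higher power, the factors [r - 1] with [r <= p] being prime to [p]. *)
Lemma lam_independent w u v :
  \sum_(1 <= r < w.+1 | prime r) (u r)%:R * lam r = \sum_(1 <= r < w.+1 | prime r) (v r)%:R * lam r :> R ->
  forall r, prime r -> (r <= w)%N -> u r = v r.
Proof.
elim: w => [|w IH] E r pr; first by rewrite leqn0 => /eqP r0; rewrite r0 in pr.
have recr (g : nat -> R) : \sum_(1 <= r < w.+2 | prime r) g r =
    \sum_(1 <= r < w.+1 | prime r) g r + (if prime w.+1 then g w.+1 else 0).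
  by rewrite [LHS]big_mkcond big_nat_recr//= -big_mkcond.
case: (boolP (prime w.+1)) => pw; last first.
  rewrite leq_eqVlt => /orP[/eqP rw|]; first by rewrite -rw pr in pw.
  by apply: IH => //; move: E; rewrite !recr (negbTE pw) !addr0.
pose A (u v : nat -> nat) n := (\prod_(1 <= r < n.+1 | prime r) (r ^ u r * r.-1 ^ v r))%N.
have pos (u' v' : nat -> nat) i : prime i -> (0 < i ^ u' i * i.-1 ^ v' i)%N.
  by move=> /prime_gt1; case: i => [|[|i]]// _; rewrite muln_gt0 !expn_gt0.
have lnA (u' v' : nat -> nat) : ln (A u' v' w.+1)%:R =
    \sum_(1 <= r < w.+2 | prime r) ((u' r)%:R * ln r%:R + (v' r)%:R * ln r.-1%:R) :> R.
  rewrite ln_prodn; last exact: pos.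
  apply: eq_bigr => i /prime_gt1; case: i => [|[|i]]// _.
  by rewrite natrM lnM ?posrE ?ltr0n ?expn_gt0// !natrX !lnXn ?ltr0n// !mulr_natl.
have AE : A u v w.+1 = A v u w.+1.
  have A0 (u' v' : nat -> nat) : 0 < (A u' v' w.+1)%:R :> R.
    by rewrite ltr0n prodn_cond_gt0//; exact: pos.
  apply/eqP; rewrite -(@eqr_nat R); apply/eqP/ln_inj; rewrite ?posrE//.
  have lamE (u' : nat -> nat) : \sum_(1 <= r < w.+2 | prime r) (u' r)%:R * lam r =
      \sum_(1 <= r < w.+2 | prime r) (u' r)%:R * ln r%:R -
      \sum_(1 <= r < w.+2 | prime r) (u' r)%:R * ln r.-1%:R :> R.
    by rewrite -sumrB; apply: eq_bigr => i _; rewrite mulrBr.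
  by rewrite !lnA !big_split /=; move: E; rewrite !lamE; lra.
have logA (u' v' : nat -> nat) : logn w.+1 (A u' v' w.+1) = u' w.+1.
  have recA : A u' v' w.+1 = (A u' v' w * (w.+1 ^ u' w.+1 * w ^ v' w.+1))%N.
    by rewrite /A [LHS]big_mkcond big_nat_recr//= -big_mkcond pw.
  have w0 : (0 < w)%N by have := prime_gt1 pw.
  have cw : coprime w.+1 w by rewrite coprimeSn.
  rewrite recA !lognM ?muln_gt0 ?expn_gt0 ?w0 ?prodn_cond_gt0//; last exact: pos.
  rewrite pfactorK// [logn _ (w ^ _)]logn_coprime ?coprimeXr// addn0.
  rewrite logn_coprime// /A big_seq_cond; elim/big_ind: _ => [|x x' hx hx'|i]; first by rewrite coprimen1.
    by rewrite coprimeMr hx hx'.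
  rewrite mem_index_iota => /andP[/andP[i0 iw] pi]; rewrite coprimeMr !coprimeXr//.
    rewrite prime_coprime// gtnNdvd//; first by have := prime_gt1 pi; lia.
    by lia.
  by rewrite prime_coprime// gtnNdvd.
have uvw : u w.+1 = v w.+1 by rewrite -(logA u v) AE logA.
rewrite leq_eqVlt => /orP[/eqP->//|]; apply: IH => //.
by move: E; rewrite !recr pw uvw => /addIr.
Qed.

Lemma side_sum_inj l w a b : side_sum l w a = side_sum l w b :> R ->
  forall r, prime r -> (r <= w)%N -> side l r a = side l r b :> R.
Proof.
move=> E r pr rw.
pose u x y r := ((r %| x + l) + (y == l %[mod r]))%N.
have := @lam_independent w (u a b) (u b a) _ r pr rw.
have -> : \sum_(1 <= i < w.+1 | prime i) (u a b i)%:R * lam i =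
    \sum_(1 <= i < w.+1 | prime i) (u b a i)%:R * lam i :> R.
  move/eqP: E; rewrite /side_sum /side -subr_eq0 -sumrB => /eqP h.
  apply/eqP; rewrite -subr_eq0 -sumrB -[X in _ == X]h; apply/eqP/eq_bigr => i _.
  by rewrite /u !natrD; ring.
move=> /(_ erefl) /(congr1 (fun n => n%:R : R)); rewrite /u !natrD /side; lra.
Qed.

(** By periodicity there are finitely many values. The factor 2 serves two values within e of a
    common centre. *)
Lemma side_sum_separated l w : exists2 e : R, 0 < e &
  forall a b, `|side_sum l w a - side_sum l w b| < 2 * e -> side_sum l w a = side_sum l w b :> R.
Proof.
pose M := primorial w; have M0 : (0 < M)%N := primorial_gt0 w.
pose P (x : 'I_M * 'I_M) (d : R) :=
  `|side_sum l w x.1 - side_sum l w x.2| < 2 * d -> side_sum l w x.1 = side_sum l w x.2 :> R.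
have [|x|e e0 he] := @finite_pos_lower R _ P.
- move=> x d d' /andP[d0 dd] h hd; apply: h; apply: lt_le_trans hd _; lra.
- have [E|E] := eqVneq (side_sum l w x.1 : R) (side_sum l w x.2); first by exists 1.
  exists (`|side_sum l w x.1 - side_sum l w x.2| / 2); first by rewrite divr_gt0// normr_gt0 subr_eq0.
  by rewrite /P mulrC divfK// ltxx.
exists e => // a b.
have := he (Ordinal (ltn_pmod a M0), Ordinal (ltn_pmod b M0)); rewrite /P /=.
by rewrite !side_sum_mod.
Qed.

(** At y = w all values within d of - c coincide by separation, so a single pattern is met, which
    [pattern_count_le] bounds. For a further prime r and each residue c0 modulo r the value is only
    translated, by lam r * side l r c0; the bound for all c therefore passes on with the same d. *)
Lemma side_sum_concentration l (e : R) : (0 < l)%N -> 0 < e -> exists2 d : R, 0 < d &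
  exists w, forall y, (w <= y)%N -> forall c : R,
    \sum_(0 <= a < primorial y) (coprime (primorial y) a)%:R * (`|c + side_sum l y a| < d)%R%:R
    <= e * (totient (primorial y))%:R :> R.
Proof.
move=> l0 e0; set z := (2 * l + 4)%N.
have [w zw hw] := @prod_prime_small R z e ltac:(rewrite /z; lia) e0.
have [d d0 hd] := side_sum_separated l w; exists d => //; exists w.
elim=> [|y IH] wy c.
  by move: zw; rewrite /z; lia.
have [yw|yw] := ltnP y w.
  have -> : y.+1 = w by lia.
  have [[a0 ha0]|no] := pselect (exists a, `|c + side_sum l w a| < d); last first.
    rewrite big1 ?mulr_ge0 ?(ltW e0)// => a _.
    by case: (boolP (_ < d)) => h; rewrite ?mulr0//; case: no; exists a.
  have t0 : 0 <= (totient (primorial w))%:R :> R by [].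
  apply: (@le_trans _ _ ((totient (primorial w))%:R *
      \prod_(z.+1 <= r < w.+1 | prime r) ((r - 3)%:R / r.-1%:R))); last by rewrite mulrC ler_wpM2r.
  apply: le_trans (pattern_count_le (fun r => side l r a0) l0 (leqnn z) zw).
  apply: ler_sum => a _; rewrite ler_wpM2l//; case: (boolP (_ < d)) => ha; last exact: prodr_ge0.
  rewrite big_seq_cond big1// => r; rewrite mem_index_iota ltnS => /andP[/andP[_ rw] pr].
  rewrite (@side_sum_inj l w a a0) ?eqxx//; apply: hd.
  rewrite (_ : _ - _ = (c + side_sum l w a) - (c + side_sum l w a0)); last by ring.
  by apply: le_lt_trans (ler_normB _ _) _; lra.
have {}IH := IH yw; case: (boolP (prime y.+1)) => py; last first.
  rewrite primorialS (negbTE py) muln1; apply: le_trans (IH c).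
  by apply: ler_sum => a _; rewrite side_sum_notprime.
have rM : (y.+1 %| primorial y.+1)%N by exact: dvdn_primorial.
rewrite (eq_bigr (fun a => (coprime (primorial y.+1) a)%:R *
    (`|c + (lam y.+1 * side l y.+1 (a %% y.+1) + side_sum l y (a %% primorial y))| < d)%R%:R)); last first.
  by move=> a _; rewrite side_sumS// side_mod// side_sum_mod.
rewrite (sum_units_primorialS (fun b c0 => (`|c + (lam y.+1 * side l y.+1 c0 + side_sum l y b)| < d)%R%:R) py).
under eq_bigr do rewrite mulr_sumr.
rewrite exchange_big /=.
apply: (@le_trans _ _ (\sum_(0 <= c0 < y.+1) (coprime y.+1 c0)%:R * (e * (totient (primorial y))%:R))).
  apply: ler_sum => c0 _; under eq_bigr do rewrite mulrCA; rewrite -mulr_sumr ler_wpM2l//.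
  by under eq_bigr do rewrite addrA; exact: IH.
rewrite -mulr_suml -natr_sum -totient_count_coprime totient_prime// totient_primorialS// natrM.
by rewrite /= mulrCA mulrC [_%:R * y%:R]mulrC mulrA mulrC mulrA.
Qed.

End Concentration.

(** * The sign of the difference of totients *)

Section TotientComparison.
Context {R : realType}.
Implicit Types (a b c l n r y z w M N : nat).

Lemma ln_totient n N : (0 < n <= N)%N ->
  ln (totient n)%:R = ln n%:R - \sum_(1 <= r < N.+1 | prime r) lam r * (r %| n)%:R :> R.
Proof.
move=> /andP[n0 nN].
have -> : \sum_(1 <= r < N.+1 | prime r) lam r * (r %| n)%:R = \sum_(r <- primes n) lam r :> R.
  rewrite (eq_bigr (fun r => if (r %| n)%N then lam r else 0)); last first.
    by move=> r _; case: (r %| n)%N; rewrite ?mulr1 ?mulr0.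
  rewrite -big_mkcondr -big_filter; apply: perm_big; apply: uniq_perm.
  - by rewrite filter_uniq// iota_uniq.
  - exact: primes_uniq.
  move=> r; rewrite mem_filter mem_primes n0 mem_index_iota ltnS /=.
  case: (boolP (prime r)) => //= pr; case: (boolP (r %| n)%N) => //= rn.
  by rewrite prime_gt0//= (leq_trans (dvdn_leq n0 rn)).
have pos r : r \in primes n -> (0 < r)%N /\ (0 < r.-1)%N.
  by rewrite mem_primes => /andP[/prime_gt1]; case: r => [|[|r]].
have e1 : ln n%:R = \sum_(r <- primes n) (logn r n)%:R * ln r%:R :> R.
  rewrite {1}(prod_prime_decomp n0) prime_decompE big_map big_seq ln_prodn.
    rewrite [RHS]big_seq; apply: eq_bigr => r /pos[r0 _] /=.
    by rewrite natrX lnXn ?ltr0n// mulr_natl.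
  by move=> r /pos[r0 _] /=; rewrite expn_gt0 r0.
rewrite totientE// e1 -sumrB big_seq ln_prodn; last first.
  by move=> r /pos[r0 r1]; rewrite muln_gt0 expn_gt0 r0 r1.
rewrite [RHS]big_seq; apply: eq_bigr => r rn; have [r0 r1] := pos r rn.
have l1 : (0 < logn r n)%N by rewrite logn_gt0.
rewrite natrM lnM ?posrE ?ltr0n// ?expn_gt0 ?r0//.
rewrite natrX lnXn ?ltr0n// /lam -[in RHS](prednK l1) -natr1 -[_ *+ _]mulr_natl; ring.
Qed.

Lemma sideE l r n : (l <= n)%N -> side l r n = (r %| n + l)%N%:R - (r %| n - l)%N%:R :> R.
Proof. by move=> l_n; rewrite /side eqn_mod_dvd. Qed.

Lemma ln_totient_sub l n N : (l < n)%N -> (n + l <= N)%N ->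
  ln (totient (n - l))%:R - ln (totient (n + l))%:R =
  side_sum l N n - (ln (n + l)%:R - ln (n - l)%:R) :> R.
Proof.
move=> l_n nN; rewrite (@ln_totient (n - l) N); last by lia.
rewrite (@ln_totient (n + l) N); last by lia.
rewrite /side_sum.
rewrite [in RHS](eq_bigr (fun r => lam r * (r %| n + l)%:R - lam r * (r %| n - l)%:R)); last first.
  by move=> r _; rewrite sideE ?(ltnW l_n)// mulrBr.
by rewrite sumrB; ring.
Qed.

Lemma lam_bounds r : prime r -> 0 <= (lam r : R) <= 2 / r%:R.
Proof.
move=> /prime_gt1; case: r => [|[|r]]// _; rewrite /lam /=.
have [h1 h2] := @ln_succ_bounds R r.+1 isT.
have r0 : 0 < r.+2%:R :> R by rewrite ltr0n.
apply/andP; split; first by apply: le_trans h1; rewrite invr_ge0.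
apply: le_trans h2 _; rewrite ler_pdivlMr// mulrC ler_pdivrMr ?ltr0n//.
by rewrite -natrM ler_nat; lia.
Qed.

Lemma side_sum_tail l y n N : (y <= 2 * N)%N -> (l <= n)%N ->
  `|side_sum l (2 * N) n - side_sum l y n| <= 2 * large_factor_sum l y N n :> R.
Proof.
move=> yN ln; rewrite /side_sum [X in `|X - _|](big_cat_nat _ (n := y.+1))//= addrAC subrr add0r.
apply: le_trans (ler_norm_sum _ _ _) _; rewrite /large_factor_sum mulr_sumr big_mkcond /=.
apply: ler_sum => r _; case: ifP => pr; last by rewrite !mul0r mulr0.
have /andP[l0 l1] := lam_bounds pr; rewrite mul1r normrM (ger0_norm l0) mulrCA [leRHS]mulrC ler_pM//.
rewrite sideE//; apply: le_trans (ler_normB _ _) _.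
by rewrite !ger0_norm.
Qed.

Lemma ln_ratio_small l n (e : R) : (l < n)%N -> 2 * l%:R <= e * (n - l)%:R ->
  `|ln (n + l)%:R - ln (n - l)%:R| <= e :> R.
Proof.
move=> l_n h; have m0 : 0 < (n - l)%:R :> R by rewrite ltr0n subn_gt0.
have p0 : 0 < (n + l)%:R :> R by rewrite ltr0n; lia.
have E : (n + l)%:R = (n - l)%:R + 2 * l%:R :> R.
  by rewrite natrB ?(ltnW l_n)// natrD; ring.
rewrite ger0_norm; last by rewrite subr_ge0 ler_ln ?posrE// ler_nat; lia.
rewrite -ln_div ?posrE//; apply: le_trans (ln_le_subr1 _) _; first by rewrite divr_gt0.
by rewrite lerBlDr ler_pdivrMr// E mulrDl mul1r; lra.
Qed.

Lemma totient_lt_ln a b : (0 < a)%N -> (0 < b)%N ->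
  (totient a < totient b)%N = (ln (totient a)%:R < ln (totient b)%:R :> R).
Proof. by move=> a0 b0; rewrite ltr_ln ?posrE ?ltr0n ?totient_gt0// ltr_nat. Qed.

(** The difference of ln totient is side_sum l y n up to twice the large-factor sum, below d / 2,
    and the ratio term, at most d / 2; a side sum of size at least d therefore decides the sign. *)
Lemma totient_order_side_sum l y n N (d : R) : (l < n)%N -> (n + l <= 2 * N)%N -> (y <= 2 * N)%N ->
  4 * l%:R <= d * (n - l)%:R -> 4 * large_factor_sum l y N n < d -> d <= `|side_sum l y n| ->
  [/\ (totient (n - l) > totient (n + l))%N = (d <= side_sum l y n),
      (totient (n - l) < totient (n + l))%N = (side_sum l y n <= - d) &
      (totient (n - l) == totient (n + l)) = false].
Proof.
move=> l_n nN yN h1 h2 h3.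
have t1 := side_sum_tail yN (ltnW l_n); have t2 := @ln_ratio_small l n (d / 2) l_n ltac:(lra).
have E := ln_totient_sub l_n nN.
have gt : (totient (n - l) > totient (n + l))%N = (d <= side_sum l y n).
  rewrite totient_lt_ln; [|by lia|by lia]; apply/idP/idP; move: t1 t2 h3; rewrite !ler_norml ler_normr;
   by move=> /andP[? ?] /andP[? ?] /orP[?|?] ?; lra.
have lt : (totient (n - l) < totient (n + l))%N = (side_sum l y n <= - d).
  rewrite totient_lt_ln; [|by lia|by lia]; apply/idP/idP; move: t1 t2 h3; rewrite !ler_norml ler_normr;
   by move=> /andP[? ?] /andP[? ?] /orP[?|?] ?; lra.
split=> //; have : (totient (n - l) < totient (n + l))%N || (totient (n - l) > totient (n + l))%N.
  by rewrite lt gt orbC; move: h3; rewrite ler_normr => /orP[->//|h]; rewrite lerNr h orbT.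
by rewrite eqn_leq => /orP[]; rewrite ltnNge => /negbTE->; rewrite ?andbF.
Qed.

Lemma side_opp l r n M : (r %| M)%N -> (n <= M)%N -> side l r (M - n) = - side l r n :> R.
Proof.
move=> rM nM; rewrite /side opprB; congr (_%:R - _%:R).
  congr nat_of_bool; rewrite /dvdn -[X in _ == X](mod0n r) -(eqn_modDr n).
  by rewrite addnAC subnK// add0n -modnDml (eqP rM) add0n eq_sym.
congr nat_of_bool; rewrite -(eqn_modDr n) subnK// (eqP rM) /dvdn eq_sym.
by rewrite addnC.
Qed.

Lemma side_sum_opp l y n : (n <= primorial y)%N ->
  side_sum l y (primorial y - n) = - side_sum l y n :> R.
Proof.
move=> nM; rewrite /side_sum -sumrN big_seq_cond [RHS]big_seq_cond; apply: eq_bigr => r.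
rewrite mem_index_iota ltnS => /andP[/andP[_ ry] pr].
by rewrite side_opp ?dvdn_primorial// mulrN.
Qed.

End TotientComparison.

(** * Counting primes by sign *)

Section PrimeSigns.
Context {R : realType}.
Implicit Types (a b c l n y N : nat).

(** The difference of the two indicators is odd under a |-> - a, hence of mean 0; the middle range
    enters only through an upper bound for its density. *)
Lemma side_sum_class_sums l y (e d : R) : (0 < e) -> 0 < d -> (1 < y)%N ->
  \sum_(0 <= a < primorial y) (coprime (primorial y) a)%:R * (`|side_sum l y a| < d)%R%:R
    <= e * (totient (primorial y))%:R ->
  exists N0, forall N, (N0 <= N)%N ->
    `|\sum_(1 <= n < N.+1) (prime n)%:R * ((coprime (primorial y) n)%:R *
        ((d <= side_sum l y n)%R%:R - (side_sum l y n <= - d)%R%:R))| <= e * prime_count N /\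
    \sum_(1 <= n < N.+1) (prime n)%:R * ((coprime (primorial y) n)%:R *
        (`|side_sum l y n| < d)%R%:R) <= 2 * e * prime_count N.
Proof.
move=> e0 d0 y1.
have M1 : (1 < primorial y)%N.
  by apply: leq_trans (dvdn_leq (primorial_gt0 y) (dvdn_primorial _ y1)).
have [q Mq] : exists q, primorial y = q.+2 by exists (primorial y - 2)%N; lia.
have modP n : ((n%:R : 'Z_q.+2) : nat) = (n %% primorial y)%N by rewrite Mq val_Zp_nat.
have chiP n : chi0 (n%:R : 'Z_q.+2) = (coprime (primorial y) n)%:R :> R by rewrite chi0_natr Mq.
have valP (a : 'Z_q.+2) : ((a : nat)%:R : 'Z_q.+2) = a by rewrite natr_Zp.
pose h (a : 'Z_q.+2) : R := side_sum l y a.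
have hN (a : 'Z_q.+2) : h (- a) = - h a.
  have -> : - a = ((primorial y - a)%N%:R : 'Z_q.+2).
    rewrite natrB; last by rewrite Mq ltnW// (ltn_ord a).
    by rewrite valP Mq pchar_Zp// sub0r.
  rewrite /h modP side_sum_mod// side_sum_opp//.
  by rewrite Mq ltnW// (ltn_ord a).
have hE n : h n%:R = side_sum l y n by rewrite /h modP side_sum_mod.
move=> conc.
pose g (a : 'Z_q.+2) : R := chi0 a * ((d <= h a)%R%:R - (h a <= - d)%R%:R).
have gN (a : 'Z_q.+2) : g (- a) = - g a.
  by rewrite /g /chi0 unitrN hN lerNr lerN2 -mulrN opprB.
have gm : mean0 g.
  split; first by move=> a aU; rewrite /g chi0_unit_supp// mul0r.
  have : \sum_a g a = - \sum_a g a.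
    by rewrite -[RHS]sumrN (reindex_inj oppr_inj) /=; apply: eq_bigr => a _; exact: gN.
  lra.
pose f (a : 'Z_q.+2) : R := chi0 a * (`|h a| < d)%R%:R.
have f0 (a : 'Z_q.+2) : 0 <= f a by rewrite mulr_ge0.
have fs : unit_supp f by move=> a aU; rewrite /f chi0_unit_supp// mul0r.
have sumZ (F : 'Z_q.+2 -> R) : \sum_a F a = \sum_(0 <= n < primorial y) F n%:R.
  by rewrite Mq big_mkord; apply: eq_bigr => a _; rewrite valP.
have phiE : @phiM R q = (totient (primorial y))%:R.
  by rewrite /phiM sumZ totient_count_coprime natr_sum; apply: eq_bigr => n _; exact: chiP.
have fe : (\sum_a f a) / @phiM R q <= e.
  rewrite ler_pdivrMr ?phiM_gt0// phiE sumZ; apply: le_trans conc.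
  by apply: ler_sum => n _; rewrite /f chiP hE.
have [N1 hN1] := sum_mean0_primes gm e0; have [N2 hN2] := sum_class_primes_le f0 fs e0.
exists (N1 + N2)%N => N NN; split.
  have := hN1 N (leq_trans (leq_addr _ _) NN); apply: le_trans.
  by rewrite le_eqVlt; apply/orP; left; apply/eqP; congr `|_|; apply: eq_bigr => n _; rewrite /g chiP hE.
have := hN2 N (leq_trans (leq_addl _ _) NN); rewrite (eq_bigr (fun n => (prime n)%:R *
    ((coprime (primorial y) n)%:R * (`|side_sum l y n| < d)%R%:R))); last first.
  by move=> n _; rewrite /f chiP hE.
move=> h2; apply: le_trans h2 _; rewrite ler_wpM2r ?prime_count_ge0//; lra.
Qed.

Definition shifted_count (P : nat -> nat -> bool) l N : R :=
  \sum_(1 <= n < N.+1)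
    [&& prime n, odd n & (l < n)%N && P (totient (n - l)) (totient (n + l))]%:R.

Lemma norm_indicators_le2 (a b c u v : bool) :
  `|a%:R - b%:R - c%:R * (u%:R - v%:R)| <= 2 :> R.
Proof.
by rewrite ler_norml; case: a b c u v => [] [] [] [] []; rewrite ?mul0r ?mul1r /=; lra.
Qed.

Lemma shifted_count_sum l (e : R) : (0 < l)%N -> 0 < e -> exists N0, forall N, (N0 <= N)%N ->
  [/\ `|shifted_count (fun a b => b < a)%N l N - shifted_count (fun a b => a < b)%N l N|
        <= e * prime_count N,
      shifted_count (fun a b => a == b) l N <= e * prime_count N &
      (1 - e) * prime_count N <= shifted_count (fun a b => b < a)%N l N +
         shifted_count (fun a b => a < b)%N l N + shifted_count (fun a b => a == b) l N
        <= prime_count N].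
Proof.
move=> l0 e0; have e8 : 0 < e / 16 by lra.
have [d d0 [w hw]] := side_sum_concentration l0 e8.
(* The factor d compensates for Markov's inequality at height d / 4 below. *)
have e2 : 0 < e * d / 64 by rewrite divr_gt0// mulr_gt0.
have [y0 hy0] := large_factor_tail l0 e2.
pose y := (w + y0 + 2)%N.
have y1 : (1 < y)%N by rewrite /y addn2.
have conc := hw y ltac:(rewrite /y; lia) 0.
have {}conc : \sum_(0 <= a < primorial y) (coprime (primorial y) a)%:R * (`|side_sum l y a| < d)%R%:R
    <= e / 16 * (totient (primorial y))%:R.
  by apply: le_trans conc; apply: ler_sum => a _; rewrite add0r.
have [N1 hN1] := side_sum_class_sums e8 d0 y1 conc.
have [N2 hN2] := hy0 y ltac:(rewrite /y; lia).
(* A prime n past [P0] is odd, exceeds l, is prime to the primorial of y, and satisfies 4 l <= d (n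
   - l). *)
pose P0 := (y + l + (Num.truncn (4 * l%:R / d)).+1)%N.
have [N3 hN3] := prime_count_gt (16 * P0%:R / e).
exists (N1 + N2 + N3 + P0)%N => N NN.
have [n1 n2] := hN1 N ltac:(by apply: leq_trans NN; rewrite -!addnA leq_addr).
have n3 := hN2 N ltac:(by apply: leq_trans NN; rewrite -!addnA addnCA leq_addr).
have n4 := hN3 N ltac:(by apply: leq_trans NN; rewrite addnAC leq_addl).
have PN : (P0 <= N)%N by apply: leq_trans NN; rewrite leq_addl.
have yP : (y < P0)%N by rewrite /P0 addnS ltnS -addnA leq_addr.
have lP : (l < P0)%N by rewrite /P0 addnS ltnS addnAC leq_addl.
(* A majorant of the exceptional primes: at least 1 if n <= P0, if the side sum is below d, or if
   the large-factor sum is at least d / 4. The three parts total at most (1 + 2 + 1) * e / 16 times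
   prime_count N. *)
pose bad n : R := (n <= P0)%N%:R + (prime n)%:R * ((coprime (primorial y) n)%:R *
    (`|side_sum l y n| < d)%R%:R) + 4 / d * ((prime n && (l < n)%N)%:R * large_factor_sum l y N n).
have bad0 n : 0 <= bad n.
  by rewrite !addr_ge0 ?mulr_ge0 ?invr_ge0 ?large_factor_sum_ge0 ?(ltW d0).
have badP n : (1 <= n < N.+1)%N -> prime n -> 1 <= bad n \/
    [/\ (P0 < n)%N, coprime (primorial y) n,
      (totient (n - l) > totient (n + l))%N = (d <= side_sum l y n),
      (totient (n - l) < totient (n + l))%N = (side_sum l y n <= - d) &
      (totient (n - l) == totient (n + l)) = false].
  move=> /andP[n_gt0 nN] pn.
  have c3 : 0 <= 4 / d * ((prime n && (l < n)%N)%:R * large_factor_sum l y N n).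
    by rewrite !mulr_ge0 ?invr_ge0 ?large_factor_sum_ge0 ?(ltW d0).
  have c2 : 0 <= (prime n)%:R * ((coprime (primorial y) n)%:R * (`|side_sum l y n| < d)%R%:R) :> R.
    by rewrite !mulr_ge0.
  case: (leqP n P0) => nP.
    by left; rewrite /bad nP -addrA lerDl addr_ge0.
  have cn : coprime (primorial y) n by rewrite coprime_primorial// (ltn_trans yP).
  case: (ltP `|side_sum l y n| d) => hd.
    left; apply: le_trans (_ : (prime n)%:R * ((coprime (primorial y) n)%:R *
      (`|side_sum l y n| < d)%R%:R) <= _); first by rewrite hd cn pn !mul1r.
    by rewrite /bad addrAC lerDr addr_ge0.
  have l_n : (l < n)%N by apply: ltn_trans nP.
  case: (ltP (4 * large_factor_sum l y N n) d) => hl; last first.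
    left; rewrite /bad; apply: le_trans (_ : 4 / d * ((prime n && (l < n)%N)%:R * large_factor_sum l y N n) <= _).
      by rewrite pn l_n mul1r mulrAC ler_pdivlMr// mul1r.
    by rewrite lerDr addr_ge0.
  right; have [h1 h2 h3] : [/\ (totient (n - l) > totient (n + l))%N = (d <= side_sum l y n),
      (totient (n - l) < totient (n + l))%N = (side_sum l y n <= - d) &
      (totient (n - l) == totient (n + l)) = false].
    apply: (@totient_order_side_sum _ l y n N d) => //.
    - by rewrite mul2n -addnn leq_add// (leq_trans (ltnW lP)).
    - by rewrite (leq_trans (ltnW yP))// (leq_trans PN)// leq_pmull.
    rewrite -ler_pdivrMl// mulrC; apply: le_trans (ltW (truncnS_gt _)) _.
    by rewrite ler_nat leq_subRL ?(ltnW l_n)// (leq_trans _ (ltnW nP))// /P0 leq_add2r leq_addl.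
  by split.
have badsum : \sum_(1 <= n < N.+1) bad n <= e / 4 * prime_count N.
  rewrite /bad !big_split /= -mulr_sumr.
  have s1 : \sum_(1 <= n < N.+1) (n <= P0)%N%:R <= P0%:R :> R.
    rewrite (big_cat_nat _ (n := P0.+1))//= [X in _ + X]big1_seq; last first.
      by move=> i /andP[_]; rewrite mem_index_iota => /andP[hi _]; rewrite leqNgt hi.
    rewrite addr0; apply: (@le_trans _ _ (\sum_(1 <= i < P0.+1) 1)).
      by apply: ler_sum => i _; rewrite lern1 leq_b1.
    by rewrite sumr_const_nat subn1.
  have s2 : P0%:R <= e / 16 * prime_count N.
    by move: n4; rewrite ler_pdivrMr// => n4; rewrite mulrAC ler_pdivlMr// mulrC (mulrC e).
  have s3 : 4 / d * (e * d / 64 * prime_count N) = e / 16 * prime_count N by field; rewrite gt_eqF.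
  have s4 := ler_wpM2l (_ : 0 <= 4 / d) n3.
  have {}s4 := s4 ltac:(by rewrite divr_ge0// ltW).
  by move: s1 s2 s4 n2; rewrite s3; lra.
have pc0 := @prime_count_ge0 R N; have epc : 0 <= e * prime_count N by rewrite mulr_ge0// ltW.
have odd_P n : (P0 < n)%N -> prime n -> odd n && (l < n)%N.
  move=> nP pn; rewrite (ltn_trans lP nP) andbT.
  case: (even_prime pn) => // n2'; have := ltn_trans (leq_ltn_trans y1 yP) nP.
  by rewrite n2'.
split.
- rewrite /shifted_count -sumrB.
  set S := \sum_(_ <= _ < _) _.
  set T := \sum_(_ <= _ < _) _ in n1.
  have ST : `|S - T| <= 2 * \sum_(1 <= n < N.+1) bad n.
    rewrite /S /T -sumrB mulr_sumr; apply: le_trans (ler_norm_sum _ _ _) _.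
    apply: ler_sum_nat => n nN; case: (boolP (prime n)) => pn /=; last first.
      by rewrite mul0r !subr0 normr0 mulr_ge0.
    have [b1|[nP cn hgt hlt _]] := badP n nN pn.
      rewrite mul1r; apply: (@le_trans _ _ 2); last by rewrite ler_peMr.
      exact: norm_indicators_le2.
    rewrite cn hgt hlt !mul1r; have /andP[-> ->] := odd_P n nP pn.
    by rewrite /= subrr normr0 mulr_ge0.
  have := ler_normD (S - T) T; rewrite subrK; lra.
- apply: (@le_trans _ _ (\sum_(1 <= n < N.+1) bad n)); last by lra.
  apply: ler_sum_nat => n nN; case: (boolP (prime n)) => pn //=.
  have [b1|[_ _ _ _ ->]] := badP n nN pn; last by rewrite !andbF.
  by apply: le_trans b1; rewrite lern1 leq_b1.
rewrite /shifted_count -!big_split /=; apply/andP; split.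
  rewrite mulrBl mul1r lerBlDr; apply: (@le_trans _ _ (\sum_(1 <= n < N.+1)
      ([&& prime n, odd n & (l < n)%N && (totient (n + l) < totient (n - l))%N]%:R +
       [&& prime n, odd n & (l < n)%N && (totient (n - l) < totient (n + l))%N]%:R +
       [&& prime n, odd n & (l < n)%N && (totient (n - l) == totient (n + l))]%:R + bad n))).
    apply: ler_sum_nat => n nN; case: (boolP (prime n)) => pn /=; last by rewrite !add0r.
    have [b1|[nP _ _ _ _]] := badP n nN pn; first by apply: le_trans b1 _; rewrite lerDr !addr_ge0.
    have /andP[-> ->] := odd_P n nP pn; rewrite /=.
    by case: ltngtP => _; rewrite /= ?addr0 ?add0r lerDl.
  by rewrite big_split /= lerD2l; lra.
apply: ler_sum => n _; case: (prime n) => /=; last by rewrite !add0r.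
case: (odd n) => /=; last by rewrite !add0r.
by case: (l < n)%N => /=; [case: ltngtP => _|]; rewrite /= ?addr0 ?add0r.
Qed.

Lemma shifted_count_half l (e : R) : (0 < l)%N -> 0 < e -> exists N0, forall N, (N0 <= N)%N ->
  [/\ `|shifted_count (fun a b => b < a)%N l N - 2^-1 * prime_count N| <= e * prime_count N,
      `|shifted_count (fun a b => a < b)%N l N - 2^-1 * prime_count N| <= e * prime_count N &
      shifted_count (fun a b => a == b) l N <= e * prime_count N].
Proof.
move=> l0 e0; have e2 : 0 < e / 2 by lra.
have [N0 hN0] := shifted_count_sum l0 e2; exists N0 => N /hN0[h1 h2 /andP[h3 h4]].
have s0 : 0 <= shifted_count (fun a b => a == b) l N by apply: sumr_ge0.
have p0 : 0 <= e * prime_count N by rewrite mulr_ge0 ?(ltW e0)// prime_count_ge0.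
move: h1; rewrite ler_norml => /andP[h1 h1'].
by split; rewrite ?ler_norml; [apply/andP; split|apply/andP; split|]; lra.
Qed.

Lemma card_upto_sum (P : pred nat) (x : R) : 0 <= x -> ~~ P 0%N ->
  (card_upto P x)%:R = \sum_(1 <= n < (Num.truncn x).+1) (P n)%:R :> R.
Proof.
move=> x0 P0; rewrite /card_upto size_filter -sum1_count natr_sum big_mkcond /=.
rewrite big_cons (negbTE P0) /= add0r -[iota 1 _]/(iota 1 _.+1.-1) -subn1 -/(index_iota 1 _).
apply: eq_big_nat => n /andP[n1 nx]; rewrite -truncn_ge_nat// -ltnS nx andbT.
by case: (P n).
Qed.

Lemma prime_pi_count (x : R) : 0 <= x -> prime_pi x = prime_count (Num.truncn x).
Proof. by move=> x0; rewrite /prime_pi card_upto_sum. Qed.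

Lemma odd_prime_count_shifted (P : nat -> nat -> bool) l (x : R) : 0 <= x ->
  odd_prime_count (fun p => (l < p)%N && P (totient (p - l)) (totient (p + l))) x =
  shifted_count P l (Num.truncn x).
Proof. by move=> x0; rewrite /odd_prime_count card_upto_sum. Qed.

Lemma near_pinfty_truncn (Q : R -> Prop) N0 :
  (forall x, 0 <= x -> (N0 <= Num.truncn x)%N -> Q x) -> \forall x \near +oo, Q x.
Proof.
move=> h; exists N0%:R; split; first exact: num_real.
move=> x Nx; have x0 : 0 <= x by apply: le_trans (ltW Nx).
by apply: h; rewrite ?truncn_ge_nat// ltW.
Qed.

End PrimeSigns.

Theorem theorem1p1 (R : realType) (l : nat) (l_gt0 : (0 < l)%N) :
  [/\ asymp
        (odd_prime_count
           (fun p => (l < p)%N && (totient (p - l) > totient (p + l))%N))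
        (fun x : R => 2^-1 * prime_pi x),
      asymp
        (odd_prime_count
           (fun p => (l < p)%N && (totient (p - l) < totient (p + l))%N))
        (fun x : R => 2^-1 * prime_pi x)
    & odd_prime_count
        (fun p => (l < p)%N && (totient (p - l) == totient (p + l)))
      =o_ (pinfty_nbhs R) (@prime_pi R)].
Proof.
have half (P : nat -> nat -> bool) : (forall e : R, 0 < e -> exists N0, forall N, (N0 <= N)%N ->
      `|shifted_count P l N - 2^-1 * prime_count N| <= e * prime_count N) ->
    asymp (odd_prime_count (fun p => (l < p)%N && P (totient (p - l)) (totient (p + l))))
      (fun x : R => 2^-1 * prime_pi x).
  move=> hP; apply/cvgrPdist_le => e e0; have e2 : 0 < e / 2 by lra.
  have [N0 hN0] := hP _ e2; have [N1 hN1] := @prime_count_gt R 1.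
  apply: (@near_pinfty_truncn _ _ (N0 + N1)) => x x0 xN.
  rewrite odd_prime_count_shifted// prime_pi_count//.
  have h1 := hN0 _ (leq_trans (leq_addr _ _) xN); have h2 := hN1 _ (leq_trans (leq_addl _ _) xN).
  set p := prime_count _ in h1 h2 *; have p0 : 0 < 2^-1 * p by lra.
  rewrite -[X in `|X - _|](divff (lt0r_neq0 p0)) -mulrBl normrM (ger0_norm (_ : 0 <= (2^-1 * p)^-1)).
    by rewrite ler_pdivrMr// distrC; lra.
  by rewrite invr_ge0 ltW.
split.
- apply: (half (fun a b => b < a)%N) => e e0.
  by have [N0 hN0] := shifted_count_half l_gt0 e0; exists N0 => N /hN0[].
- apply: (half (fun a b => a < b)%N) => e e0.
  by have [N0 hN0] := shifted_count_half l_gt0 e0; exists N0 => N /hN0[].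
apply/eqoP => e e0; have [N0 hN0] := shifted_count_half l_gt0 e0.
apply: (@near_pinfty_truncn _ _ N0) => x x0 xN; have [_ _ h] := hN0 _ xN.
rewrite (@odd_prime_count_shifted _ (fun a b => a == b))// prime_pi_count//.
rewrite (ger0_norm (prime_count_ge0 _)) ger0_norm//.
exact: sumr_ge0.
Qed.
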